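(* Let $m\ge 2$ be a fixed integer, $\lambda>1$ a constant, $p=\lambda\log(n)/n$, $\alpha=\alpha_n\in(0,\tfrac12]$, and let $G$ be a realization of the random digraph ${\rm DBM}(n,m,p,\alpha)$, with vertex set $V$. Let $t_{\rm ent}$ be the entropic time. Let $\mathbf P^G_x$ be the quenched law of the simple random walk on $G$ started at $x$, and $\pi$ its stationary distribution. As $n\to\infty$ the following holds. (Subcritical case) If $\alpha^{-1}\ll t_{\rm ent}$ and $\alpha\le\frac12$, then for all $\beta>0$ with $\beta\ne1$, $$\max_{x\in V}\Big|\big\|\mathbf P^G_x(X_{\beta t_{\rm ent}}\in\cdot)-\pi\big\|_{\rm TV}-\mathbf 1_{\{\beta<1\}}\Big|\longrightarrow 0\quad\text{in probability.}$$ (Critical case) If $\alpha^{-1}\sim C\,t_{\rm ent}$ for some constant $C>0$, then for all $\beta>0$ with $\beta\neq1$, $$\max_{x\in V}\Big|\big\|\mathbf P^G_x(X_{\beta t_{\rm ent}}\in\cdot)-\pi\big\|_{\rm TV}-\mathbf 1_{\{\beta<1\}}-\tfrac{m-1}{m}e^{-\frac{\beta}{C}\frac{m}{m-1}}\mathbf 1_{\{\beta>1\}}\Big|\longrightarrow 0\quad\text{in probability.}$$ (Supercritical case) If $\alpha^{-1}\gg t_{\rm ent}$ and $\alpha^{-1}\ll\lambda n\log(n)$, then: (a) for any $\beta>0$ with $\beta\neq1$, $$\max_{x\in V}\Big|\big\|\mathbf P^G_x(X_{\beta t_{\rm ent}}\in\cdot)-\pi\big\|_{\rm TV}-\mathbf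 1_{\{\beta<1\}}-\tfrac{m-1}{m}\mathbf 1_{\{\beta>1\}}\Big|\longrightarrow 0\quad\text{in probability;}$$ (b) for any $\beta>0$, $$\max_{x\in V}\Big|\big\|\mathbf P^G_x(X_{\beta\alpha^{-1}}\in\cdot)-\pi\big\|_{\rm TV}-\tfrac{m-1}{m}e^{-\frac{\beta m}{m-1}}\Big|\longrightarrow 0\quad\text{in probability.}$$
   Context: Directed Block Model ${\rm DBM}(n,m,p,\alpha)$. (1) Let $G_1=(V_1,E_1),\dots,G_m=(V_m,E_m)$ be independent directed Erdős–Rényi graphs on disjoint vertex sets $V_i=\{x^{(i)}:x\in\{1,\dots,n\}\}$ (the communities): each ordered pair of distinct vertices of $V_i$ is an edge of $G_i$ independently with probability $p$. (2) Independently for each edge $(x^{(i)},y^{(i)})$ of each $G_i$, with probability $\alpha$ the edge is rewired: it is removed and replaced by $(x^{(i)},y^{(j)})$, where $j$ is uniform in $\{1,\dots,m\}\setminus\{i\}$. The resulting digraph on $V=V_1\sqcup\dots\sqcup V_m$ is $G=(V,E)$. Its law is $\mathbb P$, with expectation $\mathbb E$. The simple random walk on $G$ is the discrete-time Markov chain that at each step moves along a uniformly chosen out-edge of the current vertex (and stays put at a vertex with no out-edge); $\mathbf P^G_\mu$ is its (random, quenched) law given $G$ with initial law $\mu$, and $\mathbf P^G_x$ means $\mu=\delta_x$. $\pi$ is its stationary distribution if unique, and the uniform distribution on $V$ otherwise. Entropy: ${\rm H}=\mathbb E[\log(D_x^+\vee1)]$, where $D_x^+$ is the out-degree of any vertex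 $x$ (its law does not depend on $x$). Entropic time: $t_{\rm ent}=\log(n)/{\rm H}$. Non-integer times are replaced by their integer parts. $\|\cdot\|_{\rm TV}$ is the total variation norm (half the $\ell^1$ norm). Asymptotics are for $n\to\infty$: $a\ll b$ (equivalently $b\gg a$) means $a/b\to0$; $a\sim b$ means $a/b\to1$. Convergence in probability is with respect to $\mathbb P$. *)

(* Defs.v *)
From HB Require Import structures.
From mathcomp Require Export all_boot all_order all_algebra.
From mathcomp Require Export perm.
From mathcomp Require Export all_classical all_reals all_analysis.

Set Implicit Arguments.
Unset Strict Implicit.
Unset Printing Implicit Defensive.

Export Order.TTheory GRing.Theory Num.Theory numFieldNormedType.Exports.
Local Open Scope classical_set_scope.
Local Open Scope ring_scope.

(* The vertex x^(i) is the pair (i, x). *)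
Definition vertex (m n : nat) : finType := ('I_m * 'I_n)%type.

Definition digraph (m n : nat) : finType := {set vertex m n * vertex m n}.

(* A slot (i, x, y) stands for the ordered pair (x^(i), y^(i)) of V_i. It carries
   a mark (e, r, j): e tells whether the pair is an edge of G_i, r whether this
   edge is to be rewired, and j is the community of the new endpoint. The fields
   r and j are drawn for all slots but are used only for the edges, and the slots
   with x = y are ignored, so that this samples the model. *)
Definition slot (m n : nat) : finType := ('I_m * 'I_n * 'I_n)%type.

Definition mark (m : nat) : finType := (bool * bool * 'I_m)%type.

Definition config (m n : nat) : finType := {ffun slot m n -> mark m}.

Definition graph_of (m n : nat) (w : config m n) : digraph m n :=
  [set a | let: ((i, x), (j, y)) := a in
           let: (e, r, k) := w (i, x, y) in
           [&& x != y, e & j == (if r then k else i)]]%SET.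

Definition mark_weight (R : realType) (m : nat) (p alpha : R) (i : 'I_m)
    (c : mark m) : R :=
  let: (e, r, k) := c in
  (if e then p else 1 - p) * (if r then alpha else 1 - alpha)
    * (if k != i then (m%:R - 1)^-1 else 0).

Definition config_weight (R : realType) (m n : nat) (p alpha : R)
    (w : config m n) : R :=
  \prod_(s : slot m n) mark_weight p alpha s.1.1 (w s).

(* The probability mass function of DBM(n, m, p, alpha). It sums to 1 for all real
   p and alpha (see [sum_dbm]), but is nonnegative only for p and alpha in [0, 1];
   with p = lambda log(n) / n this holds for all large n. *)
Definition dbm (R : realType) (m n : nat) (p alpha : R) (G : digraph m n) : R :=
  \sum_(w | graph_of w == G) config_weight p alpha w.

Definition dbm_pr (R : realType) (m n : nat) (p alpha : R)
    (A : pred (digraph m n)) : R :=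
  \sum_(G | A G) dbm p alpha G.

Definition dbm_mean (R : realType) (m n : nat) (p alpha : R)
    (f : digraph m n -> R) : R :=
  \sum_G dbm p alpha G * f G.

Definition outdeg (m n : nat) (G : digraph m n) (u : vertex m n) : nat :=
  #|[set v | (u, v) \in G]%SET|.

(* A vertex without out-edges is absorbing. *)
Definition transition (R : realType) (m n : nat) (G : digraph m n)
    (u v : vertex m n) : R :=
  if outdeg G u == 0%N then (v == u)%:R
  else ((u, v) \in G)%:R / (outdeg G u)%:R.

Definition srw_step (R : realType) (m n : nat) (G : digraph m n)
    (mu : {ffun vertex m n -> R}) : {ffun vertex m n -> R} :=
  [ffun v => \sum_u mu u * transition R G u v].

Definition srw_law (R : realType) (m n : nat) (G : digraph m n)
    (mu : {ffun vertex m n -> R}) (t : nat) : {ffun vertex m n -> R} :=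
  iter t (srw_step G) mu.

Definition point_mass (R : realType) (m n : nat) (x : vertex m n) :
    {ffun vertex m n -> R} :=
  [ffun v => (v == x)%:R].

Definition uniform_law (R : realType) (m n : nat) : {ffun vertex m n -> R} :=
  [ffun=> #|vertex m n|%:R^-1].

Definition stationary (R : realType) (m n : nat) (G : digraph m n)
    (mu : {ffun vertex m n -> R}) : Prop :=
  [/\ forall v, 0 <= mu v, \sum_v mu v = 1 & srw_step G mu = mu].

(* [xget x0 A] is an element of A, or x0 if A is empty. *)
Definition stat_law (R : realType) (m n : nat) (G : digraph m n) :
    {ffun vertex m n -> R} :=
  xget (uniform_law R m n)
    [set mu | stationary G mu /\ forall nu, stationary G nu -> nu = mu].

Definition tv_dist (R : realType) (m n : nat)
    (mu nu : {ffun vertex m n -> R}) : R :=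
  2^-1 * \sum_v `|mu v - nu v|.

Definition tv_to_stat (R : realType) (m n : nat) (G : digraph m n)
    (x : vertex m n) (t : nat) : R :=
  tv_dist (srw_law G (point_mass R x) t) (stat_law R G).

Definition entropy_at (R : realType) (m n : nat) (p alpha : R)
    (x : vertex m n) : R :=
  dbm_mean p alpha (fun G => ln (maxn (outdeg G x) 1)%:R).

(* The vertex picked is immaterial, see [entropyE]. *)
Definition entropy (R : realType) (m n : nat) (p alpha : R) : R :=
  if [pick x : vertex m n] is Some x then entropy_at p alpha x else 0.

Definition edge_prob (R : realType) (lambda : R) (n : nat) : R :=
  lambda * ln n%:R / n%:R.

Definition t_ent (R : realType) (m : nat) (lambda : R) (alpha : nat -> R)
    (n : nat) : R :=
  ln n%:R / entropy m n (edge_prob lambda n) (alpha n).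

Definition much_less (R : realType) (a b : nat -> R) : Prop :=
  a n / b n @[n --> \oo] --> (0 : R).

Definition asymp_equiv (R : realType) (a b : nat -> R) : Prop :=
  a n / b n @[n --> \oo] --> (1 : R).

(* Convergence to 0 in probability, G_n being a DBM(n, m, p n, alpha n). *)
Definition cvg_in_pr0 (R : realType) (m : nat) (p alpha : nat -> R)
    (Z : forall n : nat, digraph m n -> R) : Prop :=
  forall eps : R, 0 < eps ->
    dbm_pr (p n) (alpha n) (fun G : digraph m n => eps < `|Z n G|) @[n --> \oo]
      --> (0 : R).

Definition max_tv_gap (R : realType) (m n : nat) (G : digraph m n) (t : nat)
    (l : R) : R :=
  \big[Num.max/0]_(x : vertex m n) `|tv_to_stat R G x t - l|.

Lemma dbm_meanE (R : realType) (m n : nat) (p alpha : R)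
    (f : digraph m n -> R) :
  dbm_mean p alpha f = \sum_(w : config m n) config_weight p alpha w * f (graph_of w).
Proof.
rewrite (partition_big (@graph_of m n) xpredT) //=.
by apply: eq_bigr => G _; rewrite mulr_suml; apply: eq_bigr => w /eqP ->.
Qed.

Lemma sum_dbm (R : realType) (m n : nat) (p alpha : R) (hm : (1 < m)%N) :
  \sum_(G : digraph m n) dbm p alpha G = 1.
Proof.
rewrite /dbm.
transitivity (\sum_(w : config m n) config_weight p alpha w).
  by rewrite (partition_big (@graph_of m n) xpredT).
rewrite /config_weight.
rewrite -(bigA_distr_bigA (fun s => mark_weight p alpha s.1.1)).
apply: big1 => -[[i x] y] _ /=.
transitivity (\sum_(e : bool) \sum_(r : bool) \sum_(k : 'I_m)
    mark_weight p alpha i (e, r, k)).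
  by rewrite !pair_bigA /=; apply: eq_bigr => -[[e r] k].
have sum_k : \sum_(k : 'I_m) (if k != i then (m%:R - 1)^-1 else 0) = 1 :> R.
  rewrite -big_mkcond /= sumr_const cardC1 card_ord -[_ *+ _]mulr_natr.
  rewrite -subn1 natrB 1?ltnW // mulVf // subr_eq0 -[1]/(1%:R) eqr_nat.
  by rewrite gtn_eqF.
rewrite /mark_weight !big_bool /= -!mulr_sumr sum_k !mulr1 -!mulrDr.
by rewrite [alpha + _]addrC subrK !mulr1 addrC subrK.
Qed.

Lemma entropyE (R : realType) (m n : nat) (p alpha : R) (x : vertex m n) :
  entropy m n p alpha = entropy_at p alpha x.
Proof.
rewrite /entropy; case: pickP => [y _|/(_ x)//].
case: x y => [i x] [j y].
pose s := tperm i j; pose t := tperm x y.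
pose h (w : config m n) : config m n :=
  [ffun z => let: (e, r, k) := w (s z.1.1, t z.1.2, t z.2) in (e, r, s k)].
have hK : involutive h.
  move=> w; apply/ffunP => -[[k a] b]; rewrite !ffunE /= !tpermK.
  by case: (w _) => -[e r] l; rewrite tpermK.
rewrite /entropy_at !dbm_meanE (reindex_inj (inv_inj hK)) /=.
apply: eq_bigr => w _; congr (_ * ln (maxn _ _)%:R).
  rewrite /config_weight.
  pose g (z : slot m n) : slot m n := (s z.1.1, t z.1.2, t z.2).
  have gK : involutive g by move=> [[k a] b]; rewrite /g /= !tpermK.
  rewrite [RHS](reindex_inj (inv_inj gK)) /=.
  apply: eq_bigr => -[[k a] b] _; rewrite /h ffunE /g /=.
  case: (w _) => -[e r] l /=; congr (_ * _).
  by rewrite -(inj_eq (@perm_inj _ s) l) tpermK.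
rewrite /outdeg.
pose f (v : vertex m n) : vertex m n := (s v.1, t v.2).
have fK : involutive f by move=> [k a]; rewrite /f /= !tpermK.
rewrite -[RHS](card_imset _ (inv_inj fK)); apply: eq_card => -[k a].
rewrite -[X in _ = (X \in _)]fK (mem_imset _ _ (inv_inj fK)) !inE /f /h ffunE /=.
rewrite /s /t !tpermR -/s -/t.
case: (w _) => -[e r] l /=.
have -> : (x != t a) = (y != a).
  by rewrite -(inj_eq (@perm_inj _ t)) tpermK /t tpermL.
congr [&& _, _ & _].
by rewrite -(inj_eq (@perm_inj _ s)); case: r; rewrite ?tpermK // /s tpermR.
Qed.

(* Main.v *)
Require Import Defs.
From mathcomp Require Import ring lra zify.

Set Implicit Arguments.
Unset Strict Implicit.
Unset Printing Implicit Defensive.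

Local Open Scope classical_set_scope.
Local Open Scope ring_scope.

(** Why the theorem is true.

    Put L = ln n. Degrees are of order L, so H is asymptotic to ln L and the
    entropic time to tau = L / ln L (see near_t_ent). Two clocks run: mixing
    inside the communities, which happens at tau, and motion between the
    communities, whose rate is alpha.

    Mixing inside the communities. Split the transition operator P of the walk
    as E + B: B replaces the edge indicators by their means, before the division
    by the out-degree, and E is the rest. Then B f sees f only through its sums
    over the communities. A centred array of independent Bernoulli variables of
    mean of order L / n has operator norm at most L^(1/2 + eps), by the argument
    of Kahn and Szemeredi (bernoulli_opnorm): pairs of small weight by a net and
    an exponential moment, pairs of large weight by a bound on the number of
    edges in every rectangle. As the degrees are at least a constant times L,
    which uses lambda > 1 (degree_whp), E has norm at most L^(eps - 1/2).
    Expanding P^t (iwalk_expand), for |f| <= 1 with zero sum over each community,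
    |P^t f| is at most L^((eps - 1/2) t) times the square root of m n, plus a
    vanishing term. The product is small exactly when t exceeds
    (1 + eta) tau (rate_pow_small), and no loss occurs in the constant. So after
    (1 + eta) tau steps the law of the walk is close, in total variation, to a
    law which depends only on the community (tv_community). Conversely, in
    (1 - eta) tau steps the walk can reach at most (C L)^t = o(n) vertices, whence
    the distance 1 (tv_early_whp).

    Motion between the communities. Let h_j be the centred indicator of the
    community j. Then P h_j = rho h_j + g_j with rho = 1 - alpha m / (m - 1),
    where g_j(u) is the average over the out-edges of u of a centred function
    of their rewiring marks (walk_ind). Given the edges of the unrewired graph
    these marks are independent, with variance at most alpha, so that linear
    functionals of g_j whose coefficients depend on that graph alone obey
    Chernoff and Chebyshev bounds (cond_chernoff, cond_chebyshev). Everything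
    reduces to showing that P^t h_j - rho^t h_j, which is the sum of
    rho^(t-1-k) P^k g_j over k < t, is small. There are two cases.
    - If alpha tau tends to infinity, |P^k g_j| is o(alpha) for
      k >= (1 + eta) tau, by the expansion of P^k and the second moment of g_j;
      the geometric series in rho then gives o(1) (fast_whp).
    - If alpha tau is bounded, g_j is too large for this. But g_j is almost
      in the kernel of the unrewired walk P_0, and its P_0-potential phi, the sum
      of P_0^k g_j over about 16 tau steps, is uniformly small. Writing
      g_j = phi - P phi + (P - P_0) phi + o(alpha), the first difference
      telescopes along the walk and the second is charged to the expected number
      of rewired edges used, which is of order alpha t and so bounded
      (poisson_bound, slow_whp).

    Conclusion. At a time t >= (1 + eta) tau the law of the walk is close to the
    mixture with weight rho^t on the community of the starting point and uniform
    otherwise, whose distance to the uniform law is rho^t (m - 1) / m. With larger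
    times this also shows that the stationary law is close to uniform
    (stat_law_close). It remains to follow rho^t in the three regimes
    (rho_pow_cvg). *)

(** * Euclidean norms and bilinear bounds *)

Section L2.
Variable R : realType.
Implicit Types V W : finType.

Definition l2 V (f : V -> R) : R := Num.sqrt (\sum_v f v ^+ 2).

Lemma sum_sq_ge0 V (f : V -> R) : 0 <= \sum_v f v ^+ 2.
Proof. by apply: sumr_ge0 => v _; apply: sqr_ge0. Qed.

Lemma l2_ge0 V (f : V -> R) : 0 <= l2 f.
Proof. exact: sqrtr_ge0. Qed.

Lemma l2_sq V (f : V -> R) : l2 f ^+ 2 = \sum_v f v ^+ 2.
Proof. by rewrite sqr_sqrtr // sum_sq_ge0. Qed.

Lemma l2_le V (f : V -> R) (c : R) : 0 <= c -> \sum_v f v ^+ 2 <= c ^+ 2 -> l2 f <= c.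
Proof.
by move=> c0 h; rewrite -(ler_pXn2r (n := 2)) ?nnegrE ?l2_ge0 // l2_sq.
Qed.

Lemma cauchy_schwarz V (f g : V -> R) : `|\sum_v f v * g v| <= l2 f * l2 g.
Proof.
rewrite -(ler_pXn2r (n := 2)) ?nnegrE ?mulr_ge0 ?l2_ge0 //.
rewrite exprMn !l2_sq real_normK ?num_real //.
rewrite -subr_ge0.
have -> : (\sum_v f v ^+ 2) * (\sum_v g v ^+ 2) - (\sum_v f v * g v) ^+ 2 =
   2^-1 * \sum_u \sum_v (f u * g v - f v * g u) ^+ 2.
  have -> : \sum_u \sum_v (f u * g v - f v * g u) ^+ 2 =
     \sum_u \sum_v (f u ^+ 2 * g v ^+ 2) + \sum_u \sum_v (f v ^+ 2 * g u ^+ 2)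
     - 2 * \sum_u \sum_v (f u * g u) * (f v * g v).
    rewrite mulr_sumr -big_split -sumrB /=; apply: eq_bigr => u _.
    by rewrite mulr_sumr -big_split -sumrB /=; apply: eq_bigr => v _; ring.
  rewrite [X in _ + X - _]exchange_big /=.
  rewrite expr2 !mulr_suml.
  have e1 : \sum_i \sum_v f i ^+ 2 * g v ^+ 2 = \sum_i f i ^+ 2 * (\sum_v g v ^+ 2).
    by apply: eq_bigr => u _; rewrite mulr_sumr.
  have e2 : \sum_u \sum_v f u * g u * (f v * g v) = \sum_u f u * g u * \sum_v f v * g v.
    by apply: eq_bigr => u _; rewrite mulr_sumr.
  by rewrite e1 e2; lra.
by rewrite mulr_ge0 ?invr_ge0 //; apply: sumr_ge0 => u _; apply: sum_sq_ge0.
Qed.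

Lemma l2_abs_le V (f : V -> R) v : `|f v| <= l2 f.
Proof.
rewrite -(ler_pXn2r (n := 2)) ?nnegrE ?l2_ge0 // l2_sq real_normK ?num_real //.
by rewrite (bigD1 v) //= lerDl; apply: sumr_ge0 => u _; apply: sqr_ge0.
Qed.

Lemma l1_le_l2 V (f : V -> R) : \sum_v `|f v| <= Num.sqrt #|V|%:R * l2 f.
Proof.
have -> : \sum_v `|f v| = `|\sum_v (fun=> 1 : R) v * `|f v| |.
  rewrite ger0_norm; last by apply: sumr_ge0 => v _; rewrite mul1r.
  by apply: eq_bigr => v _; rewrite mul1r.
apply: le_trans (cauchy_schwarz _ _) _.
apply: ler_pM; rewrite ?l2_ge0 //; apply: l2_le; rewrite ?sqrtr_ge0 ?l2_ge0 //.
  rewrite sqr_sqrtr ?ler0n //; under eq_bigr do rewrite expr1n.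
  by rewrite sumr_const.
by rewrite l2_sq; under eq_bigr do rewrite real_normK ?num_real //.
Qed.

(** The index types may differ, so that blocks of a kernel between two
    communities are covered. *)
Definition kernel_apply V W (M : V -> W -> R) (f : W -> R) (u : V) : R := \sum_v M u v * f v.

Definition opbound V W (M : V -> W -> R) (b : R) : Prop :=
  forall (g : V -> R) (f : W -> R), `|\sum_u g u * kernel_apply M f u| <= b * (l2 g * l2 f).

(** Testing the bilinear bound against the image itself turns it into a bound
    on the operator norm. *)
Lemma opbound_apply V W (M : V -> W -> R) b f :
  0 <= b -> opbound M b -> l2 (kernel_apply M f) <= b * l2 f.
Proof.
move=> b0 hM; have [h0|h0] := eqVneq (l2 (kernel_apply M f)) 0.
  by rewrite h0 mulr_ge0 ?l2_ge0.
have h1 : 0 < l2 (kernel_apply M f) by rewrite lt_def h0 l2_ge0.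
have := hM (kernel_apply M f) f.
have -> : \sum_u kernel_apply M f u * kernel_apply M f u = l2 (kernel_apply M f) ^+ 2.
  by rewrite l2_sq; apply: eq_bigr => u _; rewrite expr2.
rewrite ger0_norm ?sqr_ge0 // expr2 mulrCA ler_pM2l //.
Qed.

End L2.

(** * Laws on a finite set *)

Section FiniteProbability.
Variable R : realType.
Implicit Types T : finType.

Definition is_law T (mu : T -> R) : Prop := (forall t, 0 <= mu t) /\ \sum_t mu t = 1.
Definition expect T (mu f : T -> R) : R := \sum_t mu t * f t.
(** Events are propositions, because the good events below quantify over real
    functions and are not decidable. *)
Definition prob T (mu : T -> R) (A : T -> Prop) : R := \sum_t mu t * `[< A t >]%:R.

Lemma prob_ge0 T (mu : T -> R) A : is_law mu -> 0 <= prob mu A.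
Proof. by move=> [m0 _]; apply: sumr_ge0 => t _; rewrite mulr_ge0. Qed.

Lemma ler_expect T (mu f g : T -> R) : is_law mu -> (forall t, f t <= g t) ->
  expect mu f <= expect mu g.
Proof. by move=> [m0 _] h; apply: ler_sum => t _; rewrite ler_wpM2l. Qed.

Lemma prob_le_expect T (mu f : T -> R) (A : T -> Prop) : is_law mu ->
  (forall t, 0 <= f t) -> (forall t, A t -> 1 <= f t) -> prob mu A <= expect mu f.
Proof.
move=> hmu f0 f1; apply: ler_expect => // t.
by case: asboolP => [/f1|_ //].
Qed.

Lemma prob_le T (mu : T -> R) (A B : T -> Prop) : is_law mu ->
  (forall t, A t -> B t) -> prob mu A <= prob mu B.
Proof.
move=> hmu h; apply: prob_le_expect => // t ht.
by have /asboolT -> := h t ht.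
Qed.

Lemma prob_or T (mu : T -> R) (A B : T -> Prop) : is_law mu ->
  prob mu (fun t => A t \/ B t) <= prob mu A + prob mu B.
Proof.
move=> hmu.
have -> : prob mu A + prob mu B =
    expect mu (fun t => `[< A t >]%:R + `[< B t >]%:R).
  by rewrite /prob -big_split /=; apply: eq_bigr => t _; rewrite -mulrDr.
apply: prob_le_expect => // t.
by case=> /asboolT ->; rewrite ?lerDl ?lerDr.
Qed.

Lemma prob_exists T (I : finType) (mu : T -> R) (A : I -> T -> Prop) : is_law mu ->
  prob mu (fun t => exists i, A i t) <= \sum_i prob mu (A i).
Proof.
move=> hmu.
have -> : \sum_i prob mu (A i) = expect mu (fun t => \sum_i `[< A i t >]%:R).
  rewrite /prob exchange_big /=; apply: eq_bigr => t _.
  by rewrite -mulr_sumr.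
apply: prob_le_expect => // [t|t]; first by rewrite sumr_ge0.
by move=> [i /asboolT hi]; rewrite (bigD1 i) //= hi lerDl sumr_ge0.
Qed.

(** The inequality is that of Markov for the exponential of the variable. *)
Lemma chernoff T (mu S : T -> R) (th a : R) : is_law mu -> 0 <= th ->
  prob mu (fun t => a <= S t) <= expR (- (th * a)) * expect mu (fun t => expR (th * S t)).
Proof.
move=> hmu th0.
have -> : expR (- (th * a)) * expect mu (fun t => expR (th * S t)) =
   expect mu (fun t => expR (th * (S t - a))).
  rewrite /expect mulr_sumr; apply: eq_bigr => t _.
  by rewrite mulrBr addrC expRD; ring.
apply: prob_le_expect => // t.
by move=> h; rewrite -expR0 ler_expR mulr_ge0 // subr_ge0.
Qed.

End FiniteProbability.

(** * Arrays with sub-Poisson exponential moments *)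

Section Exponentials.
Variable R : realType.

(** A second-order expansion for both signs of x; for bounded x the factor
    e^|x| is only a constant. *)
Lemma expR_quad (x : R) : expR x <= 1 + x + x ^+ 2 * expR `|x|.
Proof.
have [x0|x0] := leP 0 x.
  rewrite ger0_norm //.
  have h1 : expR x - 1 <= x * expR x.
    have : (1 - x) * expR x <= expR (- x) * expR x.
      by rewrite ler_wpM2r ?expR_ge0 //; exact: expR_ge1Dx.
    by rewrite -expRD addNr expR0; lra.
  have h2 : x * (expR x - 1) <= x * (x * expR x) by rewrite ler_wpM2l.
  rewrite expr2; nra.
have h1 : expR x <= 1 + x + x ^+ 2.
  have h2 : 1 - x <= expR (- x) by exact: expR_ge1Dx.
  have h3 : expR x * (1 - x) <= 1.
    apply: (@le_trans _ _ (expR x * expR (- x))); first by rewrite ler_wpM2l ?expR_ge0.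
    by rewrite -expRD addrN expR0.
  have h4 : 0 < 1 - x by lra.
  have h5 : 1 <= (1 + x + x ^+ 2) * (1 - x).
    have -> : (1 + x + x ^+ 2) * (1 - x) = 1 - x * x ^+ 2 by ring.
    have : 0 <= x ^+ 2 by exact: sqr_ge0.
    nra.
  by rewrite -(ler_pM2r h4); apply: le_trans h3 h5.
apply: le_trans h1 _; rewrite lerD2l ler_peMr ?sqr_ge0 //.
by rewrite -expR0 ler_expR.
Qed.

Lemma expR_quadB (x c : R) : `|x| <= c -> expR x - 1 <= x + x ^+ 2 * expR c.
Proof.
move=> h; have := expR_quad x.
have : x ^+ 2 * expR `|x| <= x ^+ 2 * expR c by rewrite ler_wpM2l ?sqr_ge0 // ler_expR.
lra.
Qed.
End Exponentials.

Section SubPoisson.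
Variables (R : realType) (T : finType) (mu : T -> R) (hmu : is_law mu).
Variables (n : nat) (X : T -> 'I_n -> 'I_n -> bool) (q : R).

(** The exponential moments are bounded by those of independent Poisson
    variables of mean q. Independent Bernoulli variables of mean q satisfy
    this, as 1 + q (e^a - 1) <= e^(q (e^a - 1)); it is all that the upper and
    lower tails below need, and it spares any mention of independence. *)
Definition subpoisson : Prop := forall th : 'I_n -> 'I_n -> R,
  expect mu (fun w => expR (\sum_x \sum_y th x y * (X w x y)%:R))
    <= expR (q * \sum_x \sum_y (expR (th x y) - 1)).

Hypothesis hX : subpoisson.
Hypothesis q0 : 0 <= q.

Definition edges (Q : 'I_n -> 'I_n -> bool) (w : T) : R :=
  \sum_x \sum_y (Q x y)%:R * (X w x y)%:R.

Definition area (Q : 'I_n -> 'I_n -> bool) : R := \sum_x \sum_y (Q x y)%:R.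

Lemma edges_mgf Q (th : R) :
  expect mu (fun w => expR (th * edges Q w)) <= expR (q * (area Q * (expR th - 1))).
Proof.
have := hX (fun x y => th * (Q x y)%:R).
congr (_ <= _).
  apply: eq_bigr => w _; congr (_ * expR _).
  rewrite /edges mulr_sumr; apply: eq_bigr => x _.
  by rewrite mulr_sumr; apply: eq_bigr => y _; rewrite mulrA.
congr (expR (q * _)); rewrite /area mulr_suml; apply: eq_bigr => x _.
rewrite mulr_suml; apply: eq_bigr => y _.
by case: (Q x y); rewrite ?mulr1 ?mul1r // mulr0 mul0r expR0 subrr.
Qed.

Lemma edges_upper Q (th a : R) : 0 <= th ->
  prob mu (fun w => a <= edges Q w) <= expR (- (th * a) + q * (area Q * (expR th - 1))).
Proof.
move=> th0; apply: le_trans (chernoff _ _ hmu th0) _.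
by rewrite expRD ler_wpM2l ?expR_ge0 // edges_mgf.
Qed.

Lemma edges_lower Q (th a : R) : 0 <= th ->
  prob mu (fun w => edges Q w <= a) <= expR (th * a - q * (area Q * (1 - expR (- th)))).
Proof.
move=> th0.
have -> : prob mu (fun w => edges Q w <= a) = prob mu (fun w => - a <= - edges Q w).
  by apply: eq_bigr => w _; rewrite lerN2.
apply: le_trans (chernoff _ _ hmu th0) _.
rewrite mulrN opprK expRD ler_wpM2l ?expR_ge0 //.
under [leLHS]eq_bigr do rewrite mulrN -mulNr.
apply: le_trans (edges_mgf _ _) _.
by rewrite ler_expR -mulrN -mulrN opprB.
Qed.

(** The choice of 1 / c as the parameter of the exponential moment keeps all
    exponents in [-1, 1], so that the quadratic bound on exp applies with
    constant e. *)
Lemma bilinear_upper (a : 'I_n -> 'I_n -> R) (c s : R) : 0 < c ->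
  (forall x y, `|a x y| <= c) -> \sum_x \sum_y a x y ^+ 2 <= 1 ->
  prob mu (fun w => s <= \sum_x \sum_y a x y * ((X w x y)%:R - q))
   <= expR (- (s / c) + expR 1 * q / c ^+ 2).
Proof.
move=> c0 ha ha2.
have ic0 : 0 <= c^-1 by rewrite invr_ge0 ltW.
apply: le_trans (chernoff _ _ hmu ic0) _.
rewrite [c^-1 * s]mulrC expRD ler_wpM2l ?expR_ge0 //.
have -> : expect mu (fun t => expR (c^-1 * \sum_x \sum_y a x y * ((X t x y)%:R - q)))
   = expR (- (q * \sum_x \sum_y c^-1 * a x y)) *
     expect mu (fun w => expR (\sum_x \sum_y (c^-1 * a x y) * (X w x y)%:R)).
  rewrite /expect mulr_sumr; apply: eq_bigr => w _.
  rewrite mulrCA; congr (_ * _); rewrite -expRD; congr expR.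
  rewrite !mulr_sumr -sumrN -big_split /=; apply: eq_bigr => x _.
  rewrite !mulr_sumr -sumrN -big_split /=; apply: eq_bigr => y _; ring.
apply: le_trans (ler_wpM2l (expR_ge0 _) (hX _)) _.
rewrite -expRD ler_expR -mulrN -mulrDr.
rewrite [expR 1 * q]mulrC -mulrA ler_wpM2l // addrC -sumrB.
apply: (@le_trans _ _ (\sum_x \sum_y expR 1 / c ^+ 2 * a x y ^+ 2)).
  apply: ler_sum => x _; rewrite -sumrB; apply: ler_sum => y _.
  have h : `|c^-1 * a x y| <= 1.
    by rewrite normrM ger0_norm // -ler_pdivlMl ?invr_gt0 // invrK mulr1.
  have := expR_quadB h.
  rewrite exprMn exprVn => h'; rewrite lerBlDr; apply: le_trans h' _.
  rewrite addrC lerD2r le_eqVlt; apply/orP; left; apply/eqP; ring.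
under eq_bigr do rewrite -mulr_sumr.
rewrite -mulr_sumr -[leRHS]mulr1 ler_wpM2l // divr_ge0 ?expR_ge0 ?sqr_ge0 //.
Qed.

End SubPoisson.

(** * Edge counts in rectangles *)

Section SetEntropy.
Variable R : realType.

(** An upper bound for the logarithm of the number of sets of s elements among
    n; see bin_entropy. *)
Definition set_entropy (n s : nat) : R := s%:R * (1 + ln (n%:R / s%:R)).

Lemma set_entropy_mono n s t : (0 < s)%N -> (s <= t)%N -> (t <= n)%N ->
  set_entropy n s <= set_entropy n t.
Proof.
move=> s0 st tn; rewrite /set_entropy.
have t0 : (0 < t)%N by apply: leq_trans st.
have n0 : (0 < n)%N by apply: leq_trans tn.
have s0' : 0 < s%:R :> R by rewrite ltr0n.
have t0' : 0 < t%:R :> R by rewrite ltr0n.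
have n0' : 0 < n%:R :> R by rewrite ltr0n.
have -> : n%:R / s%:R = (n%:R / t%:R) * (t%:R / s%:R) :> R.
  by field; rewrite !gt_eqF.
rewrite lnM ?posrE ?divr_gt0 //.
have l1 : 0 <= ln (n%:R / t%:R) :> R.
  by apply: ln_ge0; rewrite ler_pdivlMr // mul1r ler_nat.
have l2 : ln (t%:R / s%:R) <= t%:R / s%:R - 1 :> R.
  by have := @le_ln1Dx R (t%:R / s%:R - 1); rewrite addrCA subrr addr0; apply; rewrite ltrBrDl addrN divr_gt0.
have l3 : s%:R * ln (t%:R / s%:R) <= t%:R - s%:R :> R.
  apply: le_trans (ler_wpM2l (ltW s0') l2) _.
  by rewrite mulrBr mulr1 mulrCA divff ?gt_eqF // mulr1.
have : s%:R <= t%:R :> R by rewrite ler_nat.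
nra.
Qed.

(** Keep one term of the binomial expansion of (1 + s / n)^n, which is at most
    e^s. *)
Lemma bin_entropy n s : (0 < s)%N -> (s <= n)%N ->
  'C(n, s)%:R * expR (- set_entropy n s) <= 1 :> R.
Proof.
move=> s0 sn.
have n0 : (0 < n)%N by apply: leq_trans sn.
have s0' : 0 < s%:R :> R by rewrite ltr0n.
have n0' : 0 < n%:R :> R by rewrite ltr0n.
set x : R := s%:R / n%:R.
have x0 : 0 < x by rewrite divr_gt0.
have h1 : 'C(n, s)%:R * x ^+ s <= (1 + x) ^+ n.
  rewrite exprDn (bigD1 (Ordinal (sn : (s < n.+1)%N))) //= expr1n mul1r.
  rewrite mulr_natl lerDl sumr_ge0 // => i _.
  by rewrite mulrn_wge0 // expr1n mul1r exprn_ge0 // ltW.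
have h2 : (1 + x) ^+ n <= expR s%:R.
  have -> : s%:R = n%:R * x :> R by rewrite mulrC divfK ?gt_eqF.
  by rewrite expRM_natl lerXn2r ?nnegrE ?expR_ge0 ?addr_ge0 ?(ltW x0) // expR_ge1Dx.
have -> : expR (- set_entropy n s) = expR (- s%:R) * x ^+ s.
  rewrite /set_entropy -[n%:R / s%:R]invrK invf_div lnV ?posrE // mulrDr mulr1 opprD expRD.
  by rewrite mulrN opprK expRM_natl lnK ?posrE.
rewrite mulrCA; apply: le_trans (ler_wpM2l (expR_ge0 _) (le_trans h1 h2)) _.
by rewrite -expRD addNr expR0.
Qed.

(** Union bound over all nonempty sets at once. One unit of the coefficient G
    pays for the number of sets of a given size, the rest is worst for
    singletons. *)
Lemma sum_sets_entropy n (G : R) : (0 < n)%N -> 1 <= G ->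
  \sum_(S : {set 'I_n} | (0 < #|S|)%N) expR (- (G * set_entropy n #|S|))
   <= n%:R * expR (- ((G - 1) * (1 + ln n%:R))).
Proof.
move=> n0 G1.
rewrite (partition_big (fun S : {set 'I_n} => inord #|S| : 'I_n.+1) (fun s => s != ord0)); last first.
  move=> S h; rewrite -val_eqE /= inordK ?ltnS -?lt0n //.
  by rewrite -[n in (_ <= n)%N]card_ord max_card.
have cS (S : {set 'I_n}) : (#|S| <= n)%N by rewrite -[n in (_ <= n)%N]card_ord max_card.
apply: (@le_trans _ _ (\sum_(s < n.+1 | s != ord0) expR (- ((G - 1) * (1 + ln n%:R))))); last first.
  by rewrite sumr_const cardC1 card_ord mulr_natl.
apply: ler_sum => s hs.
have s0 : (0 < s)%N by rewrite lt0n.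
have sn : (s <= n)%N by rewrite -ltnS.
have b0 : expR (- ((G - 1) * set_entropy n s)) <= expR (- ((G - 1) * (1 + ln n%:R))).
  rewrite ler_expR lerN2 ler_wpM2l ?subr_ge0 //.
  by apply: le_trans (set_entropy_mono (ltnSn 0) s0 sn); rewrite /set_entropy mul1r divr1.
apply: (@le_trans _ _ (\sum_(S : {set 'I_n} | #|S| == s) expR (- set_entropy n s) * expR (- ((G - 1) * (1 + ln n%:R))))).
  rewrite [leLHS]big_mkcond [leRHS]big_mkcond /=; apply: ler_sum => S _.
  case: ifP => [/andP[hS /eqP hs']|_]; last by case: ifP => // _; rewrite mulr_ge0 ?expR_ge0.
  have e : #|S| = s by rewrite -hs' inordK ?ltnS.
  rewrite e eqxx; apply: le_trans (ler_wpM2l (expR_ge0 _) b0).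
  by rewrite -expRD ler_expR; lra.
rewrite sumr_const.
have -> : #|[pred S : {set 'I_n} | #|S| == s]| = 'C(n, s).
  have := @card_draws 'I_n s; rewrite card_ord => <-.
  by apply: eq_card => S; rewrite [RHS]inE.
by rewrite -[leLHS]mulr_natl mulrA ler_piMl ?expR_ge0 // bin_entropy.
Qed.

End SetEntropy.

Section Discrepancy.
Variables (R : realType) (T : finType) (mu : T -> R) (hmu : is_law mu).
Variables (n : nat) (X : T -> 'I_n -> 'I_n -> bool) (q : R).
Hypothesis hX : subpoisson mu X q.
Hypothesis q0 : 0 <= q.
Variables (L lam tau : R).
Hypotheses (n0 : (0 < n)%N) (L1 : 1 <= L) (tau1 : 1 <= tau).
Hypotheses (qL : q <= lam * L / n%:R) (taul : 2 * expR 1 * lam <= tau) (lam0 : 0 <= lam).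

Definition rect (A B : {set 'I_n}) (x y : 'I_n) : bool := (x \in A) && (y \in B).

Lemma area_rect A B : area R (rect A B) = #|A|%:R * #|B|%:R.
Proof.
rewrite /area /rect.
under eq_bigr do under eq_bigr do rewrite -mulnb natrM.
under eq_bigr do rewrite -mulr_sumr.
rewrite -mulr_suml -!natr_sum; congr (_%:R * _%:R).
  by rewrite -big_mkcond sum1_card.
by rewrite -big_mkcond sum1_card.
Qed.

(** The square root of L |A| |B| is the scale at which a rectangle of density L
    / n would contribute as much as the operator norm allows. *)
Definition side (A B : {set 'I_n}) : R := Num.sqrt (L * #|A|%:R * #|B|%:R).

(** The exponential parameter th is the logarithm of the ratio, up to powers of
    tau, between the prescribed number of edges and its mean. The assumptions
    on s and t say that the sides are comparable up to a factor L and that the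
    rectangle is not too large; they make th times the number of edges dominate
    the entropy of the larger side, up to a factor of order ln L, and this is
    what a union bound over rectangles costs. *)
Lemma rect_bound (A B : {set 'I_n}) (s := #|A|%:R : R) (t := #|B|%:R : R) :
  (0 < #|A|)%N -> (0 < #|B|)%N -> s <= t * L -> t <= s * L ->
  L * s * t <= tau ^+ 4 * n%:R ^+ 2 ->
  prob mu (fun w => tau ^+ 3 * side A B <= edges R X (rect A B) w) <=
  expR (- (tau ^+ 3 / (2 + ln L) * set_entropy R n (maxn #|A| #|B|))).
Proof.
move=> A0 B0.
have sE : s = #|A|%:R by [].
have tE : t = #|B|%:R by [].
clearbody s t => sL tL hd.
have s0 : 0 < s by rewrite sE ltr0n.
have t0 : 0 < t by rewrite tE ltr0n.
have L0 : 0 < L := lt_le_trans ltr01 L1.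
have tau0 : 0 < tau := lt_le_trans ltr01 tau1.
have n0' : 0 < n%:R :> R by rewrite ltr0n.
rewrite /side -sE -tE.
set W := Num.sqrt _.
have Lst0 : 0 < L * s * t by rewrite !mulr_gt0.
have W0 : 0 < W by rewrite sqrtr_gt0.
have WW : W ^+ 2 = L * s * t by rewrite sqr_sqrtr // ltW.
set r : R := (maxn #|A| #|B|)%:R.
have r0 : 0 < r by rewrite ltr0n leq_max A0.
have rE : r = s \/ r = t by rewrite sE tE /r /maxn; case: ltnP => _; [right|left].
have sr : s <= r by rewrite sE ler_nat leq_maxl.
have tr : t <= r by rewrite tE ler_nat leq_maxr.
have rW : r <= W.
  rewrite -(ler_pXn2r (n := 2)) ?nnegrE ?(ltW r0) ?(ltW W0) // WW expr2.
  case: rE => ->.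
    have -> : L * s * t = s * (t * L) by ring.
    by rewrite ler_wpM2l // ltW.
  have -> : L * s * t = t * (s * L) by ring.
  by rewrite ler_wpM2l // ltW.
have lnL0 : 0 <= ln L by apply: ln_ge0.
have WL : W <= r * Num.sqrt L.
  rewrite -(ler_pXn2r (n := 2)) ?nnegrE ?mulr_ge0 ?sqrtr_ge0 ?(ltW W0) ?(ltW r0) // WW exprMn sqr_sqrtr ?(ltW L0) //.
  have -> : L * s * t = (s * t) * L by ring.
  by rewrite expr2 ler_wpM2r ?(ltW L0) // ler_pM ?(ltW s0) ?(ltW t0).
have Wn : W <= tau ^+ 2 * n%:R.
  by rewrite -(ler_pXn2r (n := 2)) ?nnegrE ?(ltW W0) ?mulr_ge0 ?(ltW tau0) // WW exprMn -exprM.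
pose th := 1 + ln (tau ^+ 2 * n%:R / W).
have th1 : 1 <= th.
  by rewrite lerDl ln_ge0 // ler_pdivlMr // mul1r.
have eth : expR th = expR 1 * (tau ^+ 2 * n%:R / W).
  by rewrite expRD lnK // posrE divr_gt0 // mulr_gt0 // exprn_gt0.
have th0 : 0 <= th by lra.
apply: le_trans (edges_upper hmu hX _ _ th0) _.
rewrite ler_expR area_rect -sE -tE.
set k := tau ^+ 3 * W.
have k0 : 0 < k by rewrite mulr_gt0 // exprn_gt0.
have h1 : q * (s * t * (expR th - 1)) <= k / 2.
  apply: (@le_trans _ _ (lam * L / n%:R * (s * t * expR th))).
    apply: ler_pM => //; first by rewrite mulr_ge0 ?mulr_ge0 ?(ltW s0) ?(ltW t0) // subr_ge0 -expR0 ler_expR.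
    by rewrite ler_wpM2l ?mulr_ge0 ?(ltW s0) ?(ltW t0) // lerBlDr lerDl.
  rewrite eth.
  have -> : lam * L / n%:R * (s * t * (expR 1 * (tau ^+ 2 * n%:R / W))) =
    lam * expR 1 * tau ^+ 2 * (L * s * t / W) by field; rewrite !gt_eqF.
  rewrite -WW expr2 mulfK ?gt_eqF // /k.
  rewrite ler_pdivlMr //.
  have -> : lam * expR 1 * tau ^+ 2 * W * 2 = 2 * expR 1 * lam * (tau ^+ 2 * W) by ring.
  by rewrite [tau ^+ 3]exprS -[leRHS]mulrA ler_wpM2r // mulr_ge0 ?(ltW W0) // sqr_ge0.
have h2 : 1 + ln (n%:R / r) <= th + ln L / 2.
  rewrite /th -addrA lerD2l.
  have -> : ln L / 2 = ln (Num.sqrt L).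
    by rewrite -{1}[L]sqr_sqrtr ?(ltW L0) // lnXn ?sqrtr_gt0 // -[_ *+ 2]mulr_natr mulfK.
  have sL0 : 0 < Num.sqrt L by rewrite sqrtr_gt0.
  have tt0 : 0 < tau ^+ 2 * n%:R by rewrite mulr_gt0 // exprn_gt0.
  rewrite -lnM ?posrE ?divr_gt0 //.
  rewrite ler_ln ?posrE ?mulr_gt0 ?divr_gt0 ?invr_gt0 //.
  have -> : tau ^+ 2 * n%:R / W * Num.sqrt L = n%:R / r * (tau ^+ 2 * (r * Num.sqrt L / W)).
    by field; rewrite !gt_eqF.
  rewrite ler_peMr ?divr_ge0 ?(ltW r0) // -[1]mulr1; apply: ler_pM; rewrite ?ler01 ?exprn_ege1 //.
  by rewrite ler_pdivlMr // mul1r.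
have h3 : k * th / 2 >= tau ^+ 3 / (2 + ln L) * set_entropy R n (maxn #|A| #|B|).
  rewrite /set_entropy -/r.
  have hth : (1 + ln (n%:R / r)) / (2 + ln L) <= th / 2.
    rewrite ler_pdivrMr; last by lra.
    by apply: le_trans h2 _; nra.
  have -> : tau ^+ 3 / (2 + ln L) * (r * (1 + ln (n%:R / r))) =
    tau ^+ 3 * r * ((1 + ln (n%:R / r)) / (2 + ln L)) by field; rewrite gt_eqF //; lra.
  rewrite -[leRHS]mulrA; apply: (@le_trans _ _ (tau ^+ 3 * r * (th / 2))).
    by rewrite ler_wpM2l // mulr_ge0 ?exprn_ge0 ?(ltW tau0) ?(ltW r0).
  rewrite ler_wpM2r //; last by rewrite /k ler_wpM2l // exprn_ge0 // (ltW tau0).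
  by lra.
have h4 : k <= k * th by rewrite ler_peMr // (ltW k0).
lra.
Qed.

Definition discrepancy_fails (w : T) : Prop := exists AB : {set 'I_n} * {set 'I_n},
  [/\ (0 < #|AB.1|)%N /\ (0 < #|AB.2|)%N, #|AB.1|%:R <= #|AB.2|%:R * L,
    #|AB.2|%:R <= #|AB.1|%:R * L, L * #|AB.1|%:R * #|AB.2|%:R <= tau ^+ 4 * n%:R ^+ 2 &
    tau ^+ 3 * side AB.1 AB.2 <= edges R X (rect AB.1 AB.2) w].

(** Union bound over pairs of sets: half of the exponent is given to each
    side. *)
Lemma discrepancy_fails_prob : 6 <= tau ^+ 3 / (2 + ln L) ->
  prob mu discrepancy_fails <= n%:R ^- 2.
Proof.
move=> hG; apply: le_trans (prob_exists _ hmu) _.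
set G := tau ^+ 3 / (2 + ln L) in hG.
pose f (S : {set 'I_n}) : R := if (0 < #|S|)%N then expR (- (G / 2 * set_entropy R n #|S|)) else 0.
have f0 S : 0 <= f S by rewrite /f; case: ifP => // _; apply: expR_ge0.
have cS (S : {set 'I_n}) : (#|S| <= n)%N by rewrite -[n in (_ <= n)%N]card_ord max_card.
apply: (@le_trans _ _ (\sum_(AB : {set 'I_n} * {set 'I_n}) f AB.1 * f AB.2)).
  apply: ler_sum => -[A B] _ /=.
  have [h|h] := pselect ((0 < #|A|)%N /\ (0 < #|B|)%N /\ #|A|%:R <= #|B|%:R * L /\
     #|B|%:R <= #|A|%:R * L /\ L * #|A|%:R * #|B|%:R <= tau ^+ 4 * n%:R ^+ 2); last first.
    rewrite /prob big1 ?mulr_ge0 // => w _.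
    case: asboolP => [[[? ?] ? ? ? ?]|_]; last by rewrite mulr0.
    by case: h.
  case: h => A0 [B0 [h1 [h2 h3]]].
  apply: (@le_trans _ _ (expR (- (G * set_entropy R n (maxn #|A| #|B|))))).
    apply: le_trans (rect_bound A0 B0 h1 h2 h3).
    by apply: prob_le => // w [].
  rewrite /f A0 B0 -expRD ler_expR.
  have e1 : set_entropy R n #|A| <= set_entropy R n (maxn #|A| #|B|).
    by apply: set_entropy_mono; rewrite ?leq_maxl // geq_max !cS.
  have e2 : set_entropy R n #|B| <= set_entropy R n (maxn #|A| #|B|).
    by apply: set_entropy_mono; rewrite ?leq_maxr // geq_max !cS.
  nra.
rewrite -(pair_bigA _ (fun A B => f A * f B)) /=.
under eq_bigr do rewrite -mulr_sumr.
rewrite -mulr_suml -expr2 -exprVn lerXn2r ?nnegrE ?sumr_ge0 ?invr_ge0 //.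
rewrite /f -big_mkcond /=.
have G1 : 1 <= G / 2 by lra.
apply: le_trans (sum_sets_entropy n0 G1) _.
have n0' : 0 < n%:R :> R by rewrite ltr0n.
have ln0 : 0 <= ln n%:R :> R by rewrite ln_ge0 // ler1n.
apply: (@le_trans _ _ (n%:R * expR (- (ln n%:R *+ 2)))).
  rewrite ler_wpM2l // ler_expR; nra.
rewrite expRN -[ln _ *+ 2]mulr_natr expRM_natr lnK ?posrE // expr2 invfM mulrA divff ?gt_eqF //.
by rewrite mul1r.
Qed.

End Discrepancy.

(** * Pairs of large weight *)

Lemma count_close (R : realType) (N J a : nat) :
  \sum_(b < N) ((a <= b + J) && (b <= a + J))%N%:R <= (2 * J + 1)%:R :> R.
Proof.
rewrite -natr_sum ler_nat.
have -> : (\sum_(b < N) ((a <= b + J) && (b <= a + J)) =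
    size [seq b <- iota 0 N | (a <= b + J) && (b <= a + J)])%N.
  rewrite size_filter -sum1_count.
  rewrite -[N in iota 0 N]subn0 -/(index_iota 0 N) [RHS]big_mkcond big_mkord.
  by apply: eq_bigr => b _; case: (_ && _).
have -> : (2 * J + 1 = size (iota (a - J) (2 * J + 1)))%N by rewrite size_iota.
apply: uniq_leq_size; first by rewrite filter_uniq ?iota_uniq.
move=> b; rewrite mem_filter !mem_iota => /andP[/andP[h1 h2] _].
lia.
Qed.

Section Levels.
Variables (R : realType) (tau : R).
Hypothesis tau1 : 1 < tau.

(** Values in (0, 1] are sorted into the bands between consecutive powers of 1
    / tau. *)
Definition level (u : R) : nat := Num.truncn (- ln u / ln tau).

Lemma levelP (u : R) : 0 < u -> u <= 1 ->
  tau^-1 ^+ (level u).+1 < u /\ u <= tau^-1 ^+ level u.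
Proof.
move=> u0 u1.
have tau0 : 0 < tau by apply: lt_trans tau1.
have lt0 : 0 < ln tau by rewrite ln_gt0.
have a0 : 0 <= - ln u / ln tau by rewrite divr_ge0 ?(ltW lt0) // oppr_ge0 ln_le0.
have /andP[h1 h2] := Num.Theory.truncn_itv a0.
rewrite -/(level u) in h1 h2.
rewrite ler_pdivlMr // in h1; rewrite ltr_pdivrMr // in h2.
have e (k : nat) : tau^-1 ^+ k = expR (- (k%:R * ln tau)).
  by rewrite expRN expRM_natl lnK ?posrE // exprVn.
move: h1 h2; move: (level u) => k h1 h2.
by rewrite !e -{1 2}[u]lnK ?posrE // ltr_expR ler_expR; split; lra.
Qed.

End Levels.

Section Heavy.
Variables (R : realType) (n : nat) (Y : 'I_n -> 'I_n -> R).
Variables (L D C0 tau : R) (J : nat).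
Hypotheses (n0 : (0 < n)%N) (Y0 : forall x y, 0 <= Y x y) (D1 : 1 <= D) (DD : D ^+ 2 = L).
Hypotheses (tau1 : 1 < tau) (DJ : D <= tau ^+ J).
Hypotheses (rowY : forall x, \sum_y Y x y <= C0 * L) (colY : forall y, \sum_x Y x y <= C0 * L).
Hypothesis disc : forall A B : {set 'I_n}, (0 < #|A|)%N -> (0 < #|B|)%N ->
  L * #|A|%:R * #|B|%:R <= tau ^+ 4 * n%:R ^+ 2 ->
  \sum_(x in A) \sum_(y in B) Y x y <= tau ^+ 3 * (D * Num.sqrt (#|A|%:R * #|B|%:R)).
Variables (u v : 'I_n -> R).
Hypotheses (u0 : forall x, 0 <= u x) (v0 : forall x, 0 <= v x).
Hypotheses (u2 : \sum_x u x ^+ 2 <= 1) (v2 : \sum_x v x ^+ 2 <= 1).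

(** Besides being heavy, the pair has entries within a factor D of each other.
    Heavy pairs which are not balanced are paid by the degrees alone. *)
Definition balanced x y : bool :=
  [&& D / n%:R < u x * v y, u x < D * v y & v y < D * u x].

Lemma le1_of_sum_sq (w : 'I_n -> R) x : (forall x, 0 <= w x) -> \sum_x w x ^+ 2 <= 1 -> w x <= 1.
Proof.
move=> w0 w2; rewrite -(ler_pXn2r (n := 2)) ?nnegrE // expr1n.
apply: le_trans w2; rewrite (bigD1 x) //= lerDl.
by apply: sumr_ge0 => *; apply: sqr_ge0.
Qed.

Definition lev_set (w : 'I_n -> R) (a : nat) : {set 'I_n} :=
  [set x | (0 < w x) && (level tau (w x) == a)]%SET.

Lemma sum_in_le (A : {set 'I_n}) (f : 'I_n -> R) : (forall x, 0 <= f x) ->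
  \sum_(x in A) f x <= \sum_x f x.
Proof. by move=> f0; rewrite [leLHS]big_mkcond; apply: ler_sum => x _; case: ifP. Qed.

Lemma lev_set_weight w a : (forall x, 0 <= w x) -> \sum_x w x ^+ 2 <= 1 ->
  #|lev_set w a|%:R * tau^-1 ^+ a ^+ 2 <= tau ^+ 2 * \sum_(x in lev_set w a) w x ^+ 2.
Proof.
move=> w0 w2.
have tau0 : 0 < tau by apply: lt_trans tau1.
rewrite mulr_natl -sumr_const mulr_sumr; apply: ler_sum => x.
rewrite inE => /andP[wx /eqP lx].
have [h1 _] := levelP tau1 wx (le1_of_sum_sq x w0 w2).
rewrite lx in h1.
rewrite -exprMn lerXn2r ?nnegrE ?mulr_ge0 ?exprn_ge0 ?invr_ge0 ?(ltW tau0) //.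
by rewrite -ler_pdivrMl // -exprS ltW.
Qed.

(** On a pair of bands all weights agree up to tau^2, so the sum is governed by
    the number of edges in a rectangle, and the arithmetic-geometric inequality
    turns the size of that rectangle into the squared mass of the bands.
    Heaviness bounds the rectangle from above, as the hypothesis on edge counts
    requires, and balance forces the indices of the bands to differ by at most
    J. *)
Lemma balanced_block (a b : nat) :
  \sum_(x in lev_set u a) \sum_(y in lev_set v b) (balanced x y)%:R * Y x y * (u x * v y) <=
  tau ^+ 5 * D * (((a <= b + J) && (b <= a + J))%N%:R *
     ((\sum_(x in lev_set u a) u x ^+ 2 + \sum_(y in lev_set v b) v y ^+ 2) / 2)).
Proof.
have tau0 : 0 < tau by apply: lt_trans tau1.
have D0 : 0 < D by apply: lt_le_trans D1.
have n0' : 0 < n%:R :> R by rewrite ltr0n.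
have s0 (w : 'I_n -> R) (c : nat) : 0 <= \sum_(x in lev_set w c) w x ^+ 2.
  by apply: sumr_ge0 => *; apply: sqr_ge0.
have [h|h] := pselect (exists x y, [/\ x \in lev_set u a, y \in lev_set v b & balanced x y]); last first.
  rewrite big1 => [|x xa].
    by rewrite !mulr_ge0 ?exprn_ge0 ?addr_ge0 ?s0 ?ler0n ?invr_ge0 ?(ltW D0) ?(ltW tau0).
  rewrite big1 // => y yb; case hb: (balanced x y); last by rewrite !mul0r.
  by case: h; exists x, y.
case: h => x [y [xa yb /and3P[b1 b2 b3]]].
have wa := @lev_set_weight u a u0 u2.
have wb := @lev_set_weight v b v0 v2.
set A := lev_set u a in xa wa *; set B := lev_set v b in yb wb *.
have A0 : (0 < #|A|)%N by apply/card_gt0P; exists x.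
have B0 : (0 < #|B|)%N by apply/card_gt0P; exists y.
set sA : R := \sum_(x in A) u x ^+ 2 in wa *; set sB : R := \sum_(x in B) v x ^+ 2 in wb *.
have sA1 : sA <= 1.
  by apply: le_trans u2; apply: sum_in_le => x'; apply: sqr_ge0.
have sB1 : sB <= 1.
  by apply: le_trans v2; apply: sum_in_le => x'; apply: sqr_ge0.
move: xa yb; rewrite !inE => /andP[ux /eqP lx] /andP[vy /eqP ly].
have [ux1 ux2] := levelP tau1 ux (le1_of_sum_sq x u0 u2).
have [vy1 vy2] := levelP tau1 vy (le1_of_sum_sq y v0 v2).
rewrite lx in ux1 ux2; rewrite ly in vy1 vy2.
set p := tau^-1 ^+ a in wa ux2; set r := tau^-1 ^+ b in wb vy2.
have p0 : 0 < p by rewrite exprn_gt0 ?invr_gt0.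
have r0 : 0 < r by rewrite exprn_gt0 ?invr_gt0.
have hJ (c d : nat) : tau^-1 ^+ c.+1 < D * tau^-1 ^+ d -> (d <= c + J)%N.
  move=> hc; rewrite leqNgt; apply/negP => hd.
  have : tau ^+ J * tau^-1 ^+ d <= tau^-1 ^+ c.+1.
    rewrite -(subnK hd) -addSn exprD [_ ^+ (c.+1 + J)]exprD.
    have -> : tau ^+ J * (tau^-1 ^+ (d - (c + J).+1) * (tau^-1 ^+ c.+1 * tau^-1 ^+ J)) =
       tau^-1 ^+ (d - (c + J).+1) * tau^-1 ^+ c.+1 * (tau ^+ J * tau^-1 ^+ J).
      by move: (tau ^+ J) (tau^-1 ^+ J) (tau^-1 ^+ _) (tau^-1 ^+ _) => *; ring.
    rewrite -exprMn divff ?gt_eqF // expr1n mulr1 ler_piMl // ?exprn_ge0 ?invr_ge0 ?(ltW tau0) //.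
    by rewrite exprn_ile1 ?invr_ge0 ?(ltW tau0) // invf_le1 ?(ltW tau1).
  move=> h'; have h3 : D * tau^-1 ^+ d <= tau ^+ J * tau^-1 ^+ d.
    by rewrite ler_wpM2r // exprn_ge0 // invr_ge0 (ltW tau0).
  by have := lt_le_trans hc (le_trans h3 h'); rewrite ltxx.
have -> : ((a <= b + J) && (b <= a + J))%N.
  apply/andP; split; apply: hJ.
    by apply: lt_le_trans vy1 _; apply: ltW; apply: lt_le_trans b3 _; rewrite ler_wpM2l ?(ltW D0).
  by apply: lt_le_trans ux1 _; apply: ltW; apply: lt_le_trans b2 _; rewrite ler_wpM2l ?(ltW D0).
rewrite mul1r.
have pr : D / n%:R < p * r by apply: lt_le_trans b1 _; apply: ler_pM.
have cA : 0 < #|A|%:R :> R by rewrite ltr0n.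
have cB : 0 < #|B|%:R :> R by rewrite ltr0n.
have hd : L * #|A|%:R * #|B|%:R <= tau ^+ 4 * n%:R ^+ 2.
  have e1 : (#|A|%:R * p ^+ 2) * (#|B|%:R * r ^+ 2) <= tau ^+ 2 * tau ^+ 2.
    apply: ler_pM; rewrite ?mulr_ge0 ?(ltW p0) ?(ltW r0) ?ler0n //.
      by apply: le_trans wa _; rewrite ler_piMr ?sqr_ge0.
    by apply: le_trans wb _; rewrite ler_piMr ?sqr_ge0.
  have e2 : D ^+ 2 <= (p * r * n%:R) ^+ 2.
    rewrite lerXn2r ?nnegrE ?mulr_ge0 ?(ltW D0) ?(ltW p0) ?(ltW r0) //.
    by rewrite -ler_pdivrMr // ltW.
  rewrite -DD; apply: (@le_trans _ _ ((p * r * n%:R) ^+ 2 * #|A|%:R * #|B|%:R)).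
    by do 2!rewrite ler_wpM2r ?ler0n //.
  have -> : (p * r * n%:R) ^+ 2 * #|A|%:R * #|B|%:R =
    (#|A|%:R * p ^+ 2) * (#|B|%:R * r ^+ 2) * n%:R ^+ 2 by ring.
  by rewrite ler_wpM2r ?sqr_ge0 // (le_trans e1) // -exprD.
have hdisc := disc A0 B0 hd.
apply: (@le_trans _ _ (p * r * \sum_(x in A) \sum_(y in B) Y x y)).
  rewrite mulr_sumr; apply: ler_sum => x' xA; rewrite mulr_sumr; apply: ler_sum => y' yB.
  move: xA yB; rewrite !inE => /andP[ux' /eqP lx'] /andP[vy' /eqP ly'].
  have [_ ux2'] := levelP tau1 ux' (le1_of_sum_sq x' u0 u2).
  have [_ vy2'] := levelP tau1 vy' (le1_of_sum_sq y' v0 v2).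
  rewrite lx' in ux2'; rewrite ly' in vy2'.
  rewrite [leRHS]mulrC; apply: ler_pM; rewrite ?mulr_ge0 ?ler0n //.
    by case: balanced; rewrite ?mul1r // mul0r.
  by apply: ler_pM.
apply: (@le_trans _ _ (p * r * (tau ^+ 3 * (D * Num.sqrt (#|A|%:R * #|B|%:R))))).
  by rewrite ler_wpM2l // mulr_ge0 ?(ltW p0) ?(ltW r0).
have agm : p * r * Num.sqrt (#|A|%:R * #|B|%:R) <= (#|A|%:R * p ^+ 2 + #|B|%:R * r ^+ 2) / 2.
  rewrite sqrtrM ?ler0n //.
  set c := Num.sqrt _; set d := Num.sqrt _.
  have -> : #|A|%:R = c ^+ 2 by rewrite sqr_sqrtr ?ler0n.
  have -> : #|B|%:R = d ^+ 2 by rewrite sqr_sqrtr ?ler0n.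
  have : 0 <= (c * p - d * r) ^+ 2 by apply: sqr_ge0.
  by nra.
have -> : p * r * (tau ^+ 3 * (D * Num.sqrt (#|A|%:R * #|B|%:R))) =
   tau ^+ 3 * D * (p * r * Num.sqrt (#|A|%:R * #|B|%:R)) by ring.
have -> : tau ^+ 5 * D * ((sA + sB) / 2) = tau ^+ 3 * D * ((tau ^+ 2 * sA + tau ^+ 2 * sB) / 2) by field.
rewrite ler_wpM2l ?mulr_ge0 ?exprn_ge0 ?(ltW tau0) ?(ltW D0) //.
by apply: le_trans agm _; rewrite ler_wpM2r ?invr_ge0 // lerD.
Qed.

Lemma lev_partition (w G : 'I_n -> R) (N : nat) :
  (forall x, (level tau (w x) < N)%N) -> (forall x, ~~ (0 < w x) -> G x = 0) ->
  \sum_x G x = \sum_(a < N) \sum_(x in lev_set w a) G x.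
Proof.
move=> hN hG.
under [RHS]eq_bigr do rewrite big_mkcond.
rewrite exchange_big /=; apply: eq_bigr => x _.
rewrite (bigD1 (Ordinal (hN x))) //= inE eqxx andbT big1 ?addr0 => [|a ha].
  by case: ifPn => // /hG.
by move: ha; rewrite -val_eqE /= inE eq_sym => /negbTE ->; rewrite andbF.
Qed.

(** Each band meets only 2 J + 1 others, and the squared masses of the bands
    sum to at most 1. *)
Lemma balanced_sum : \sum_x \sum_y (balanced x y)%:R * Y x y * (u x * v y)
   <= (2 * J + 1)%:R * tau ^+ 5 * D.
Proof.
have tau0 : 0 < tau by apply: lt_trans tau1.
have D0 : 0 < D by apply: lt_le_trans D1.
pose N := maxn (\max_x level tau (u x)).+1 (\max_x level tau (v x)).+1.
have hNu x : (level tau (u x) < N)%N by rewrite leq_max ltnS leq_bigmax.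
have hNv x : (level tau (v x) < N)%N by rewrite leq_max !ltnS leq_bigmax orbT.
rewrite (lev_partition hNu) => [|x hx]; last first.
  rewrite big1 // => y _; have -> : u x = 0 by apply/eqP; rewrite eq_le u0 leNgt hx.
  by rewrite mul0r mulr0.
have -> : \sum_(a < N) \sum_(x in lev_set u a) \sum_y (balanced x y)%:R * Y x y * (u x * v y) =
  \sum_(a < N) \sum_(b < N) \sum_(x in lev_set u a) \sum_(y in lev_set v b) (balanced x y)%:R * Y x y * (u x * v y).
  apply: eq_bigr => a _; rewrite [RHS]exchange_big /=; apply: eq_bigr => x _.
  rewrite (lev_partition hNv) // => y hy.
  have -> : v y = 0 by apply/eqP; rewrite eq_le v0 leNgt hy.
  by rewrite !mulr0.
pose sA (a : nat) : R := \sum_(x in lev_set u a) u x ^+ 2.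
pose sB (a : nat) : R := \sum_(x in lev_set v a) v x ^+ 2.
pose ch (a b : nat) : R := ((a <= b + J) && (b <= a + J))%N%:R.
have sA0 a : 0 <= sA a by apply: sumr_ge0 => *; apply: sqr_ge0.
have sB0 a : 0 <= sB a by apply: sumr_ge0 => *; apply: sqr_ge0.
have sA1 : \sum_(a < N) sA a <= 1.
  apply: le_trans u2; rewrite [leRHS](lev_partition hNu) // => x hx.
  have -> : u x = 0 by apply/eqP; rewrite eq_le u0 leNgt hx.
  by rewrite expr0n.
have sB1 : \sum_(a < N) sB a <= 1.
  apply: le_trans v2; rewrite [leRHS](lev_partition hNv) // => x hx.
  have -> : v x = 0 by apply/eqP; rewrite eq_le v0 leNgt hx.
  by rewrite expr0n.
apply: (@le_trans _ _ (\sum_(a < N) \sum_(b < N) tau ^+ 5 * D * (ch a b * ((sA a + sB b) / 2)))).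
  by apply: ler_sum => a _; apply: ler_sum => b _; apply: balanced_block.
under eq_bigr do rewrite -mulr_sumr.
rewrite -mulr_sumr -[leRHS]mulrA [leRHS]mulrC ler_wpM2l ?mulr_ge0 ?exprn_ge0 ?(ltW tau0) ?(ltW D0) //.
have eA : \sum_(a < N) \sum_(b < N) ch a b * sA a <= (2 * J + 1)%:R * \sum_(a < N) sA a.
  rewrite mulr_sumr; apply: ler_sum => a _; rewrite -mulr_suml ler_wpM2r //.
  exact: count_close.
have eB : \sum_(a < N) \sum_(b < N) ch a b * sB b <= (2 * J + 1)%:R * \sum_(a < N) sB a.
  rewrite exchange_big mulr_sumr; apply: ler_sum => b _; rewrite -mulr_suml ler_wpM2r //.
  rewrite /ch; under eq_bigr do rewrite andbC.
  exact: count_close.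
apply: (@le_trans _ _ ((\sum_(a < N) \sum_(b < N) ch a b * sA a + \sum_(a < N) \sum_(b < N) ch a b * sB b) / 2)).
  rewrite le_eqVlt; apply/orP; left; apply/eqP.
  rewrite -big_split mulr_suml; apply: eq_bigr => a _.
  rewrite -big_split mulr_suml; apply: eq_bigr => b _ /=; ring.
have J0 : 0 <= (2 * J + 1)%:R :> R by [].
nra.
Qed.

(** If u(x) >= D v(y), the product u(x) v(y) is at most u(x)^2 / D, and the row
    sums bound the total; the same holds with the roles exchanged. The
    remaining pairs are balanced. *)
Lemma heavy_sum : \sum_x \sum_y (D / n%:R < u x * v y)%R%:R * Y x y * (u x * v y)
   <= (2 * C0 + (2 * J + 1)%:R * tau ^+ 5) * D.
Proof.
have D0 : 0 < D by apply: lt_le_trans D1.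
have hc : \sum_x \sum_y Y x y * (v y ^+ 2 / D) <= C0 * D.
  rewrite exchange_big /=; apply: (@le_trans _ _ (\sum_y C0 * D * v y ^+ 2)).
    apply: ler_sum => y _; rewrite -mulr_suml.
    have -> : C0 * D * v y ^+ 2 = C0 * L * (v y ^+ 2 / D) by rewrite -DD; field; rewrite gt_eqF.
    by rewrite ler_wpM2r // divr_ge0 ?sqr_ge0 ?(ltW D0).
  rewrite -mulr_sumr ler_piMr // mulr_ge0 ?(ltW D0) //.
  have := rowY (Ordinal n0); have : 0 <= \sum_y Y (Ordinal n0) y by apply: sumr_ge0.
  by move=> h1 h2; have := le_trans h1 h2; rewrite pmulr_lge0 // -DD exprn_gt0.
have hr : \sum_x \sum_y Y x y * (u x ^+ 2 / D) <= C0 * D.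
  apply: (@le_trans _ _ (\sum_x C0 * D * u x ^+ 2)).
    apply: ler_sum => y _; rewrite -mulr_suml.
    have -> : C0 * D * u y ^+ 2 = C0 * L * (u y ^+ 2 / D) by rewrite -DD; field; rewrite gt_eqF.
    by rewrite ler_wpM2r // divr_ge0 ?sqr_ge0 ?(ltW D0).
  rewrite -mulr_sumr ler_piMr // mulr_ge0 ?(ltW D0) //.
  have := rowY (Ordinal n0); have : 0 <= \sum_y Y (Ordinal n0) y by apply: sumr_ge0.
  by move=> h1 h2; have := le_trans h1 h2; rewrite pmulr_lge0 // -DD exprn_gt0.
apply: (@le_trans _ _ (\sum_x \sum_y ((balanced x y)%:R * Y x y * (u x * v y) +
    (Y x y * (v y ^+ 2 / D) + Y x y * (u x ^+ 2 / D))))).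
  apply: ler_sum => x _; apply: ler_sum => y _.
  have p1 : 0 <= Y x y * (v y ^+ 2 / D) by rewrite mulr_ge0 // divr_ge0 ?sqr_ge0 ?(ltW D0).
  have p2 : 0 <= Y x y * (u x ^+ 2 / D) by rewrite mulr_ge0 // divr_ge0 ?sqr_ge0 ?(ltW D0).
  rewrite /balanced; case: (D / n%:R < u x * v y) => /=; last by rewrite !mul0r !addr_ge0.
  rewrite !mul1r; have [h1|h1] := ltP (u x) (D * v y); last first.
    have h : u x * v y <= u x ^+ 2 / D.
      by rewrite ler_pdivlMr // expr2 -mulrA ler_wpM2l // mulrC.
    have := ler_wpM2l (Y0 x y) h; rewrite /= !mul0r; lra.
  have [h2|h2] := ltP (v y) (D * u x); first by rewrite /= mul1r; lra.
  have h : u x * v y <= v y ^+ 2 / D.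
    by rewrite ler_pdivlMr // expr2 mulrAC ler_wpM2r // mulrC.
  have := ler_wpM2l (Y0 x y) h; rewrite /= !mul0r; lra.
have -> : \sum_x \sum_y ((balanced x y)%:R * Y x y * (u x * v y) +
    (Y x y * (v y ^+ 2 / D) + Y x y * (u x ^+ 2 / D))) =
   \sum_x \sum_y (balanced x y)%:R * Y x y * (u x * v y) +
    (\sum_x \sum_y Y x y * (v y ^+ 2 / D) + \sum_x \sum_y Y x y * (u x ^+ 2 / D)).
  rewrite -!big_split /=; apply: eq_bigr => x _.
  by rewrite -!big_split /=; apply: eq_bigr.
have := balanced_sum.
lra.
Qed.

End Heavy.

(** * Nets of the unit ball *)

Section Net.
Variables (R : realType) (n : nat).
Hypothesis n0 : (0 < n)%N.

(** Signs and absolute values of the coordinates, in units of 1 / (4 sqrt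
    n). *)
Definition net_index : finType := {ffun 'I_n -> bool * 'I_(4 * n).+1}.
Definition net_vec (z : net_index) (x : 'I_n) : R :=
  (-1) ^+ (z x).1 * (z x).2%:R / (4 * Num.sqrt n%:R).
Definition in_net (z : net_index) : bool := (\sum_x (z x).2 ^ 2 <= 16 * n)%N.

Lemma net_scale_gt0 : 0 < 4 * Num.sqrt n%:R :> R.
Proof. by rewrite mulr_gt0 // sqrtr_gt0 ltr0n. Qed.

Lemma net_vec_norm z : in_net z -> \sum_x net_vec z x ^+ 2 <= 1.
Proof.
move=> hz; have s0 := net_scale_gt0.
have -> : \sum_x net_vec z x ^+ 2 = (\sum_x (z x).2 ^ 2)%:R / (16 * n%:R).
  rewrite natr_sum mulr_suml; apply: eq_bigr => x _.
  rewrite /net_vec !exprMn sqrr_sign mul1r exprVn exprMn sqr_sqrtr ?ler0n // -natrX.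
  by congr (_ / (_ * _)); rewrite -natrX.
rewrite ler_pdivrMr ?mulr_gt0 ?ltr0n // mul1r -natrM ler_nat //.
Qed.

(** The integer points z with sum of squares at most 16 n satisfy sum |z_x| <=
    16 n, so they are counted by 2^(16 n) times a product of geometric
    series. *)
Lemma net_card : #|[pred z | in_net z]|%:R <= 2 ^+ (18 * n) :> R.
Proof.
pose F (c : bool * 'I_(4 * n).+1) : R := 2^-1 ^+ c.2.
have F1 : \sum_c F c <= 2 ^+ 2.
  rewrite -(pair_bigA _ (fun b k => F (b, k))) /= big_bool /= /F /=.
  have h (N : nat) : \sum_(k < N) 2^-1 ^+ k <= 2 :> R.
    have -> : \sum_(k < N) 2^-1 ^+ k = 2 - 2 * 2^-1 ^+ N :> R.
      elim: N => [|N IH]; first by rewrite big_ord0 expr0; lra.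
      rewrite big_ord_recr /= IH exprS; lra.
    by rewrite gerBl mulr_ge0 // exprn_ge0 // invr_ge0.
  have := h (4 * n).+1; lra.
rewrite -sum1_card natr_sum.
apply: (@le_trans _ _ (\sum_(z : net_index) 2 ^+ (16 * n) * \prod_x F (z x))).
  rewrite [leLHS]big_mkcond; apply: ler_sum => z _.
  have P0 : 0 <= \prod_x F (z x) by apply: prodr_ge0 => x _; rewrite exprn_ge0 // invr_ge0.
  case: ifP => [hz|_]; last by rewrite mulr_ge0 // exprn_ge0.
  have -> : \prod_x F (z x) = 2^-1 ^+ (\sum_x (z x).2) by rewrite /F -expr_sum.
  rewrite exprVn ler_pdivlMr ?exprn_gt0 // mul1r ler_eXn2l ?ltr1n //.
  move: hz; rewrite inE => /(leq_trans _); apply.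
  by apply: leq_sum => x _; case: (nat_of_ord _) => // k; rewrite leq_pmulr.
rewrite -mulr_sumr -(bigA_distr_bigA (fun=> F)) /= prodr_const card_ord.
rewrite -[(18 * n)%N]/((16 + 2) * n)%N mulnDl exprD ler_wpM2l ?exprn_ge0 //.
by rewrite exprM lerXn2r ?nnegrE ?exprn_ge0 ?sumr_ge0 // => c _; rewrite exprn_ge0 // invr_ge0.
Qed.

(** Rounding each coordinate towards zero keeps the point in the net and moves
    it by at most 1 / 4 in norm. *)
Lemma net_approx (u : 'I_n -> R) : \sum_x u x ^+ 2 <= 1 ->
  exists2 z, in_net z & \sum_x (4 * (u x - net_vec z x)) ^+ 2 <= 1.
Proof.
move=> hu; have s0 := net_scale_gt0.
set s := 4 * Num.sqrt n%:R in s0.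
have ss : s ^+ 2 = 16 * n%:R by rewrite exprMn sqr_sqrtr ?ler0n // -natrX.
have u1 x : `|u x| <= 1.
  rewrite -(ler_pXn2r (n := 2)) ?nnegrE // expr1n real_normK ?num_real //.
  apply: le_trans hu; rewrite (bigD1 x) //= lerDl.
  by apply: sumr_ge0 => *; apply: sqr_ge0.
pose k x := Num.truncn (s * `|u x|).
have su0 x : 0 <= s * `|u x| by rewrite mulr_ge0 // ltW.
have sle : s <= 4 * n%:R.
  rewrite ler_pM2l // -(ler_pXn2r (n := 2)) ?nnegrE ?sqrtr_ge0 // sqr_sqrtr // expr2.
  by rewrite ler_peMr // ler1n.
have k1 x : (k x)%:R <= s * `|u x| by have /andP[] := truncn_itv (su0 x).
have k2 x : s * `|u x| < (k x).+1%:R by have /andP[] := truncn_itv (su0 x).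
have k3 x : (k x < (4 * n).+1)%N.
  rewrite ltnS -(ler_nat R) (le_trans (k1 x)) // natrM (le_trans _ sle) //.
  by rewrite ler_piMr // ltW.
pose z : net_index := [ffun x => (u x < 0, Ordinal (k3 x))].
have zE x : net_vec z x = (-1) ^+ (u x < 0)%R * (k x)%:R / s by rewrite /net_vec ffunE.
exists z.
  rewrite /in_net -(ler_nat R) natr_sum natrM.
  apply: (@le_trans _ _ (\sum_x s ^+ 2 * u x ^+ 2)).
    apply: ler_sum => x _; rewrite ffunE /= natrX -[u x ^+ 2]real_normK ?num_real // -exprMn.
    by rewrite lerXn2r ?nnegrE.
  by rewrite -mulr_sumr ss ler_piMr // mulr_ge0.
have h x : (4 * (u x - net_vec z x)) ^+ 2 <= n%:R^-1.
  have -> : u x - net_vec z x = (-1) ^+ (u x < 0)%R * ((s * `|u x| - (k x)%:R) / s).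
    rewrite zE {1}[u x]numEsign; field; rewrite gt_eqF //.
  rewrite mulrCA exprMn sqrr_sign mul1r !exprMn exprVn ss.
  have : (s * `|u x| - (k x)%:R) ^+ 2 <= 1.
    rewrite expr_le1 ?subr_ge0 //; have := k2 x; rewrite -natr1; lra.
  move=> h1; rewrite -[n%:R^-1]mul1r invfM [4 ^+ 2]expr2.
  have -> : 4 * 4 * ((s * `|u x| - (k x)%:R) ^+ 2 * (16^-1 * n%:R^-1)) =
     (s * `|u x| - (k x)%:R) ^+ 2 * n%:R^-1 :> R by field; rewrite pnatr_eq0 -lt0n.
  by rewrite ler_wpM2r // invr_ge0.
apply: le_trans (ler_sum _ (fun x _ => h x)) _.
by rewrite sumr_const card_ord -[leLHS]mulr_natl divff // pnatr_eq0 -lt0n.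
Qed.
End Net.

Section OpNorm.
Variables (R : realType) (n : nat).
Hypothesis n0 : (0 < n)%N.

Definition bilinear (M : 'I_n -> 'I_n -> R) (u v : 'I_n -> R) : R :=
  \sum_x \sum_y M x y * (u x * v y).

Lemma bilinearDl M u1 u2 v : bilinear M (fun x => u1 x + u2 x) v = bilinear M u1 v + bilinear M u2 v.
Proof.
rewrite /bilinear -big_split; apply: eq_bigr => x _; rewrite -big_split; apply: eq_bigr => y _ /=; ring.
Qed.
Lemma bilinearDr M u v1 v2 : bilinear M u (fun x => v1 x + v2 x) = bilinear M u v1 + bilinear M u v2.
Proof.
rewrite /bilinear -big_split; apply: eq_bigr => x _; rewrite -big_split; apply: eq_bigr => y _ /=; ring.
Qed.
Lemma bilinearZl M c u v : bilinear M (fun x => c * u x) v = c * bilinear M u v.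
Proof.
rewrite /bilinear mulr_sumr; apply: eq_bigr => x _; rewrite mulr_sumr; apply: eq_bigr => y _ /=; ring.
Qed.
Lemma bilinearZr M c u v : bilinear M u (fun x => c * v x) = c * bilinear M u v.
Proof.
rewrite /bilinear mulr_sumr; apply: eq_bigr => x _; rewrite mulr_sumr; apply: eq_bigr => y _ /=; ring.
Qed.

(** Applying the approximation to the rescaled remainder again and again, each
    vector is a geometric series of net points; the a priori bound C / 2^k on
    the error after k rounds tends to zero. *)
Lemma net_to_ball M (B : R) : 0 <= B ->
  (forall z z', in_net z -> in_net z' -> bilinear M (@net_vec R n z) (@net_vec R n z') <= B) ->
  forall u v, \sum_x u x ^+ 2 <= 1 -> \sum_x v x ^+ 2 <= 1 -> bilinear M u v <= 2 * B.
Proof.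
move=> B0 hB.
pose C : R := \sum_x \sum_y `|M x y|.
have C0 : 0 <= C by apply: sumr_ge0 => x _; apply: sumr_ge0 => y _.
have le1 (w : 'I_n -> R) x : \sum_x w x ^+ 2 <= 1 -> `|w x| <= 1.
  move=> w2; rewrite -(ler_pXn2r (n := 2)) ?nnegrE // expr1n real_normK ?num_real //.
  apply: le_trans w2; rewrite (bigD1 x) //= lerDl.
  by apply: sumr_ge0 => *; apply: sqr_ge0.
have step (k : nat) u v : \sum_x u x ^+ 2 <= 1 -> \sum_x v x ^+ 2 <= 1 ->
    bilinear M u v <= 2 * B + C / 2 ^+ k.
  elim: k u v => [|k IH] u v hu hv.
    rewrite expr0 divr1; apply: (@le_trans _ _ C); last by rewrite lerDr mulr_ge0.
    apply: ler_sum => x _; apply: ler_sum => y _; apply: le_trans (ler_norm _) _.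
    by rewrite !normrM ler_piMr // mulr_ile1 // le1.
  have [z hz zu] := net_approx n0 hu; have [z' hz' zv] := net_approx n0 hv.
  have i4 (w : 'I_n -> R) z0 : w = (fun x => net_vec R z0 x + 4^-1 * (4 * (w x - net_vec R z0 x))).
    by apply/funext => x; rewrite mulKf ?pnatr_eq0 // addrC subrK.
  have e1 : bilinear M u v = bilinear M (net_vec R z) (net_vec R z') +
      4^-1 * bilinear M (net_vec R z) (fun x => 4 * (v x - net_vec R z' x)) +
      4^-1 * bilinear M (fun x => 4 * (u x - net_vec R z x)) v.
    rewrite {1}(i4 u z) bilinearDl bilinearZl; congr (_ + _).
    by rewrite {1}(i4 v z') bilinearDr bilinearZr.
  rewrite e1.
  have h1 := hB _ _ hz hz'.
  have h2 := IH _ _ (net_vec_norm R n0 hz) zv.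
  have h3 := IH _ _ zu hv.
  have -> : C / 2 ^+ k.+1 = (C / 2 ^+ k) / 2 by rewrite exprS invfM mulrA mulrAC.
  lra.
move=> u v hu hv; apply/ler_addgt0Pr => e e0.
pose k := (Num.truncn (C / e)).+1.
apply: le_trans (step k u v hu hv) _; rewrite lerD2l ler_pdivrMr ?exprn_gt0 //.
rewrite mulrC -ler_pdivrMr // ltW //.
have Ce : 0 <= C / e by rewrite divr_ge0 // ltW.
have /andP[_ h] := truncn_itv Ce; apply: lt_trans h _.
by rewrite -natrX ltr_nat ltn_expl.
Qed.

Lemma ball_to_opbound M (B : R) : 0 <= B ->
  (forall u v, \sum_x u x ^+ 2 <= 1 -> \sum_x v x ^+ 2 <= 1 -> bilinear M u v <= B) ->
  opbound M B.
Proof.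
move=> B0 hB g f.
have -> : \sum_u g u * kernel_apply M f u = bilinear M g f.
  apply: eq_bigr => x _; rewrite /kernel_apply mulr_sumr; apply: eq_bigr => y _; ring.
have zero (w : 'I_n -> R) x : l2 w = 0 -> w x = 0.
  by move=> h; apply/eqP; rewrite -normr_le0 -h l2_abs_le.
have [g0|g0] := eqVneq (l2 g) 0.
  rewrite /bilinear big1 ?normr0 ?mulr_ge0 ?l2_ge0 // => x _.
  by rewrite big1 // => y _; rewrite (zero g) // mul0r mulr0.
have [f0|f0] := eqVneq (l2 f) 0.
  rewrite /bilinear big1 ?normr0 ?mulr_ge0 ?l2_ge0 // => x _.
  by rewrite big1 // => y _; rewrite (zero f) // !mulr0.
have gp : 0 < l2 g by rewrite lt_def g0 l2_ge0.
have fp : 0 < l2 f by rewrite lt_def f0 l2_ge0.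
have unit (w : 'I_n -> R) c : 0 < l2 w -> c ^+ 2 = 1 -> \sum_x (c * (l2 w)^-1 * w x) ^+ 2 <= 1.
  move=> w0 c1; under eq_bigr do rewrite !exprMn c1 mul1r.
  by rewrite -mulr_sumr -l2_sq exprVn mulVf // expf_neq0 // gt_eqF.
have key c : c ^+ 2 = 1 -> c * bilinear M g f <= B * (l2 g * l2 f).
  move=> c1; rewrite -ler_pdivrMr ?mulr_gt0 //.
  have := hB _ _ (unit g c gp c1) (unit f 1 fp (expr1n _ _)).
  rewrite bilinearZl bilinearZr; congr (_ <= _); field; rewrite !gt_eqF //.
rewrite ler_norml lerNl; apply/andP; split.
  by have := key (-1); rewrite sqrrN expr1n mulN1r; apply.
by have := key 1; rewrite expr1n mul1r; apply.
Qed.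
End OpNorm.

(** * Operator norm of a sparse random array *)

Section BernoulliOpNorm.
Variables (R : realType) (T : finType) (mu : T -> R) (hmu : is_law mu).
Variables (n : nat) (X : T -> 'I_n -> 'I_n -> bool) (q : R).
Hypothesis hX : subpoisson mu X q.
Hypothesis q0 : 0 <= q.
Variables (L lam tau C0 K : R) (J : nat).
Hypotheses (n0 : (0 < n)%N) (L1 : 1 <= L) (lam0 : 0 <= lam) (C00 : 0 <= C0) (K0 : 0 <= K).
Hypotheses (qL : q <= lam * L / n%:R).
Hypotheses (tau1 : 1 < tau) (taul : 2 * expR 1 * lam <= tau) (tauL : 6 <= tau ^+ 3 / (2 + ln L)).
Hypotheses (tauC : C0 <= tau ^+ 3) (tauJ : Num.sqrt L <= tau ^+ J).

Let D := Num.sqrt L.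
Let L0 : 0 < L := lt_le_trans ltr01 L1.
Let n0' : 0 < n%:R :> R.
Proof. by rewrite ltr0n. Qed.
Let D1 : 1 <= D.
Proof. by rewrite -(ler_pXn2r (n := 2)) ?nnegrE ?sqrtr_ge0 // expr1n sqr_sqrtr // ltW. Qed.
Let D0 : 0 < D := lt_le_trans ltr01 D1.
Let DD : D ^+ 2 = L.
Proof. by rewrite sqr_sqrtr // ltW. Qed.

Definition row_sum (w : T) x : R := \sum_y (X w x y)%:R.
Definition col_sum (w : T) y : R := \sum_x (X w x y)%:R.
Definition rows_fail (w : T) : Prop := exists x, C0 * L <= row_sum w x.
Definition cols_fail (w : T) : Prop := exists y, C0 * L <= col_sum w y.
(** The threshold is compared with the absolute value of the product, so that
    the light part of the bilinear form has bounded coefficients and a Chernoff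
    bound survives the union over the net. *)
Definition light_part (z z' : net_index n) x y : R :=
  let a := net_vec R z x * net_vec R z' y in if `|a| <= D / n%:R then a else 0.
Definition light_fail (w : T) : Prop := exists zz : net_index n * net_index n,
  [/\ in_net zz.1, in_net zz.2 &
    K * D <= \sum_x \sum_y light_part zz.1 zz.2 x y * ((X w x y)%:R - q)].

Lemma row_edges x : row_sum^~ x = edges R X (fun x' _ => x' == x).
Proof.
apply/funext => w; rewrite /row_sum /edges [RHS](bigD1 x) //= [X in _ = _ + X]big1 ?addr0 => [|x' /negbTE h].
  by apply: eq_bigr => y _; rewrite eqxx mul1r.
by rewrite big1 // => y _; rewrite h mul0r.
Qed.

Lemma row_area x : area R (fun x' (_ : 'I_n) => x' == x) = n%:R.
Proof.
rewrite /area (bigD1 x) //= [X in _ + X]big1 ?addr0 => [|x' /negbTE h].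
  by under eq_bigr do rewrite eqxx; rewrite sumr_const card_ord.
by rewrite big1 // => y _; rewrite h.
Qed.

Lemma col_edges y : col_sum^~ y = edges R X (fun _ y' => y' == y).
Proof.
apply/funext => w; apply: eq_bigr => x _.
rewrite (bigD1 y) //= big1 ?addr0 ?eqxx ?mul1r // => y' /negbTE h.
by rewrite h mul0r.
Qed.

Lemma col_area y : area R (fun (_ : 'I_n) y' => y' == y) = n%:R.
Proof.
have h : \sum_(y' < n) (y' == y)%:R = 1 :> R.
  rewrite (bigD1 y) //= big1 ?addr0 ?eqxx // => y' /negbTE h'; by rewrite h'.
by rewrite /area; under eq_bigr do rewrite h; rewrite sumr_const card_ord.
Qed.

Lemma sum_upper Q : area R Q = n%:R ->
  prob mu (fun w => C0 * L <= edges R X Q w) <= expR ((expR 1 * lam - C0) * L).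
Proof.
move=> hQ; apply: le_trans (edges_upper hmu hX _ _ ler01) _.
rewrite ler_expR hQ mul1r mulrBl addrC lerD2r.
apply: (@le_trans _ _ (lam * L / n%:R * (n%:R * expR 1))).
  apply: ler_pM => //.
  by rewrite ler_wpM2l // lerBlDr lerDl.
rewrite le_eqVlt; apply/orP; left; apply/eqP; field; exact: lt0r_neq0.
Qed.

Lemma rows_fail_prob : prob mu rows_fail <= n%:R * expR ((expR 1 * lam - C0) * L).
Proof.
apply: le_trans (prob_exists _ hmu) _.
rewrite -[n in n%:R]card_ord mulr_natl -sumr_const; apply: ler_sum => x _.
have := sum_upper (row_area x); rewrite -row_edges; exact.
Qed.

Lemma cols_fail_prob : prob mu cols_fail <= n%:R * expR ((expR 1 * lam - C0) * L).
Proof.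
apply: le_trans (prob_exists _ hmu) _.
rewrite -[n in n%:R]card_ord mulr_natl -sumr_const; apply: ler_sum => x _.
have := sum_upper (col_area x); rewrite -col_edges; exact.
Qed.

Lemma prod_norm_sq (u v : 'I_n -> R) : \sum_x u x ^+ 2 <= 1 -> \sum_x v x ^+ 2 <= 1 ->
  \sum_x \sum_y (u x * v y) ^+ 2 <= 1.
Proof.
move=> hu hv; under eq_bigr do under eq_bigr do rewrite exprMn.
under eq_bigr do rewrite -mulr_sumr.
by rewrite -mulr_suml mulr_ile1 // ?sum_sq_ge0.
Qed.

Lemma light_fail_prob : prob mu light_fail <= expR ((36 + expR 1 * lam - K) * n%:R).
Proof.
apply: le_trans (prob_exists _ hmu) _.
have Dn0 : 0 < D / n%:R by rewrite divr_gt0.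
apply: (@le_trans _ _ (\sum_(zz : net_index n * net_index n)
   ((in_net zz.1)%:R * (in_net zz.2)%:R) * expR ((expR 1 * lam - K) * n%:R))).
  apply: ler_sum => -[z z'] _ /=.
  have [h|h] := boolP (in_net z && in_net z'); last first.
    rewrite -natrM mulnb (negbTE h) mul0r /prob big1 // => w _.
    case: asboolP => [[h1 h2 _]|_]; last by rewrite mulr0.
    by rewrite h1 h2 in h.
  case/andP: h => hz hz'; rewrite hz hz' !mul1r.
  apply: le_trans (prob_le (B := fun w => K * D <= \sum_x \sum_y light_part z z' x y * ((X w x y)%:R - q)) hmu _) _.
    by move=> w [].
  apply: le_trans (@bilinear_upper _ _ _ hmu _ _ _ hX q0 (light_part z z') _ (K * D) Dn0 _ _) _.
  - by move=> x y; rewrite /light_part; case: ifP => // _; rewrite normr0 ltW.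
  - apply: le_trans (prod_norm_sq (net_vec_norm R n0 hz) (net_vec_norm R n0 hz')).
    apply: ler_sum => x _; apply: ler_sum => y _; rewrite /light_part.
    by case: ifP => // _; rewrite expr0n sqr_ge0.
  rewrite ler_expR mulrBl addrC.
  have -> : K * D / (D / n%:R) = K * n%:R by field; rewrite !lt0r_neq0.
  rewrite lerD2r ler_pdivrMr ?exprn_gt0 //.
  apply: le_trans (ler_wpM2l (expR_ge0 1) qL) _.
  rewrite le_eqVlt; apply/orP; left; apply/eqP.
  by rewrite expr_div_n DD; field; rewrite lt0r_neq0.
rewrite -mulr_suml.
rewrite -(pair_bigA _ (fun z z' : net_index n => (in_net z)%:R * (in_net z')%:R)) /=.
under eq_bigr do rewrite -mulr_sumr.
rewrite -mulr_suml.
have h : \sum_(z : net_index n) (in_net z)%:R <= expR (18 * n%:R) :> R.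
  rewrite -natr_sum -big_mkcond sum1_card.
  apply: le_trans (net_card R n) _.
  rewrite -natrM -[(18 * n)%:R]mulr1 expRM_natl lerXn2r ?nnegrE ?expR_ge0 //.
  by have := expR_ge1Dx (1 : R); lra.
have h0 : 0 <= \sum_(z : net_index n) (in_net z)%:R :> R by rewrite sumr_ge0.
have -> : (36 + expR 1 * lam - K) * n%:R = 36 * n%:R + (expR 1 * lam - K) * n%:R by ring.
rewrite [leRHS]expRD ler_wpM2r ?expR_ge0 //.
apply: le_trans (ler_pM h0 h0 h h) _.
by rewrite -expRD ler_expR; lra.
Qed.

Lemma rect_sum (A B : {set 'I_n}) w :
  edges R X (rect A B) w = \sum_(x in A) \sum_(y in B) (X w x y)%:R.
Proof.
rewrite /edges /rect [RHS]big_mkcond; apply: eq_bigr => x _.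
case: (x \in A) => /=; last by rewrite big1 // => y _; rewrite mul0r.
rewrite [RHS]big_mkcond; apply: eq_bigr => y _.
by case: (y \in B); rewrite ?mul1r ?mul0r.
Qed.

(** When one side of the rectangle is more than L times the other, the bound on
    the row or column sums already gives the estimate. *)
Lemma no_discrepancy w : ~ discrepancy_fails X L tau w -> ~ rows_fail w -> ~ cols_fail w ->
  forall A B : {set 'I_n}, (0 < #|A|)%N -> (0 < #|B|)%N ->
  L * #|A|%:R * #|B|%:R <= tau ^+ 4 * n%:R ^+ 2 ->
  \sum_(x in A) \sum_(y in B) (X w x y)%:R <=
    tau ^+ 3 * (D * Num.sqrt (#|A|%:R * #|B|%:R)) :> R.
Proof.
move=> hd hr hc A B A0 B0 hAB.
have sideE : side L A B = D * Num.sqrt (#|A|%:R * #|B|%:R).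
  by rewrite /side -mulrA (sqrtrM _ (ltW L0)).
rewrite -sideE.
have rl x : row_sum w x <= C0 * L by rewrite leNgt; apply/negP => h; apply: hr; exists x; exact: ltW.
have cl y : col_sum w y <= C0 * L by rewrite leNgt; apply/negP => h; apply: hc; exists y; exact: ltW.
have s0 : 0 <= side L A B by rewrite sqrtr_ge0.
have s2 : side L A B ^+ 2 = L * #|A|%:R * #|B|%:R by rewrite sqr_sqrtr ?mulr_ge0 ?(ltW L0).
have [h1|h1] := leP (#|A|%:R) (#|B|%:R * L); last first.
  rewrite exchange_big /=; apply: (@le_trans _ _ (\sum_(y in B) C0 * L)).
    apply: ler_sum => y _; apply: le_trans (cl y).
    by apply: sum_in_le => x.
  rewrite sumr_const -[leLHS]mulr_natr -mulrA; apply: ler_pM => //; first by rewrite mulr_ge0 ?(ltW L0).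
  rewrite -(ler_pXn2r (n := 2)) ?nnegrE ?mulr_ge0 ?(ltW L0) //.
  have -> : (L * #|B|%:R) ^+ 2 = L * #|B|%:R * (#|B|%:R * L) by ring.
  by rewrite s2 [leRHS]mulrAC ler_wpM2l ?(ltW h1) // mulr_ge0 // (ltW L0).
have [h2|h2] := leP (#|B|%:R) (#|A|%:R * L); last first.
  apply: (@le_trans _ _ (\sum_(x in A) C0 * L)).
    apply: ler_sum => x _; apply: le_trans (rl x).
    by apply: sum_in_le => y.
  rewrite sumr_const -[leLHS]mulr_natr -mulrA; apply: ler_pM => //; first by rewrite mulr_ge0 ?(ltW L0).
  rewrite -(ler_pXn2r (n := 2)) ?nnegrE ?mulr_ge0 ?(ltW L0) //.
  have -> : (L * #|A|%:R) ^+ 2 = L * #|A|%:R * (#|A|%:R * L) by ring.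
  by rewrite s2 ler_wpM2l ?(ltW h2) // mulr_ge0 // (ltW L0).
rewrite leNgt; apply/negP => h; apply: hd; exists (A, B); split => //=.
by rewrite rect_sum ltW.
Qed.

Definition op_const : R := (K + lam + 2 * C0 + (2 * J + 1)%:R * tau ^+ 5) * D.

(** For a pair in the net, light pairs of coordinates are controlled directly.
    On a heavy one |u v| <= (n / D) (u v)^2, so the mean contribution of these
    is at most lam D, and their actual contribution is bounded by heavy_sum. *)
Lemma good_opbound w : ~ discrepancy_fails X L tau w -> ~ rows_fail w -> ~ cols_fail w ->
  ~ light_fail w -> opbound (fun x y => (X w x y)%:R - q) (2 * op_const).
Proof.
move=> hd hr hc hl.
have t0 : 0 < tau := lt_trans ltr01 tau1.
have oc0 : 0 <= op_const by rewrite mulr_ge0 ?(ltW D0) // !addr_ge0 ?mulr_ge0 ?exprn_ge0 ?(ltW t0).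
apply: ball_to_opbound; first by rewrite mulr_ge0.
apply: net_to_ball => // z z' hz hz'.
set u := net_vec R z; set v := net_vec R z'.
have u2 : \sum_x u x ^+ 2 <= 1 := net_vec_norm R n0 hz.
have v2 : \sum_x v x ^+ 2 <= 1 := net_vec_norm R n0 hz'.
have au2 : \sum_x `|u x| ^+ 2 <= 1 by under eq_bigr do rewrite real_normK ?num_real //.
have av2 : \sum_x `|v x| ^+ 2 <= 1 by under eq_bigr do rewrite real_normK ?num_real //.
have rl x : \sum_y (X w x y)%:R <= C0 * L by rewrite leNgt; apply/negP => h; apply: hr; exists x; exact: ltW.
have cl y : \sum_x (X w x y)%:R <= C0 * L by rewrite leNgt; apply/negP => h; apply: hc; exists y; exact: ltW.
have Y0 x y : 0 <= (X w x y)%:R :> R by [].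
have hv := heavy_sum n0 Y0 D1 DD tau1 tauJ rl cl (no_discrepancy hd hr hc)
  (fun x => normr_ge0 (u x)) (fun x => normr_ge0 (v x)) au2 av2.
have hlight : \sum_x \sum_y light_part z z' x y * ((X w x y)%:R - q) <= K * D.
  by rewrite leNgt; apply/negP => h; apply: hl; exists (z, z'); split => //=; exact: ltW.
have hq : \sum_x \sum_y (n%:R / D * q) * (u x * v y) ^+ 2 <= lam * D.
  under eq_bigr do rewrite -mulr_sumr.
  rewrite -mulr_sumr; apply: (@le_trans _ _ (n%:R / D * q * 1)).
    by rewrite ler_wpM2l ?prod_norm_sq // mulr_ge0 // divr_ge0 // ltW.
  rewrite mulr1 -ler_pdivlMl ?divr_gt0 // invf_div.
  apply: le_trans qL _; rewrite -DD le_eqVlt; apply/orP; left; apply/eqP; field.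
  exact: lt0r_neq0.
apply: (@le_trans _ _ (\sum_x \sum_y (light_part z z' x y * ((X w x y)%:R - q) +
   ((D / n%:R < `|u x| * `|v y|)%R%:R * (X w x y)%:R * (`|u x| * `|v y|) +
    (n%:R / D * q) * (u x * v y) ^+ 2)))).
  apply: ler_sum => x _; apply: ler_sum => y _.
  rewrite /light_part -/(u x) -/(v y) normrM.
  have p1 : 0 <= (n%:R / D * q) * (u x * v y) ^+ 2.
    by apply: mulr_ge0; rewrite ?sqr_ge0 // mulr_ge0 // divr_ge0 // (ltW D0).
  have [h|h] := leP (`|u x| * `|v y|) (D / n%:R).
    by rewrite !mul0r add0r [leLHS]mulrC lerDl.
  rewrite mul0r add0r mul1r mulrBl; apply: lerD.
    by rewrite ler_wpM2l // -normrM ler_norm.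
  apply: (@le_trans _ _ (q * `|u x * v y|)).
    by rewrite -mulrN ler_wpM2l // -normrN ler_norm.
  have -> : n%:R / D * q * (u x * v y) ^+ 2 = q * ((n%:R / D * `|u x * v y|) * `|u x * v y|).
    by rewrite -[(u x * v y) ^+ 2]real_normK ?num_real //; ring.
  rewrite ler_wpM2l // ler_peMl // normrM.
  by rewrite -ler_pdivrMl ?divr_gt0 // invf_div mulr1 ltW.
have -> : \sum_x \sum_y (light_part z z' x y * ((X w x y)%:R - q) +
   ((D / n%:R < `|u x| * `|v y|)%R%:R * (X w x y)%:R * (`|u x| * `|v y|) +
    (n%:R / D * q) * (u x * v y) ^+ 2)) =
   \sum_x \sum_y light_part z z' x y * ((X w x y)%:R - q) +
   (\sum_x \sum_y (D / n%:R < `|u x| * `|v y|)%R%:R * (X w x y)%:R * (`|u x| * `|v y|) +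
    \sum_x \sum_y (n%:R / D * q) * (u x * v y) ^+ 2).
  rewrite -!big_split /=; apply: eq_bigr => x _.
  by rewrite -!big_split /=; apply: eq_bigr.
rewrite /op_const.
move: hlight hv hq; rewrite -/D; lra.
Qed.

Lemma bernoulli_opnorm :
  prob mu (fun w => ~ [/\ opbound (fun x y => (X w x y)%:R - q) (2 * op_const),
     forall x, row_sum w x <= C0 * L & forall y, col_sum w y <= C0 * L])
  <= n%:R ^- 2 + 2 * (n%:R * expR ((expR 1 * lam - C0) * L)) + expR ((36 + expR 1 * lam - K) * n%:R).
Proof.
have h1 := discrepancy_fails_prob hmu hX q0 n0 L1 (ltW tau1) qL taul tauL.
have h2 := rows_fail_prob; have h3 := cols_fail_prob; have h4 := light_fail_prob.
apply: (@le_trans _ _ (prob mu (fun w => (discrepancy_fails X L tau w \/ rows_fail w) \/ (cols_fail w \/ light_fail w)))).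
  apply: prob_le => // w; apply: contra_notP => /not_orP[/not_orP[a1 a2] /not_orP[a3 a4]].
  split; first exact: good_opbound.
    by move=> x; rewrite leNgt; apply/negP => h; apply: a2; exists x; exact: ltW.
  by move=> x; rewrite leNgt; apply/negP => h; apply: a3; exists x; exact: ltW.
apply: le_trans (prob_or _ _ hmu) _.
have h5 := prob_or (discrepancy_fails X L tau) rows_fail hmu.
have h6 := prob_or cols_fail light_fail hmu.
lra.
Qed.

End BernoulliOpNorm.

Section Asymptotics.
Variable R : realType.

Lemma near_nat_ge (M : R) : \forall n \near \oo, M <= n%:R.
Proof.
exists (Num.truncn M).+1 => // n /= hn; apply: ltW.
by apply: lt_le_trans (truncnS_gt M) _; rewrite ler_nat.
Qed.

Lemma near_ln_ge (M : R) : \forall n \near \oo, M <= ln n%:R.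
Proof.
near=> n.
have h : expR M <= n%:R by near: n; exact: near_nat_ge.
rewrite -[M]expRK ler_ln ?posrE ?expR_gt0 //.
exact: lt_le_trans (expR_gt0 _) h.
Unshelve. all: by end_near. Qed.

Lemma near_powR_ge (e M : R) : 0 < e -> exists L0, forall L : R, L0 <= L -> M <= L `^ e.
Proof.
move=> e0; exists ((Num.max M 1) `^ e^-1) => L hL.
have m0 : 0 <= Num.max M 1 by rewrite le_max ler01 orbT.
apply: (@le_trans _ _ (Num.max M 1)); first by rewrite le_max lexx.
move: m0 hL; move: (Num.max M 1) => m m0 hL.
rewrite -[leLHS]powRr1 // -(@mulVf _ e) ?gt_eqF // powRrM.
have L0 : 0 <= L by apply: le_trans hL; rewrite powR_ge0.
by apply: ge0_ler_powR; rewrite ?nnegrE ?powR_ge0 ?(ltW e0).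
Qed.

Definition well_spread n (X : 'I_n -> 'I_n -> bool) (q b C : R) : Prop :=
  [/\ opbound (fun x y => (X x y)%:R - q) b,
      forall x, \sum_y (X x y)%:R <= C & forall y, \sum_x (X x y)%:R <= C].

(** The base tau of the bands is taken to be L^(eps / 6). Six powers of it
    bound the operator norm, each constant is below it for large n, and the
    number J of bands within a factor sqrt L of each other stays bounded. *)
Lemma opnorm_whp (lam eps : R) : 0 <= lam -> 0 < eps ->
  forall d : R, 0 < d -> \forall n \near \oo,
    forall (T : finType) (mu : T -> R) (X : T -> 'I_n -> 'I_n -> bool) (q : R),
    is_law mu -> subpoisson mu X q -> 0 <= q -> q <= lam * ln n%:R / n%:R ->
    prob mu (fun w => ~ well_spread (X w) q (ln n%:R `^ (2^-1 + eps))
       ((expR 1 * lam + 2) * ln n%:R)) <= d.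
Proof.
move=> lam0 eps0 d d0.
(* C0 leaves n^(-2) for the tail of each row or column sum, and K beats the e^(36 n)
   pairs of points of the net. *)
pose C0 := expR 1 * lam + 2; pose K := 37 + expR 1 * lam.
have e0 : 0 <= expR 1 * lam by rewrite mulr_ge0 ?expR_ge0.
pose e' := eps / 6.
have e'0 : 0 < e' by rewrite divr_gt0.
pose J := (Num.truncn (2 * e')^-1).+1.
pose M := 2 + 2 * expR 1 * lam + C0 + 12 + 6 / e' + 2 * (K + lam + 2 * C0) + 2 * (2 * J + 1)%:R.
have [L0 hL0] := near_powR_ge M e'0.
near=> n.
have L1 : 1 <= ln n%:R :> R by near: n; exact: near_ln_ge.
have hL : L0 <= ln n%:R by near: n; exact: near_ln_ge.
have h4 : 4 / d <= n%:R by near: n; exact: near_nat_ge.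
have n1 : 1 <= n%:R :> R by near: n; exact: near_nat_ge.
have n0 : (0 < n)%N by rewrite -(ler_nat R).
have n0' : 0 < n%:R :> R by rewrite ltr0n.
move=> T mu X q hmu hX q0 qL.
set L := ln n%:R in qL L1 hL *.
have Lp : 0 < L := lt_le_trans ltr01 L1.
pose tau := L `^ e'.
have tauM : M <= tau by apply: hL0.
have J0 : 0 <= (2 * J + 1)%:R :> R by [].
have ie0 : 0 <= 6 / e' by rewrite divr_ge0 // ltW.
have C00 : 0 <= C0 by rewrite addr_ge0.
have K0 : 0 <= K by rewrite addr_ge0.
have tau2 : 2 <= tau by move: tauM; rewrite /M; lra.
have tau1 : 1 < tau by lra.
have tau0 : 0 < tau by lra.
have lel : 2 * expR 1 * lam <= tau by move: tauM; rewrite /M; lra.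
have tC : C0 <= tau ^+ 3.
  apply: (@le_trans _ _ tau); first by move: tauM; rewrite /M; lra.
  by rewrite -{1}[tau]expr1 ler_eXn2l.
have lnLE : ln L <= tau / e'.
  have -> : ln L = ln tau / e' by rewrite /tau ln_powR mulrAC divff ?gt_eqF // mul1r.
  rewrite ler_wpM2r ?invr_ge0 ?(ltW e'0) //.
  have := @le_ln1Dx R (tau - 1); rewrite addrCA subrr addr0 => h.
  by apply: le_trans (h _) _; lra.
have lnL0 : 0 <= ln L by rewrite ln_ge0.
have tL : 6 <= tau ^+ 3 / (2 + ln L).
  rewrite ler_pdivlMr; last by lra.
  apply: (@le_trans _ _ (tau * (12 + 6 / e'))).
    have : 6 * (tau / e') = tau * (6 / e') by ring.
    nra.
  have h1 : 12 + 6 / e' <= tau by move: tauM; rewrite /M; lra.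
  have h2 : tau * (12 + 6 / e') <= tau * tau by rewrite ler_wpM2l // ltW.
  apply: le_trans h2 _; rewrite -expr2 ler_eXn2l //.
have tJ : Num.sqrt L <= tau ^+ J.
  rewrite -powR12_sqrt ?(ltW Lp) // -powR_mulrn ?(ltW tau0) // /tau -powRrM.
  rewrite ler_powR //.
  have h := truncnS_gt (2 * e')^-1; rewrite -/J in h.
  rewrite -ler_pdivrMl //.
  by rewrite -invfM [e' * 2]mulrC ltW.
have := bernoulli_opnorm hmu hX q0 n0 L1 lam0 C00 K0 qL tau1 lel tL tC tJ.
set B := op_const _ _ _ _ _ _.
have hB : 2 * B <= L `^ (2^-1 + eps).
  rewrite /B /op_const powRD ?(gt_eqF Lp) ?implybT //.
  have -> : L `^ eps = tau ^+ 6.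
    rewrite /tau -powR_mulrn ?powR_ge0 // -powRrM; congr (_ `^ _); rewrite /e'; by field.
  rewrite powR12_sqrt ?(ltW Lp) // mulrA [leRHS]mulrC ler_wpM2r ?sqrtr_ge0 //.
  rewrite [tau ^+ 6]exprS.
  have t5 : 1 <= tau ^+ 5 by rewrite exprn_ege1 // ltW.
  apply: (@le_trans _ _ ((2 * (K + lam + 2 * C0) + 2 * (2 * J + 1)%:R) * tau ^+ 5)).
    have : 0 <= 2 * (K + lam + 2 * C0) by lra.
    nra.
  by rewrite ler_wpM2r ?(le_trans ler01) //; move: tauM; rewrite /M; lra.
move=> hp; apply: le_trans (le_trans _ hp) _.
  apply: prob_le => // w; apply: contra_not => -[h1 h2 h3]; split => //.
  move=> g f; apply: le_trans (h1 g f) _.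
  by rewrite ler_wpM2r // mulr_ge0 ?l2_ge0.
have eL : expR ((expR 1 * lam - C0) * L) = n%:R ^- 2.
  have -> : (expR 1 * lam - C0) * L = - (L * 2%:R) by rewrite /C0; ring.
  by rewrite expRN expRM_natr lnK ?posrE.
have eK : expR ((36 + expR 1 * lam - K) * n%:R) <= n%:R^-1.
  have -> : (36 + expR 1 * lam - K) * n%:R = - n%:R by rewrite /K; ring.
  rewrite expRN lef_pV2 ?posrE ?expR_gt0 //.
  by have := expR_ge1Dx (n%:R : R); lra.
rewrite eL.
have nn : n%:R ^- 2 <= n%:R^-1 :> R.
  by rewrite lef_pV2 ?posrE ?exprn_gt0 // expr2 ler_peMr // ltW.
have -> : n%:R * n%:R ^- 2 = n%:R^-1 :> R by field; rewrite gt_eqF.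
apply: (@le_trans _ _ (4 * n%:R^-1)); first by lra.
by rewrite ler_pdivrMr // -ler_pdivrMl // mulrC.
Unshelve. all: by end_near. Qed.

End Asymptotics.

(** * The law of the marks *)

Section ConfigLaw.
Variables (R : realType) (m n : nat) (p alpha : R).
Hypotheses (hm : (1 < m)%N).

Let mw (i : 'I_m) (c : mark m) : R := mark_weight p alpha i c.
Let cw (w : config m n) : R := config_weight p alpha w.

Lemma expect_prod (G : slot m n -> mark m -> R) :
  expect cw (fun w => \prod_s G s (w s)) = \prod_s \sum_c mw s.1.1 c * G s c.
Proof.
rewrite (bigA_distr_bigA (fun s c => mw s.1.1 c * G s c)).
by apply: eq_bigr => w _; rewrite -big_split.
Qed.

Lemma sum_config_weight : \sum_w cw w = 1.
Proof.
have := dbm_meanE p alpha (fun _ : digraph m n => 1 : R).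
rewrite /dbm_mean; under eq_bigr do rewrite mulr1.
by rewrite sum_dbm // => ->; apply: eq_bigr => w _; rewrite mulr1.
Qed.

Definition flag_weight (a : R) (b : bool) : R := if b then a else 1 - a.
Definition target_weight (i k : 'I_m) : R := if k != i then (m%:R - 1)^-1 else 0.

Lemma mark_weightE i e r k :
  mw i (e, r, k) = flag_weight p e * flag_weight alpha r * target_weight i k.
Proof. by []. Qed.

Lemma sum_target (i : 'I_m) : \sum_k target_weight i k = 1.
Proof.
rewrite -big_mkcond /= sumr_const cardC1 card_ord -[_ *+ _]mulr_natr.
rewrite -subn1 natrB 1?ltnW // mulVf // subr_eq0 -[1]/(1%:R) eqr_nat.
by rewrite gtn_eqF.
Qed.

Lemma sum_mark (i : 'I_m) (f : mark m -> R) :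
  \sum_c mw i c * f c = \sum_e \sum_r \sum_k flag_weight p e * flag_weight alpha r * target_weight i k * f (e, r, k).
Proof. by rewrite !pair_bigA /=; apply: eq_bigr => -[[e r] k]. Qed.

Lemma sum_mark1 (i : 'I_m) : \sum_c mw i c = 1.
Proof.
under eq_bigr do rewrite -[mw _ _]mulr1.
rewrite sum_mark !big_bool /= /flag_weight.
under eq_bigr do rewrite mulr1; under [X in _ + X + _]eq_bigr do rewrite mulr1.
under [X in _ + (X + _)]eq_bigr do rewrite mulr1; under [X in _ + (_ + X)]eq_bigr do rewrite mulr1.
by rewrite -!mulr_sumr sum_target; ring.
Qed.

Hypotheses (p0 : 0 <= p) (p1 : p <= 1) (a0 : 0 <= alpha) (a1 : alpha <= 1).

Lemma flag_weight_ge0 a b : 0 <= a -> a <= 1 -> 0 <= flag_weight a b.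
Proof. by move=> h0 h1; rewrite /flag_weight; case: b => //; rewrite subr_ge0. Qed.

Lemma target_weight_ge0 i k : 0 <= target_weight i k.
Proof.
rewrite /target_weight; case: ifP => // _.
by rewrite invr_ge0 subr_ge0 ler1n ltnW.
Qed.

Lemma mark_weight_ge0 i c : 0 <= mw i c.
Proof.
case: c => -[e r] k; rewrite mark_weightE !mulr_ge0 ?target_weight_ge0 ?flag_weight_ge0 //.
Qed.

Lemma config_law : is_law cw.
Proof.
split; last exact: sum_config_weight.
by move=> w; apply: prodr_ge0 => s _; apply: mark_weight_ge0.
Qed.

(** Each entry is a function of the mark of its own slot, so the exponential
    moment factorizes over the slots. *)
Lemma config_subpoisson (i : 'I_m) (h : mark m -> bool) :
  subpoisson cw (fun w x y => h (w (i, x, y))) (\sum_c mw i c * (h c)%:R).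
Proof.
move=> th; pose q : R := \sum_c mw i c * (h c)%:R; rewrite -/q.
pose G (s : slot m n) (c : mark m) : R :=
  if s.1.1 == i then expR (th s.1.2 s.2 * (h c)%:R) else 1.
have -> : expect cw (fun w => expR (\sum_x \sum_y th x y * (h (w (i, x, y)))%:R)) =
   expect cw (fun w => \prod_s G s (w s)).
  apply: eq_bigr => w _; congr (_ * _).
  have -> : \prod_s G s (w s) = \prod_j \prod_x \prod_y G (j, x, y) (w (j, x, y)).
    by rewrite !pair_bigA /=; apply: eq_bigr => -[[j x] y].
  rewrite (bigD1 i) //= [X in _ = _ * X]big1 ?mulr1 => [|j /negbTE hj].
    rewrite expR_sum; apply: eq_bigr => x _.
    by rewrite expR_sum; apply: eq_bigr => y _; rewrite /G eqxx.
  by rewrite big1 // => x _; rewrite big1 // => y _; rewrite /G /= hj.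
rewrite expect_prod.
have -> : \prod_s \sum_c mw s.1.1 c * G s c =
   \prod_j \prod_x \prod_y \sum_c mw j c * G (j, x, y) c.
  by rewrite !pair_bigA /=; apply: eq_bigr => -[[j x] y].
rewrite (bigD1 i) //= [X in _ * X]big1 ?mulr1 => [|j /negbTE hj]; last first.
  rewrite big1 // => x _; rewrite big1 // => y _; rewrite /G /= hj.
  by under eq_bigr do rewrite mulr1; rewrite sum_mark1.
rewrite mulr_sumr expR_sum; apply: ler_prod => x _.
apply/andP; split.
  apply: prodr_ge0 => y _; apply: sumr_ge0 => c _; rewrite mulr_ge0 ?mark_weight_ge0 //.
  by rewrite /G; case: ifP => // _; rewrite expR_ge0.
rewrite mulr_sumr expR_sum; apply: ler_prod => y _.
apply/andP; split.
  apply: sumr_ge0 => c _; rewrite mulr_ge0 ?mark_weight_ge0 //.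
  by rewrite /G; case: ifP => // _; rewrite expR_ge0.
have -> : \sum_c mw i c * G (i, x, y) c = 1 + q * (expR (th x y) - 1).
  transitivity (\sum_c mw i c + q * (expR (th x y) - 1)); last by rewrite sum_mark1.
  rewrite /q mulr_suml -big_split; apply: eq_bigr => c _ /=.
  rewrite /G eqxx; case: (h c); rewrite ?mulr1 ?mulr0 ?expR0 ?mul0r; ring.
exact: expR_ge1Dx.
Qed.

End ConfigLaw.

(** * Walk operators and their expansion *)

Lemma sum_vertex (R : realType) (m n : nat) (F : vertex m n -> R) :
  \sum_v F v = \sum_j \sum_y F (j, y).
Proof. by rewrite pair_bigA /=; apply: eq_bigr => -[j y]. Qed.

Section Walk.
Variables (R : realType) (m n : nat).
Implicit Types (w : config m n) (u v : vertex m n) (f : vertex m n -> R).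
Variable dst : 'I_m -> mark m -> 'I_m.

Definition slot_of u (y : 'I_n) : slot m n := (u.1, u.2, y).
Definition adj w u (y : 'I_n) : bool := (u.2 != y) && (w (slot_of u y)).1.1.
(** Slots are counted, not end points: rewiring keeps the second coordinate of
    the end point, so edges never merge and the out-degree does not depend on
    the rewiring. *)
Definition degr w u : nat := \sum_y adj w u y.

(** The operator acts on functions, as a conditional expectation of the next
    value. The rule dst says to which community the edge leads: the same
    definition serves the rewired graph and the unrewired one. *)
Definition walk w f u : R :=
  (degr w u)%:R^-1 * \sum_y (adj w u y)%:R * f (dst u.1 (w (slot_of u y)), y).

Definition arc w u v : bool := adj w u v.2 && (dst u.1 (w (slot_of u v.2)) == v.1).

Lemma arc_sum w f u :
  \sum_v (arc w u v)%:R * f v = \sum_y (adj w u y)%:R * f (dst u.1 (w (slot_of u y)), y).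
Proof.
rewrite sum_vertex /= exchange_big /=.
apply: eq_bigr => y _; rewrite (bigD1 (dst u.1 (w (slot_of u y)))) //= /arc /= eqxx andbT.
rewrite big1 ?addr0 // => j; rewrite eq_sym => /negbTE ->.
by rewrite andbF mul0r.
Qed.

Lemma degr_arc w u : (degr w u)%:R = \sum_v (arc w u v)%:R :> R.
Proof.
under eq_bigr do rewrite -[_%:R]mulr1.
rewrite (arc_sum w (fun=> 1)) /degr natr_sum.
by apply: eq_bigr => y _; rewrite mulr1.
Qed.

Lemma walk_kernel_apply w f u : walk w f u = (degr w u)%:R^-1 * kernel_apply (fun u v => (arc w u v)%:R) f u.
Proof. by rewrite /walk -arc_sum. Qed.

Lemma walkD w f g u : walk w (fun v => f v + g v) u = walk w f u + walk w g u.
Proof.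
by rewrite /walk; under eq_bigr do rewrite mulrDr; rewrite big_split mulrDr.
Qed.

Lemma walkZ w c f u : walk w (fun v => c * f v) u = c * walk w f u.
Proof.
by rewrite /walk; under eq_bigr do rewrite mulrCA; rewrite -mulr_sumr mulrCA.
Qed.

Lemma walk_const w c u : (0 < degr w u)%N -> walk w (fun=> c) u = c.
Proof.
move=> d0; rewrite /walk -mulr_suml -natr_sum -/(degr w u) mulrA mulVf ?mul1r //.
by rewrite pnatr_eq0 -lt0n.
Qed.

Lemma walk_le w f g u : (forall v, f v <= g v) -> walk w f u <= walk w g u.
Proof.
move=> h; rewrite /walk ler_wpM2l ?invr_ge0 //.
by apply: ler_sum => y _; rewrite ler_wpM2l.
Qed.

Lemma walk_abs w f u c : 0 <= c -> (forall v, `|f v| <= c) -> `|walk w f u| <= c.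
Proof.
move=> c0 h.
have [d0|d0] := posnP (degr w u); first by rewrite /walk d0 invr0 mul0r normr0.
rewrite ler_norml; apply/andP; split.
  by rewrite -(walk_const (- c) d0); apply: walk_le => v; have := h v; rewrite ler_norml => /andP[].
by rewrite -[leRHS](walk_const c d0); apply: walk_le => v; have := h v; rewrite ler_norml => /andP[].
Qed.

Definition iwalk w t f : vertex m n -> R := iter t (walk w) f.

Lemma iwalkS w t f u : iwalk w t.+1 f u = iwalk w t (walk w f) u.
Proof. by rewrite /iwalk iterSr. Qed.

Lemma eq_walk w f g u : f =1 g -> walk w f u = walk w g u.
Proof. by move=> /funext ->. Qed.

Lemma iwalkD w t f g u : iwalk w t (fun v => f v + g v) u = iwalk w t f u + iwalk w t g u.
Proof.
elim: t u => //= t IH u; rewrite /= -walkD; exact: eq_walk.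
Qed.

Lemma iwalkZ w t c f u : iwalk w t (fun v => c * f v) u = c * iwalk w t f u.
Proof.
elim: t u => //= t IH u; rewrite /= -walkZ; exact: eq_walk.
Qed.

Lemma iwalk_const w t c u : (forall u, 0 < degr w u)%N -> iwalk w t (fun=> c) u = c.
Proof.
move=> d0; elim: t u => //= t IH u; rewrite /= (@eq_walk _ _ (fun=> c)) ?walk_const //.
Qed.

Lemma iwalk_abs w t f u c : 0 <= c -> (forall v, `|f v| <= c) -> `|iwalk w t f u| <= c.
Proof. by move=> c0 h; elim: t u => //= t IH u; apply: walk_abs. Qed.

Lemma iwalk_le w t f g u : (forall v, f v <= g v) -> iwalk w t f u <= iwalk w t g u.
Proof. by move=> h; elim: t u => //= t IH u; apply: walk_le. Qed.

Lemma iwalk_sum w t (I : finType) (f : I -> vertex m n -> R) u :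
  iwalk w t (fun v => \sum_i f i v) u = \sum_i iwalk w t (f i) u.
Proof.
elim: t u => //= t IH u.
rewrite (@eq_walk w _ _ u IH) /walk.
rewrite -mulr_sumr; congr (_ * _); rewrite exchange_big /=.
by apply: eq_bigr => y _; rewrite mulr_sumr.
Qed.

Variables (p : R) (kd : 'I_m -> 'I_m -> R).
Definition noise w u v : R := (arc w u v)%:R - p * kd u.1 v.1.
(** The mean of the unnormalized step, up to the factor given by the
    out-degree: it depends on f only through its community sums. *)
Definition drift f u : R := p * \sum_j kd u.1 j * \sum_y f (j, y).
Definition enoise w f u : R := (degr w u)%:R^-1 * kernel_apply (noise w) f u.
Definition edrift w f u : R := (degr w u)%:R^-1 * drift f u.

Lemma walk_split w f u : walk w f u = enoise w f u + edrift w f u.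
Proof.
rewrite walk_kernel_apply /enoise /edrift -mulrDr; congr (_ * _).
have -> : drift f u = \sum_v p * kd u.1 v.1 * f v.
  rewrite sum_vertex /= /drift mulr_sumr.
  by apply: eq_bigr => j _; rewrite !mulr_sumr; apply: eq_bigr => y _ /=; ring.
by rewrite /kernel_apply -big_split; apply: eq_bigr => v _ /=; rewrite /noise; ring.
Qed.

Definition block_hit (i j : 'I_m) (c : mark m) : bool := c.1.1 && (dst i c == j).

Lemma l2_block f j : l2 (fun y => f (j, y)) <= l2 f.
Proof.
apply: l2_le; rewrite ?l2_ge0 // l2_sq sum_vertex /=.
rewrite [leRHS](bigD1 j) //= lerDl; apply: sumr_ge0 => ? _; exact: sum_sq_ge0.
Qed.

(** The noise consists of m^2 blocks. In each of them only the diagonal, which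
    the graph omits, has to be subtracted; it costs 1. *)
Lemma noise_opbound w b : 0 <= b ->
  (forall i j, opbound (fun x y => (block_hit i j (w (i, x, y)))%:R - p * kd i j) b) ->
  opbound (noise w) ((m * m)%:R * (b + 1)).
Proof.
move=> b0 hb g f.
pose Bl i j := \sum_x g (i, x) * kernel_apply (fun x y => (block_hit i j (w (i, x, y)))%:R - p * kd i j) (fun y => f (j, y)) x
   - \sum_x g (i, x) * ((block_hit i j (w (i, x, x)))%:R * f (j, x)).
have -> : \sum_u g u * kernel_apply (noise w) f u = \sum_i \sum_j Bl i j.
  rewrite sum_vertex /=.
  apply: eq_bigr => i _; rewrite /Bl; under [RHS]eq_bigr do rewrite -sumrB.
  rewrite exchange_big; apply: eq_bigr => x _.
  rewrite /kernel_apply sum_vertex /= mulr_sumr.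
  apply: eq_bigr => j _; rewrite -mulrBr; congr (_ * _).
  rewrite (bigD1 x) // [in RHS](bigD1 x) //= /noise /arc /adj /= eqxx /= [RHS]addrAC; congr (_ + _).
    by rewrite /block_hit; ring.
  apply: eq_bigr => y hy; rewrite eq_sym in hy; by rewrite hy.
have Bb i j : `|Bl i j| <= (b + 1) * (l2 g * l2 f).
  apply: le_trans (ler_normB _ _) _; rewrite mulrDl mul1r; apply: lerD.
    apply: le_trans (hb i j _ _) _; rewrite ler_wpM2l // ler_pM ?l2_ge0 ?l2_block //.
  apply: le_trans (cauchy_schwarz _ _) _; rewrite ler_pM ?l2_ge0 ?l2_block //.
  apply: le_trans (l2_block f j); apply: l2_le; rewrite ?l2_ge0 // l2_sq.
  apply: ler_sum => x _; case: block_hit; rewrite ?mul1r // mul0r expr0n /= sqr_ge0 //.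
apply: le_trans (ler_norm_sum _ _ _) _.
apply: (@le_trans _ _ (\sum_(i < m) \sum_(j < m) (b + 1) * (l2 g * l2 f))).
  apply: ler_sum => i _; apply: le_trans (ler_norm_sum _ _ _) _.
  by apply: ler_sum => j _.
by rewrite !sumr_const card_ord -mulrnA -[leLHS]mulr_natl mulrA.
Qed.

Lemma enoise_l2 w (b dl : R) f : 0 <= b -> 0 < dl -> opbound (noise w) b ->
  (forall u, dl <= (degr w u)%:R) -> l2 (enoise w f) <= b / dl * l2 f.
Proof.
move=> b0 dl0 hb hd.
apply: (@le_trans _ _ (dl^-1 * l2 (kernel_apply (noise w) f))); last first.
  by rewrite mulrAC [leRHS]mulrC ler_wpM2l ?invr_ge0 ?(ltW dl0) // opbound_apply.
apply: l2_le; first by rewrite mulr_ge0 ?invr_ge0 ?(ltW dl0) ?l2_ge0.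
rewrite exprMn l2_sq mulr_sumr; apply: ler_sum => u _.
rewrite exprMn ler_wpM2r ?sqr_ge0 // lerXn2r ?nnegrE ?invr_ge0 ?(ltW dl0) //.
by rewrite lef_pV2 ?posrE // (lt_le_trans dl0).
Qed.

(** Write the walk as noise plus drift and expand from the inside: f is sent by
    the noise for l steps, meets the drift for the first time, and then the
    walk, a contraction in the uniform norm, carries the result through the
    remaining steps. *)
Lemma iwalk_expand w (e : R) (c : nat -> R) t f u : 0 <= e ->
  (forall f, l2 (enoise w f) <= e * l2 f) ->
  (forall l v, (l < t)%N -> `|edrift w (iter l (enoise w) f) v| <= c l) ->
  `|iwalk w t f u| <= e ^+ t * l2 f + \sum_(l < t) c l.
Proof.
move=> e0 he; elim: t f c u => [|t IH] f c u hc.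
  by rewrite /= big_ord0 addr0 expr0 mul1r l2_abs_le.
rewrite iwalkS.
have -> : walk w f = fun v => enoise w f v + edrift w f v.
  by apply/funext => v; rewrite walk_split.
rewrite iwalkD; apply: le_trans (ler_normD _ _) _.
rewrite big_ord_recl [leRHS]addrCA [leRHS]addrC; apply: lerD; last first.
  apply: iwalk_abs; last by move=> v; apply: (hc 0%N v).
  by apply: le_trans (hc 0%N u _).
apply: le_trans (IH _ (fun l => c l.+1) _ _) _.
  by move=> l v hl; have := hc l.+1 v; rewrite iterSr; apply.
by rewrite exprSr -mulrA lerD2r ler_wpM2l ?exprn_ge0.
Qed.

Lemma iter_enoise_l2 w (e : R) l f : 0 <= e -> (forall f, l2 (enoise w f) <= e * l2 f) ->
  l2 (iter l (enoise w) f) <= e ^+ l * l2 f.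
Proof.
move=> e0 he; elim: l => [|l IH] /=; first by rewrite mul1r.
by apply: le_trans (he _) _; rewrite exprS -mulrA ler_wpM2l.
Qed.

(** Cauchy-Schwarz for the community sums. *)
Lemma edrift_abs w (dl : R) f u : 0 < dl -> 0 <= p -> (forall i j, 0 <= kd i j <= 1) ->
  (forall u, dl <= (degr w u)%:R) ->
  `|edrift w f u| <= p / dl * Num.sqrt (m * n)%:R * l2 f.
Proof.
move=> dl0 p0 hk hd.
rewrite /edrift normrM ger0_norm ?invr_ge0 // mulrC -!mulrA [X in _ <= X]mulrCA.
rewrite /drift normrM (ger0_norm p0) mulrC; apply: ler_pM; rewrite ?mulr_ge0 ?invr_ge0 //.
  by rewrite lef_pV2 ?posrE // (lt_le_trans dl0).
rewrite ler_wpM2l //.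
apply: (@le_trans _ _ (\sum_v `|f v|)).
  rewrite sum_vertex /=.
  apply: le_trans (ler_norm_sum _ _ _) _; apply: ler_sum => j _.
  have /andP[h1 h2] := hk u.1 j.
  rewrite normrM (ger0_norm h1); apply: le_trans (ler_piMl _ h2) _ => //.
  exact: ler_norm_sum.
by have := l1_le_l2 f; rewrite card_prod !card_ord.
Qed.

End Walk.

(** * The walk on the graph and total variation *)

Section GraphWalk.
Variables (R : realType) (m n : nat).
Implicit Types (w : config m n) (u v x : vertex m n) (f : vertex m n -> R).

Definition full_dst (i : 'I_m) (c : mark m) : 'I_m := if c.1.2 then c.2 else i.
(** This rule undoes all rewirings. *)
Definition base_dst (i : 'I_m) (c : mark m) : 'I_m := i.

Lemma graph_ofE w u v : ((u, v) \in graph_of w) = arc full_dst w u v.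
Proof.
case: u => i x; case: v => j y; rewrite inE /arc /adj /slot_of /full_dst /=.
case: (w (i, x, y)) => -[e r] k /=; rewrite -andbA; congr [&& _, _ & _].
by rewrite eq_sym.
Qed.

Lemma outdeg_graph_of w u : outdeg (graph_of w) u = degr w u.
Proof.
apply/eqP; rewrite -(eqr_nat R) (degr_arc R full_dst) /outdeg -sum1_card natr_sum big_mkcond /=.
by apply/eqP; apply: eq_bigr => v _; rewrite inE graph_ofE; case: arc.
Qed.

Lemma transition_walk w u f : (0 < degr w u)%N ->
  \sum_v transition R (graph_of w) u v * f v = walk full_dst w f u.
Proof.
move=> d0; rewrite walk_kernel_apply /kernel_apply mulr_sumr; apply: eq_bigr => v _.
by rewrite /transition outdeg_graph_of gtn_eqF // graph_ofE mulrAC mulrC.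
Qed.

Lemma srw_law_walk w (mu : {ffun vertex m n -> R}) t f : (forall u, 0 < degr w u)%N ->
  \sum_v srw_law (graph_of w) mu t v * f v = \sum_u mu u * iwalk full_dst w t f u.
Proof.
move=> d0; elim: t f => [|t IH] f //=.
under eq_bigr do rewrite /srw_step ffunE mulr_suml.
rewrite exchange_big /=.
under eq_bigr do under eq_bigr do rewrite -mulrA.
under eq_bigr do rewrite -mulr_sumr transition_walk //.
rewrite IH; apply: eq_bigr => u _; by rewrite -iwalkS.
Qed.

Lemma point_mass_walk w x t f : (forall u, 0 < degr w u)%N ->
  \sum_v srw_law (graph_of w) (point_mass R x) t v * f v = iwalk full_dst w t f x.
Proof.
move=> d0; rewrite srw_law_walk // (bigD1 x) //= ffunE eqxx mul1r big1 ?addr0 // => u /negbTE h.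
by rewrite ffunE h mul0r.
Qed.

Lemma tv_dist_le (mu nu : {ffun vertex m n -> R}) c :
  (forall f, (forall v, `|f v| <= 1) -> \sum_v (mu v - nu v) * f v <= 2 * c) -> tv_dist mu nu <= c.
Proof.
move=> h; have := h (fun v => Num.sg (mu v - nu v)) _.
rewrite /tv_dist; under eq_bigr do rewrite mulrC -normrEsg.
move=> h'; rewrite ler_pdivrMl //; apply: h' => v.
by rewrite normr_sg; case: (_ != 0).
Qed.

Lemma tv_dist_ge (mu nu : {ffun vertex m n -> R}) f :
  (forall v, `|f v| <= 1) -> \sum_v (mu v - nu v) * f v <= 2 * tv_dist mu nu.
Proof.
move=> hf; rewrite /tv_dist mulrA divff ?mul1r //; apply: ler_sum => v _.
apply: le_trans (ler_norm _) _; rewrite normrM ler_piMr //.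
Qed.

Lemma tv_distC (mu nu : {ffun vertex m n -> R}) : tv_dist mu nu = tv_dist nu mu.
Proof. by rewrite /tv_dist; under eq_bigr do rewrite distrC. Qed.

Lemma tv_dist_triangle (mu nu ka : {ffun vertex m n -> R}) :
  tv_dist mu nu <= tv_dist mu ka + tv_dist ka nu.
Proof.
rewrite /tv_dist -mulrDr ler_wpM2l ?invr_ge0 // -big_split; apply: ler_sum => v _.
exact: ler_distD.
Qed.

Lemma tv_dist_diff (mu nu ka : {ffun vertex m n -> R}) :
  `|tv_dist mu nu - tv_dist mu ka| <= tv_dist nu ka.
Proof.
have := tv_dist_triangle mu nu ka; have := tv_dist_triangle mu ka nu.
rewrite [tv_dist ka nu]tv_distC ler_norml; lra.
Qed.

(** The vertex inside a community is uniform, and the community is the one of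
    the starting point with weight a and uniform otherwise. *)
Definition community_law (a : R) (x : vertex m n) : {ffun vertex m n -> R} :=
  [ffun v => n%:R^-1 * (m%:R^-1 + a * ((x.1 == v.1)%:R - m%:R^-1))].

Lemma community_law_tv a x : 0 <= a -> (0 < m)%N ->
  tv_dist (community_law a x) (uniform_law R m n) = (m%:R - 1) / m%:R * a.
Proof.
move=> a0 m0; case: x => i z.
have n0' : n%:R != 0 :> R by rewrite pnatr_eq0 -lt0n (leq_ltn_trans _ (ltn_ord z)).
have m0' : m%:R != 0 :> R by rewrite pnatr_eq0 -lt0n.
have m1 : m%:R^-1 <= 1 :> R by rewrite invf_le1 ?ltr0n // ler1n.
rewrite /tv_dist sum_vertex.
have h j : \sum_y `|community_law a (i, z) (j, y) - uniform_law R m n (j, y)| =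
   a * `|(i == j)%:R - m%:R^-1|.
  rewrite -[a in RHS]ger0_norm // -normrM.
  under eq_bigr => y _.
    rewrite !ffunE /= card_prod !card_ord natrM invfM.
    have -> : n%:R^-1 * (m%:R^-1 + a * ((i == j)%:R - m%:R^-1)) - m%:R^-1 * n%:R^-1 =
      n%:R^-1 * (a * ((i == j)%:R - m%:R^-1)) by ring.
    rewrite normrM [ `|n%:R^-1| ]ger0_norm ?invr_ge0 //.
    over.
  by rewrite sumr_const card_ord -[LHS]mulr_natl mulrA divff // mul1r.
under eq_bigr do rewrite h.
rewrite (bigD1 i) //= eqxx.
have -> : \sum_(j < m | j != i) a * `|(i == j)%:R - m%:R^-1| = (m%:R - 1) * (a * m%:R^-1).
  rewrite (eq_bigr (fun=> a * m%:R^-1)) => [|j]; last first.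
    by rewrite eq_sym => /negbTE ->; rewrite sub0r normrN ger0_norm ?invr_ge0.
  rewrite sumr_const cardC1 card_ord -[LHS]mulr_natl -subn1 natrB //.
rewrite (_ : true%:R = 1 :> R) // ger0_norm ?subr_ge0 //; field; exact: m0'.
Qed.

Lemma uniform_sum1 : (0 < m)%N -> (0 < n)%N -> \sum_v uniform_law R m n v = 1.
Proof.
move=> m0 n0; under eq_bigr do rewrite ffunE.
rewrite sumr_const -[LHS]mulr_natl divff // pnatr_eq0 -lt0n.
by rewrite card_prod !card_ord muln_gt0 m0.
Qed.

(** A stationary law is a mixture of the laws at any time T. If there is no
    unique one, the law considered is uniform by definition. *)
Lemma stat_law_close w T c : (forall u, 0 < degr w u)%N -> 0 <= c ->
  (forall x, tv_dist (srw_law (graph_of w) (point_mass R x) T) (uniform_law R m n) <= c) ->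
  tv_dist (stat_law R (graph_of w)) (uniform_law R m n) <= c.
Proof.
move=> d0 c0 hT; rewrite /stat_law; case: xgetP => [mu _ [[mu0 mu1 muP] _]|_]; last first.
  by rewrite /tv_dist big1 ?mulr0 // => v _; rewrite subrr normr0.
have muT : srw_law (graph_of w) mu T = mu.
  by rewrite /srw_law; elim: (T) => //= t ->.
apply: tv_dist_le => f hf.
have -> : \sum_v (mu v - uniform_law R m n v) * f v =
  \sum_x mu x * \sum_v (srw_law (graph_of w) (point_mass R x) T v - uniform_law R m n v) * f v.
  under eq_bigr do rewrite mulrBl.
  rewrite sumrB -{1}muT srw_law_walk //.
  under [RHS]eq_bigr do under eq_bigr do rewrite mulrBl.
  under [RHS]eq_bigr do rewrite sumrB point_mass_walk // mulrBr.
  by rewrite sumrB -mulr_suml mu1 mul1r.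
apply: (@le_trans _ _ (\sum_x mu x * (2 * c))).
  apply: ler_sum => x _; rewrite ler_wpM2l //.
  by apply: le_trans (tv_dist_ge _ _ hf) _; rewrite ler_pM2l.
by rewrite -mulr_suml mu1 mul1r.
Qed.

Lemma eq_walk_nbrs w u (f g : vertex m n -> R) : (forall y, adj w u y -> f (full_dst u.1 (w (slot_of u y)), y) = g (full_dst u.1 (w (slot_of u y)), y)) ->
  walk full_dst w f u = walk full_dst w g u :> R.
Proof.
move=> h; congr (_ * _); apply: eq_bigr => y _.
by case: (boolP (adj w u y)) => [/h ->|]; rewrite ?mul0r.
Qed.

Lemma reach_small w (De : nat) t x : (forall u, 0 < degr w u)%N -> (forall u, degr w u <= De)%N ->
  exists A : {set vertex m n}, (#|A| <= De ^ t)%N /\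
    iwalk full_dst w t (fun v => (v \in A)%:R) x = 1 :> R.
Proof.
move=> d0 hD; elim: t x => [|t IH] x.
  by exists [set x]%SET; rewrite cards1 /= inE eqxx.
pose A v := projT1 (cid (IH v)).
have hA v : (#|A v| <= De ^ t)%N /\ iwalk full_dst w t (fun z => (z \in A v)%:R) v = 1 :> R.
  by rewrite /A; case: cid.
pose nb y := (full_dst x.1 (w (slot_of x y)), y).
exists (\bigcup_(y | adj w x y) A (nb y))%SET; split.
  apply: (@leq_trans (\sum_(y | adj w x y) De ^ t)%N); last first.
    rewrite sum_nat_const expnS leq_mul2r; apply/orP; right; apply: leq_trans (hD x).
    rewrite -sum1_card big_mkcond /=; apply: leq_sum => y _.
    by rewrite -[y \in _]/(adj w x y); case: (adj w x y).
  elim/big_rec2: _ => [|y k B _ hB]; first by rewrite cards0.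
  rewrite (leq_trans (leq_card_setU _ _)) // leq_add // (proj1 (hA _)) //.
rewrite /= (@eq_walk_nbrs _ _ _ (fun=> 1)) ?walk_const // => y hy.
apply/eqP; rewrite eq_le; apply/andP; split.
  rewrite -[leRHS](iwalk_const full_dst t 1 (nb y) d0); apply: iwalk_le => v.
  by case: (_ \in _).
rewrite -[leLHS](proj2 (hA (nb y))); apply: iwalk_le => v.
rewrite ler_nat; case: (boolP (v \in A (nb y))) => // hv.
by rewrite lt0b; apply/bigcupP; exists y.
Qed.

Lemma tv_lower w (De : nat) t x : (0 < m)%N -> (0 < n)%N ->
  (forall u, 0 < degr w u)%N -> (forall u, degr w u <= De)%N ->
  1 - (De ^ t)%:R / (m * n)%:R <= tv_dist (srw_law (graph_of w) (point_mass R x) t) (uniform_law R m n).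
Proof.
move=> m0 n0 d0 hD; have [A [cA hA]] := reach_small t x d0 hD.
set mu := srw_law _ _ _; set U := uniform_law _ _ _.
have := @tv_dist_ge mu U (fun v => 2 * (v \in A)%:R - 1) _.
have -> : \sum_v (mu v - U v) * (2 * (v \in A)%:R - 1) =
  2 * (1 - #|A|%:R / (m * n)%:R).
  have e1 : \sum_v mu v = 1.
    under eq_bigr do rewrite -[mu _]mulr1.
    by rewrite /mu point_mass_walk // iwalk_const.
  have e2 : \sum_v U v = 1 by exact: uniform_sum1.
  have e3 : \sum_v mu v * (v \in A)%:R = 1 by rewrite /mu point_mass_walk.
  have e4 : \sum_v U v * (v \in A)%:R = #|A|%:R / (m * n)%:R.
    under eq_bigr do rewrite ffunE.
    rewrite -mulr_sumr mulrC -natr_sum -big_mkcond sum1_card card_prod !card_ord //.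
  have -> : \sum_v (mu v - U v) * (2 * (v \in A)%:R - 1) =
    2 * (\sum_v mu v * (v \in A)%:R - \sum_v U v * (v \in A)%:R) - (\sum_v mu v - \sum_v U v).
    by rewrite -!sumrB mulr_sumr -sumrB; apply: eq_bigr => v _; ring.
  by rewrite e1 e2 e3 e4 subrr subr0.
rewrite ler_pM2l // => h; apply: le_trans (h _).
  by rewrite lerD2l lerN2 ler_wpM2r ?invr_ge0 // ler_nat.
by move=> v; case: (v \in A); rewrite ?mulr1 ?mulr0; rewrite ler_norml; lra.
Qed.

End GraphWalk.

(** * Typical configurations *)

Section GoodEvent.
Variables (R : realType) (m : nat) (hm : (1 < m)%N).
Variables (lam : R) (hlam : 1 < lam) (alpha : nat -> R).
Hypothesis halpha : forall n, 0 < alpha n /\ alpha n <= 1 / 2.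

Definition cfg_prob n (A : config m n -> Prop) : R :=
  prob (config_weight (edge_prob lam n) (alpha n)) A.

(** For small n the weights of configurations need not be nonnegative, so the
    lemmas on such events pass through near_law. *)
Definition whp (A : forall n, config m n -> Prop) : Prop :=
  forall d : R, 0 < d -> \forall n \near \oo, cfg_prob (fun w => ~ A n w) <= d.

Lemma alpha_ge0 n : 0 <= alpha n. Proof. by apply: ltW; case: (halpha n). Qed.
Lemma alpha_le1 n : alpha n <= 1. Proof. by have [_] := halpha n; lra. Qed.

Lemma ln_le_sqrt (x : R) : 0 < x -> ln x <= 2 * Num.sqrt x.
Proof.
move=> x0; have s0 : 0 < Num.sqrt x by rewrite sqrtr_gt0.
rewrite -{1}[x]sqr_sqrtr ?(ltW x0) // lnXn // -[_ *+ 2]mulr_natl ler_pM2l //.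
have := @le_ln1Dx R (Num.sqrt x - 1); rewrite addrCA subrr addr0 => h.
by apply: le_trans (h _) _; lra.
Qed.

Lemma near_edge_prob : \forall n \near \oo, 0 <= edge_prob lam n /\ edge_prob lam n <= 1.
Proof.
near=> n.
have n1 : 1 <= n%:R :> R by near: n; exact: near_nat_ge.
have n2 : (2 * lam) ^+ 2 <= n%:R by near: n; exact: near_nat_ge.
have n0 : 0 < n%:R :> R := lt_le_trans ltr01 n1.
have l0 : 0 < lam := lt_trans ltr01 hlam.
rewrite /edge_prob; split; first by rewrite divr_ge0 // mulr_ge0 ?ln_ge0 // ltW.
rewrite ler_pdivrMr // mul1r.
apply: le_trans (ler_wpM2l (ltW l0) (ln_le_sqrt n0)) _.
have s0 : 0 < Num.sqrt n%:R :> R by rewrite sqrtr_gt0.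
have : 2 * lam <= Num.sqrt n%:R.
  by rewrite -(ler_pXn2r (n := 2)) ?nnegrE ?sqrtr_ge0 ?mulr_ge0 ?(ltW l0) // sqr_sqrtr ?(ltW n0).
move=> h; rewrite -[leRHS]sqr_sqrtr ?(ltW n0) // expr2 mulrA [lam * 2]mulrC.
by rewrite ler_wpM2r // ltW.
Unshelve. all: by end_near. Qed.

Lemma near_law : \forall n \near \oo, is_law (@config_weight R m n (edge_prob lam n) (alpha n)).
Proof.
near=> n.
have [h0 h1] : 0 <= edge_prob lam n /\ edge_prob lam n <= 1 by near: n; exact: near_edge_prob.
by apply: config_law; rewrite ?alpha_ge0 ?alpha_le1.
Unshelve. all: by end_near. Qed.

Lemma whp_near (A B : forall n, config m n -> Prop) :
  (\forall n \near \oo, forall w, A n w -> B n w) -> whp A -> whp B.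
Proof.
move=> hAB hA d d0; near=> n.
have hl : is_law (@config_weight R m n (edge_prob lam n) (alpha n)) by near: n; exact: near_law.
have hn : forall w, A n w -> B n w by near: n.
apply: (@le_trans _ _ (cfg_prob (fun w => ~ A n w))).
  by apply: prob_le => // w hB hA'; apply: hB; apply: hn.
by near: n; apply: hA.
Unshelve. all: by end_near. Qed.

Lemma whp_and (A B : forall n, config m n -> Prop) :
  whp A -> whp B -> whp (fun n w => A n w /\ B n w).
Proof.
move=> hA hB d d0; near=> n.
have hl : is_law (@config_weight R m n (edge_prob lam n) (alpha n)) by near: n; exact: near_law.
have h1 : cfg_prob (fun w => ~ A n w) <= d / 2 by near: n; apply: hA; rewrite divr_gt0.
have h2 : cfg_prob (fun w => ~ B n w) <= d / 2 by near: n; apply: hB; rewrite divr_gt0.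
apply: (@le_trans _ _ (cfg_prob (fun w => ~ A n w \/ ~ B n w))).
  by apply: prob_le => // w /not_andP.
apply: le_trans (prob_or _ _ hl) _; rewrite /cfg_prob in h1 h2; lra.
Unshelve. all: by end_near. Qed.

Lemma whp_forall (I : finType) (A : I -> forall n, config m n -> Prop) :
  (forall i, whp (A i)) -> whp (fun n w => forall i, A i n w).
Proof.
move=> hA.
suff h (s : seq I) : whp (fun n w => forall i, i \in s -> A i n w).
  apply: whp_near (h (enum I)); near=> n => w hw i; apply: hw; by rewrite mem_enum.
elim: s => [|j s IH].
  move=> d d0; near=> n; apply: le_trans (ltW d0).
  by rewrite /cfg_prob /prob big1 // => w _; case: asboolP => [h|]; rewrite ?mulr0 //; case: h.
apply: whp_near (whp_and (hA j) IH); near=> n => w [h1 h2] i.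
by rewrite inE => /orP[/eqP ->|/h2].
Unshelve. all: by end_near. Qed.

(** Probability that an edge leaving community i leads to community j. *)
Definition full_mean n (i j : 'I_m) : R := if i == j then 1 - alpha n else alpha n / (m%:R - 1).
Definition base_mean (i j : 'I_m) : R := (i == j)%:R.

Lemma m1_gt0 : 0 < m%:R - 1 :> R.
Proof. by rewrite subr_gt0 ltr1n. Qed.

Lemma full_mean_01 n i j : 0 <= full_mean n i j <= 1.
Proof.
have h1 := alpha_ge0 n; have h2 := alpha_le1 n; have m0 := m1_gt0.
rewrite /full_mean; case: ifP => _; first lra.
have m1 : 1 <= m%:R - 1 :> R by rewrite lerBrDr -[1 + 1]/(2%:R) ler_nat.
rewrite divr_ge0 ?(ltW m0) //= ler_pdivrMr // mul1r; lra.
Qed.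

Lemma base_mean_01 i j : 0 <= base_mean i j <= 1.
Proof. by rewrite /base_mean; case: eqP => _; rewrite ?lexx ler01. Qed.

Lemma block_hit_full n i j :
  \sum_c mark_weight (edge_prob lam n) (alpha n) i c * (block_hit (@full_dst m) i j c)%:R =
  edge_prob lam n * full_mean n i j.
Proof.
rewrite (sum_mark _ _ i) !big_bool /= /block_hit /full_dst /=.
have z (a b : R) : \sum_(k < m) a * b * target_weight R i k * 0 = 0.
  by rewrite big1 // => k _; rewrite mulr0.
rewrite !z !addr0.
set p := edge_prob lam n; set a := alpha n.
have -> : \sum_(k < m) p * (1 - a) * target_weight R i k * (i == j)%:R = p * (1 - a) * (i == j)%:R.
  by rewrite -mulr_suml -mulr_sumr sum_target // mulr1.
have -> : \sum_(k < m) p * a * target_weight R i k * (k == j)%:R = p * a * target_weight R i j.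
  by rewrite (bigD1 j) //= eqxx mulr1 big1 ?addr0 // => k /negbTE ->; rewrite mulr0.
rewrite /target_weight /full_mean eq_sym -/a.
case: eqP => _ /=; ring.
Qed.

Lemma block_hit_base n i j :
  \sum_c mark_weight (edge_prob lam n) (alpha n) i c * (block_hit (@base_dst m) i j c)%:R =
  edge_prob lam n * base_mean i j.
Proof.
rewrite (sum_mark _ _ i) !big_bool /= /block_hit /base_dst /=.
have z (a b c : R) : \sum_(k < m) a * b * target_weight R i k * c = a * b * c.
  by rewrite -mulr_suml -mulr_sumr sum_target // mulr1.
rewrite !z /base_mean; ring.
Qed.

(** The size of the noise divided by the out-degrees: L^(1/2 + eps) over L. *)
Definition rate (eps : R) (n : nat) : R := ln n%:R `^ (eps - 2^-1).

Definition typical (dl eps : R) n (w : config m n) : Prop :=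
  [/\ forall u, dl * ln n%:R <= (degr w u)%:R,
      forall u, (degr w u)%:R <= (expR 1 * lam + 2) * ln n%:R,
      forall f : vertex m n -> R,
        l2 (enoise (@full_dst m) (edge_prob lam n) (full_mean n) w f) <= rate eps n * l2 f &
      forall f : vertex m n -> R,
        l2 (enoise (@base_dst m) (edge_prob lam n) base_mean w f) <= rate eps n * l2 f].

Lemma spread_whp (dst : 'I_m -> mark m -> 'I_m) (kd : nat -> 'I_m -> 'I_m -> R) (eps : R) :
  0 < eps -> (forall n i j, 0 <= kd n i j <= 1) ->
  (forall n i j, \sum_c mark_weight (edge_prob lam n) (alpha n) i c * (block_hit dst i j c)%:R =
  edge_prob lam n * kd n i j) ->
  whp (fun n w => forall ij : 'I_m * 'I_m,
    well_spread (fun x y => block_hit dst ij.1 ij.2 (w (ij.1, x, y))) (edge_prob lam n * kd n ij.1 ij.2)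
      (ln n%:R `^ (2^-1 + eps)) ((expR 1 * lam + 2) * ln n%:R)).
Proof.
move=> eps0 hk hmean; apply: whp_forall => -[i j] /= d d0.
have l0 : 0 <= lam := ltW (lt_trans ltr01 hlam).
near=> n.
have hl : is_law (@config_weight R m n (edge_prob lam n) (alpha n)) by near: n; exact: near_law.
have [h0 h1] : 0 <= edge_prob lam n /\ edge_prob lam n <= 1 by near: n; exact: near_edge_prob.
have /andP[k0 k1] := hk n i j.
have key : forall (T : finType) (mu : T -> R) (X : T -> 'I_n -> 'I_n -> bool) (q : R),
    is_law mu -> subpoisson mu X q -> 0 <= q -> q <= lam * ln n%:R / n%:R ->
    prob mu (fun w => ~ well_spread (X w) q (ln n%:R `^ (2^-1 + eps))
       ((expR 1 * lam + 2) * ln n%:R)) <= d.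
  by near: n; apply: opnorm_whp.
apply: key => //; last 2 first.
- by rewrite mulr_ge0.
- by rewrite -/(edge_prob lam n) ler_piMr.
rewrite -hmean; apply: config_subpoisson; rewrite ?alpha_ge0 ?alpha_le1 //.
Unshelve. all: by end_near. Qed.

End GoodEvent.

Section Typical.
Variables (R : realType) (m : nat) (hm : (1 < m)%N).
Variables (lam : R) (hlam : 1 < lam) (alpha : nat -> R).
Hypothesis halpha : forall n, 0 < alpha n /\ alpha n <= 1 / 2.

(** The parameter of the lower tail of the degrees, chosen so that lam (1 -
    e^(- theta)) = (lam + 1) / 2. *)
Definition theta : R := - ln ((lam - 1) / (2 * lam)).
(** Small enough to leave n^(-1 - (lam - 1) / 4) in the lower tail bound. *)
Definition degree_const : R := (lam - 1) / 2 / (2 * theta).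

Lemma theta_gt0 : 0 < theta.
Proof.
have l0 : 0 < 2 * lam by move: hlam; lra.
rewrite oppr_gt0 ln_lt0 // divr_gt0 ?subr_gt0 //= ltr_pdivrMr // mul1r.
by move: hlam; lra.
Qed.

Lemma degree_const_gt0 : 0 < degree_const.
Proof. by have := theta_gt0; rewrite /degree_const => h; rewrite !divr_gt0 ?mulr_gt0 ?subr_gt0. Qed.

Lemma base_row_degr n (w : config m n) i x :
  \sum_y (block_hit (@base_dst m) i i (w (i, x, y)))%:R <= (degr w (i, x))%:R + 1 :> R.
Proof.
rewrite /degr natr_sum (bigD1 x) //= [in leRHS](bigD1 x) //= addrC.
apply: lerD; last by case: block_hit.
rewrite -[leLHS]add0r; apply: lerD; first by [].
apply: ler_sum => y hy; rewrite /adj /= eq_sym hy /block_hit /base_dst eqxx andbT //.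
Qed.

Lemma degr_base_row n (w : config m n) i x :
  (degr w (i, x))%:R <= \sum_y (block_hit (@base_dst m) i i (w (i, x, y)))%:R :> R.
Proof.
rewrite /degr natr_sum; apply: ler_sum => y _.
by rewrite /adj /slot_of /block_hit /base_dst eqxx andbT /=; case: (x == y); rewrite ?lexx.
Qed.

(** The lower tail at a vertex is of order n^(-1 - (lam - 1) / 4), which beats
    the number m n of vertices exactly because lam > 1. *)
Lemma degree_whp : whp lam alpha (fun n (w : config m n) => forall u, degree_const * ln n%:R <= (degr w u)%:R).
Proof.
move=> d d0.
have t0 := theta_gt0.
have c0 : 0 < (lam - 1) / 2 by rewrite divr_gt0 // subr_gt0.
near=> n.
have hl : is_law (@config_weight R m n (edge_prob lam n) (alpha n)) by near: n; exact: near_law.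
have [h0 h1] : 0 <= edge_prob lam n /\ edge_prob lam n <= 1 by near: n; exact: near_edge_prob.
have n1 : 1 <= n%:R :> R by near: n; exact: near_nat_ge.
have hL : m%:R * expR theta / d / ((lam - 1) / 4) <= ln n%:R by near: n; exact: near_ln_ge.
have n0 : 0 < n%:R :> R := lt_le_trans ltr01 n1.
set L := ln n%:R in hL *.
have key (u : vertex m n) : cfg_prob lam alpha (fun w => (degr w u)%:R <= degree_const * L) <=
   expR theta * (n%:R^-1 * expR (- ((lam - 1) / 4 * L))).
  case: u => i x.
  pose X (w : config m n) x y := block_hit (@base_dst m) i i (w (i, x, y)).
  have hX : subpoisson (@config_weight R m n (edge_prob lam n) (alpha n)) X (edge_prob lam n * base_mean R i i).
    by rewrite -(block_hit_base hm lam alpha); apply: config_subpoisson; rewrite ?(alpha_ge0 halpha) ?(alpha_le1 halpha).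
  (* The row of the array exceeds the out-degree by at most the diagonal entry. *)
  have h2 := edges_lower hl hX (fun x' _ => x' == x) (degree_const * L + 1) (ltW t0).
  apply: le_trans (le_trans _ h2) _.
    apply: prob_le => // w hw.
    rewrite -row_edges; apply: le_trans (base_row_degr _ _ _) _; by rewrite lerD2r.
  rewrite row_area /base_mean eqxx mulr1.
  have -> : expR (- theta) = (lam - 1) / (2 * lam).
    rewrite /theta opprK lnK // posrE divr_gt0 ?subr_gt0 ?mulr_gt0 //.
    by apply: lt_trans hlam.
  have -> : theta * (degree_const * L + 1) - edge_prob lam n * (n%:R * (1 - (lam - 1) / (2 * lam))) =
     theta + (- L + - ((lam - 1) / 4 * L)).
    rewrite /degree_const /edge_prob -/L; field.
    by rewrite !lt0r_neq0 //; apply: lt_trans hlam.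
  by rewrite expRD [expR (- L + _)]expRD [expR (- L)]expRN /L lnK ?posrE.
apply: (@le_trans _ _ (cfg_prob lam alpha (fun w => exists u : vertex m n, (degr w u)%:R <= degree_const * L))).
  apply: prob_le => // w; apply: contra_notP => hn u.
  by rewrite leNgt; apply/negP => hu; apply: hn; exists u; apply: ltW.
apply: le_trans (prob_exists _ hl) _.
apply: le_trans (ler_sum _ (fun u _ => key u)) _.
rewrite sumr_const -[leLHS]mulr_natl card_prod !card_ord natrM.
have -> : m%:R * n%:R * (expR theta * (n%:R^-1 * expR (- ((lam - 1) / 4 * L)))) =
  m%:R * expR theta * expR (- ((lam - 1) / 4 * L)) by field; rewrite gt_eqF.
rewrite expRN ler_pdivrMr ?expR_gt0 // [d * _]mulrC -ler_pdivrMr //.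
apply: (@le_trans _ _ ((lam - 1) / 4 * L)); last by apply: le_trans (expR_ge1Dx _); rewrite lerDr.
have c4 : 0 < (lam - 1) / 4 by rewrite divr_gt0 // subr_gt0.
by rewrite [leRHS]mulrC -ler_pdivrMr.
Unshelve. all: by end_near. Qed.

Lemma typical_whp (eps : R) : 0 < eps -> whp lam alpha (@typical R m lam alpha degree_const eps).
Proof.
move=> eps0.
have e2 : 0 < eps / 2 by rewrite divr_gt0.
have hf := spread_whp hm hlam halpha e2 (full_mean_01 hm halpha) (block_hit_full hm lam alpha).
have hb := spread_whp hm hlam halpha e2 (fun _ => @base_mean_01 R m) (block_hit_base hm lam alpha).
apply: (whp_near hm hlam halpha _ (whp_and hm hlam halpha degree_whp (whp_and hm hlam halpha hf hb))).
have [L0 hL0] := near_powR_ge (2 * (m * m)%:R / degree_const) e2.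
have dc0 := degree_const_gt0.
near=> n => w [hd [hwf hwb]].
have L1 : 1 <= ln n%:R :> R by near: n; exact: near_ln_ge.
have LL : L0 <= ln n%:R by near: n; exact: near_ln_ge.
have [h0 h1] : 0 <= edge_prob lam n /\ edge_prob lam n <= 1 by near: n; exact: near_edge_prob.
set L := ln n%:R in hd hwf hwb L1 LL *.
have Lp : 0 < L := lt_le_trans ltr01 L1.
set b := L `^ (2^-1 + eps / 2).
have b0 : 0 <= b by rewrite powR_ge0.
have b1 : 1 <= b.
  by rewrite -(powRr0 L) ler_powR // addr_ge0 // ltW.
have dL0 : 0 < degree_const * L by rewrite mulr_gt0.
have final (dst : 'I_m -> mark m -> 'I_m) (kd : 'I_m -> 'I_m -> R) (f : vertex m n -> R) :
   (forall i j, opbound (fun x y => (block_hit dst i j (w (i, x, y)))%:R - edge_prob lam n * kd i j) b) ->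
   l2 (enoise dst (edge_prob lam n) kd w f) <= rate eps n * l2 f.
  move=> hop; have hN := noise_opbound b0 hop.
  have M0 : 0 <= (m * m)%:R * (b + 1) by rewrite mulr_ge0 // addr_ge0.
  apply: le_trans (enoise_l2 _ M0 dL0 hN hd) _.
  rewrite ler_wpM2r ?l2_ge0 // ler_pdivrMr //.
  apply: (@le_trans _ _ ((m * m)%:R * (2 * b))); first by rewrite ler_wpM2l //; lra.
  rewrite /rate -/L.
  have -> : L `^ (eps - 2^-1) * (degree_const * L) = degree_const * (L `^ (eps / 2) * b).
    rewrite mulrCA; congr (_ * _); rewrite /b -{2}[L]powRr1 ?(ltW Lp) //.
    rewrite -!powRD ?(gt_eqF Lp) ?implybT //; congr (_ `^ _); by field.
  have -> : (m * m)%:R * (2 * b) = 2 * (m * m)%:R * b by ring.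
  rewrite [leRHS]mulrA ler_wpM2r // [leRHS]mulrC -ler_pdivrMr //.
  exact: hL0.
split => //.
- move=> [i x]; apply: le_trans (degr_base_row _ _ _) _.
  by have [_ h _] := hwb (i, i); exact: h.
- by move=> f; apply: final => i j; have [h _ _] := hwf (i, j); exact: h.
- by move=> f; apply: final => i j; have [h _ _] := hwb (i, j); exact: h.
Unshelve. all: by end_near. Qed.

End Typical.

(** * Rewiring marks given the edges *)

Section Marks.
Variables (R : realType) (m n : nat) (p alpha : R).
Hypotheses (hm : (1 < m)%N) (p0 : 0 <= p) (p1 : p <= 1) (a0 : 0 <= alpha) (a1 : alpha <= 1).

Let mw (i : 'I_m) (c : mark m) : R := mark_weight p alpha i c.
Let cw (w : config m n) : R := config_weight p alpha w.
Let edge_field := {ffun slot m n -> bool}.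

Definition edges_of (w : config m n) : edge_field := [ffun s => (w s).1.1].
(** It makes quantities of the unrewired graph available as functions of the
    edges alone. *)
Definition unmarked (e : edge_field) : config m n := [ffun s => (e s, false, s.1.1)].

(** Given the edges, the rewiring marks of distinct slots are independent. *)
Lemma cond_expect (F : edge_field -> R) (G : edge_field -> slot m n -> mark m -> R) :
  expect cw (fun w => F (edges_of w) * \prod_s G (edges_of w) s (w s)) =
  \sum_e F e * \prod_s \sum_(c | c.1.1 == e s) mw s.1.1 c * G e s c.
Proof.
rewrite /expect (partition_big edges_of xpredT) //=; apply: eq_bigr => e _.
rewrite (bigA_distr_big_dep (fun s (c : mark m) => c.1.1 == e s) (fun s c => mw s.1.1 c * G e s c)).
rewrite mulr_sumr; apply: eq_big => w.
  apply/eqP/familyP => [<- s|h]; first by rewrite unfold_in ffunE.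
  by apply/ffunP => s; rewrite ffunE; have := h s; rewrite unfold_in => /eqP.
by move=> /eqP ->; rewrite mulrCA; congr (_ * _); rewrite /cw /config_weight -big_split.
Qed.

Lemma sum_flag_mark i e (f : mark m -> R) :
  \sum_(c | c.1.1 == e) mw i c * f c =
  flag_weight p e * \sum_r \sum_k flag_weight alpha r * target_weight R i k * f (e, r, k).
Proof.
transitivity (\sum_c mw i c * ((c.1.1 == e)%:R * f c)).
  rewrite big_mkcond; apply: eq_bigr => c _.
  by case: eqP; rewrite ?mul1r // mul0r mulr0.
rewrite (sum_mark _ _ i).
have -> : \sum_e' \sum_r \sum_k flag_weight p e' * flag_weight alpha r * target_weight R i k *
    ((e' == e)%:R * f (e', r, k)) =
  \sum_r \sum_k flag_weight p e * flag_weight alpha r * target_weight R i k * f (e, r, k).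
  rewrite (bigD1 e) //= [X in _ + X]big1 ?addr0 => [|e' h].
    by apply: eq_bigr => r _; apply: eq_bigr => k _; rewrite eqxx mul1r.
  by rewrite big1 // => r _; rewrite big1 // => k _; rewrite (negbTE h) mul0r mulr0.
rewrite mulr_sumr; apply: eq_bigr => r _; rewrite mulr_sumr; apply: eq_bigr => k _.
by rewrite !mulrA.
Qed.

Lemma sum_flag_mark1 i e : \sum_(c | c.1.1 == e) mw i c = flag_weight p e.
Proof.
under eq_bigr do rewrite -[mw _ _]mulr1.
rewrite (sum_flag_mark i e (fun=> 1)) big_bool /=.
under eq_bigr do rewrite mulr1; under [X in _ * (_ + X)]eq_bigr do rewrite mulr1.
by rewrite -!mulr_sumr sum_target // /flag_weight; ring.
Qed.

Lemma sum_edge_weight : \sum_(e : edge_field) \prod_s flag_weight p (e s) = 1.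
Proof.
have := cond_expect (fun=> 1) (fun _ _ _ => 1).
under [X in _ = X]eq_bigr => e _.
  rewrite mul1r; under eq_bigr => s _ do under eq_bigr do rewrite mulr1.
  under eq_bigr do rewrite sum_flag_mark1.
  over.
move=> <-; transitivity (\sum_w cw w); last exact: sum_config_weight.
apply: eq_bigr => w _; by rewrite mul1r prodr_const expr1n mulr1.
Qed.

(** Centring and variance are required for each value of the edge field, so
    that the bounds below hold conditionally on the edges. *)
Definition is_score (Y : 'I_m -> mark m -> R) : Prop := forall i,
  [/\ forall c, `|Y i c| <= 1,
      forall e, \sum_(c | c.1.1 == e) mw i c * Y i c = 0 &
      forall e, \sum_(c | c.1.1 == e) mw i c * Y i c ^+ 2 <= flag_weight p e * alpha].

Variable Y : 'I_m -> mark m -> R.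
Hypothesis hY : is_score Y.
Variables (good : edge_field -> bool) (Q : edge_field -> slot m n -> R).

Definition mark_sum (w : config m n) : R :=
  \sum_s Q (edges_of w) s * Y s.1.1 (w s).

Lemma fw0 e : 0 <= flag_weight p e. Proof. exact: flag_weight_ge0. Qed.

Lemma score_mgf i e x La : `|x| <= La ->
  \sum_(c | c.1.1 == e) mw i c * expR (x * Y i c) <= flag_weight p e * expR (alpha * expR La * x ^+ 2).
Proof.
move=> hx; have [Y1 Y2 Y3] := hY i.
apply: (@le_trans _ _ (\sum_(c | c.1.1 == e) (mw i c + x * (mw i c * Y i c) + x ^+ 2 * expR La * (mw i c * Y i c ^+ 2)))).
  apply: ler_sum => c _.
  have -> : mw i c + x * (mw i c * Y i c) + x ^+ 2 * expR La * (mw i c * Y i c ^+ 2) =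
     mw i c * (1 + x * Y i c + (x * Y i c) ^+ 2 * expR La) by ring.
  rewrite ler_wpM2l ?(mark_weight_ge0 hm) //.
  have hxY : `|x * Y i c| <= La.
    by rewrite normrM (le_trans _ hx) // ler_piMr.
  by have := expR_quadB hxY; lra.
rewrite !big_split /= -!mulr_sumr Y2 mulr0 addr0 sum_flag_mark1.
apply: (@le_trans _ _ (flag_weight p e * (1 + alpha * expR La * x ^+ 2))); last first.
  by rewrite ler_wpM2l ?fw0 // expR_ge1Dx.
rewrite mulrDr mulr1 lerD2l.
apply: le_trans (ler_wpM2l _ (Y3 e)) _; first by rewrite mulr_ge0 ?sqr_ge0 ?expR_ge0.
rewrite le_eqVlt; apply/orP; left; apply/eqP; ring.
Qed.

(** The coefficients and the event good depend on the edges alone, so they are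
    constants in the conditional expectation. The second term of the exponent
    is the sum of the conditional variances, estimated by the product of the
    largest coefficient and the sum of all. *)
Lemma cond_chernoff (La Qm a : R) : 0 <= La -> 0 < Qm ->
  (forall e, good e -> forall s, `|Q e s| <= Qm) ->
  (forall e, good e -> \sum_s `|Q e s| <= 1) ->
  prob cw (fun w => good (edges_of w) /\ a <= mark_sum w) <=
  expR (- (La * a / Qm) + alpha * expR La * (La ^+ 2 / Qm)).
Proof.
move=> La0 Qm0 hQ1 hQ2.
have hl : is_law cw by apply: config_law.
apply: (@le_trans _ _ (expR (- (La * a / Qm)) * expect cw (fun w => (good (edges_of w))%:R *
   \prod_s expR (La / Qm * Q (edges_of w) s * Y s.1.1 (w s))))).
  have -> : expR (- (La * a / Qm)) * expect cw (fun w => (good (edges_of w))%:R *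
     \prod_s expR (La / Qm * Q (edges_of w) s * Y s.1.1 (w s))) =
    expect cw (fun w => (good (edges_of w))%:R * expR (La / Qm * (mark_sum w - a))).
    rewrite /expect mulr_sumr; apply: eq_bigr => w _.
    rewrite mulrCA; congr (_ * _); rewrite mulrCA; congr (_ * _).
    rewrite -expR_sum -expRD; congr expR; rewrite mulrBr mulr_sumr addrC; congr (_ - _); last by ring.
    by apply: eq_bigr => s _; rewrite mulrA.
  apply: prob_le_expect => // w.
  move=> [-> h]; rewrite mul1r -expR0 ler_expR mulr_ge0 ?subr_ge0 //.
  by rewrite divr_ge0 // ltW.
rewrite expRD ler_wpM2l ?expR_ge0 //.
rewrite (cond_expect (fun e => (good e)%:R) (fun e s c => expR (La / Qm * Q e s * Y s.1.1 c))).
set B := expR (alpha * _ * _).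
apply: (@le_trans _ _ (\sum_(e : edge_field) B * \prod_s flag_weight p (e s))); last first.
  by rewrite -mulr_sumr sum_edge_weight mulr1.
apply: ler_sum => e _; case: (boolP (good e)) => he; last first.
  by rewrite mul0r mulr_ge0 ?expR_ge0 // prodr_ge0 // => s _; apply: fw0.
rewrite mul1r.
apply: (@le_trans _ _ (\prod_s (flag_weight p (e s) * expR (alpha * expR La * (La / Qm * Q e s) ^+ 2)))).
  apply: ler_prod => s _; apply/andP; split.
    by apply: sumr_ge0 => c _; rewrite mulr_ge0 ?expR_ge0 ?(mark_weight_ge0 hm).
  apply: score_mgf; rewrite normrM ger0_norm ?divr_ge0 ?(ltW Qm0) //.
  by rewrite mulrAC ler_pdivrMr // ler_wpM2l // hQ1.
rewrite big_split /= mulrC ler_wpM2r ?prodr_ge0 // => [s _|]; first exact: fw0.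
rewrite -expR_sum ler_expR -mulr_sumr ler_wpM2l ?mulr_ge0 ?expR_ge0 //.
apply: (@le_trans _ _ (\sum_s La ^+ 2 / Qm * `|Q e s|)).
  apply: ler_sum => s _; rewrite exprMn.
  have -> : (La / Qm) ^+ 2 * Q e s ^+ 2 = La ^+ 2 / Qm * ((`|Q e s| * `|Q e s|) / Qm).
    by rewrite -expr2 real_normK ?num_real //; field; exact: lt0r_neq0.
  rewrite ler_wpM2l ?divr_ge0 ?sqr_ge0 ?(ltW Qm0) //.
  by rewrite ler_pdivrMr // ler_wpM2l // hQ1.
by rewrite -mulr_sumr ler_piMr ?hQ2 // divr_ge0 ?sqr_ge0 ?(ltW Qm0).
Qed.

(** Off the diagonal the conditional expectation vanishes. *)
Lemma score_pair s t : expect cw (fun w => (good (edges_of w))%:R *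
     (Q (edges_of w) s * Q (edges_of w) t * (Y s.1.1 (w s) * Y t.1.1 (w t)))) <=
  (s == t)%:R * (alpha * \sum_(e : edge_field) (good e)%:R * Q e s ^+ 2 * \prod_u flag_weight p (e u)).
Proof.
pose G (e : edge_field) (u : slot m n) (c : mark m) : R :=
  (if u == s then Y s.1.1 c else 1) * (if u == t then Y t.1.1 c else 1).
have -> : expect cw (fun w => (good (edges_of w))%:R *
     (Q (edges_of w) s * Q (edges_of w) t * (Y s.1.1 (w s) * Y t.1.1 (w t)))) =
  expect cw (fun w => ((good (edges_of w))%:R * Q (edges_of w) s * Q (edges_of w) t) * \prod_u G (edges_of w) u (w u)).
  apply: eq_bigr => w _; congr (_ * _); rewrite !mulrA; rewrite -!mulrA; congr (_ * (_ * (_ * _))).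
  rewrite big_split /= (bigD1 s) //= eqxx big1 ?mulr1 => [|u /negbTE -> //].
  by rewrite (bigD1 t) //= eqxx big1 ?mulr1 => [|u /negbTE -> //].
rewrite (cond_expect (fun e => (good e)%:R * Q e s * Q e t) G).
case: (eqVneq s t) => [st|st]; last first.
  rewrite mul0r big1 // => e _; rewrite (bigD1 s) //= [X in _ * (X * _)](_ : _ = 0) ?mul0r ?mulr0 //.
  have [_ Y2 _] := hY s.1.1.
  rewrite -[RHS](Y2 (e s)); apply: eq_bigr => c _.
  by rewrite /G eqxx (negbTE st) mulr1.
subst t; rewrite mul1r mulr_sumr; apply: ler_sum => e _.
have -> : (good e)%:R * Q e s * Q e s = (good e)%:R * Q e s ^+ 2 by rewrite expr2 mulrA.
have F0 : 0 <= (good e)%:R * Q e s ^+ 2 by apply: mulr_ge0; rewrite ?sqr_ge0.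
rewrite [leRHS]mulrCA ler_wpM2l //.
rewrite (bigD1 s) //= [in leRHS](bigD1 s) //= mulrA.
have [_ _ Y3] := hY s.1.1.
apply: ler_pM.
- apply: sumr_ge0 => c _; rewrite mulr_ge0 ?(mark_weight_ge0 hm) // /G eqxx -expr2 sqr_ge0 //.
- by apply: prodr_ge0 => u _; apply: sumr_ge0 => c _; rewrite mulr_ge0 ?(mark_weight_ge0 hm) // /G;
    case: eqP => _; rewrite ?mulr1 // -expr2 sqr_ge0.
- rewrite mulrC; apply: le_trans (Y3 (e s)); apply: ler_sum => c _.
  by rewrite /G eqxx expr2.
apply: ler_prod => u /negbTE us; apply/andP; split.
  by apply: sumr_ge0 => c _; rewrite mulr_ge0 ?(mark_weight_ge0 hm) // /G us mulr1.
rewrite -(sum_flag_mark1 u.1.1 (e u)); apply: ler_sum => c _.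
by rewrite /G us !mulr1.
Qed.

Lemma cond_second_moment (V : R) : 0 <= V ->
  (forall e, good e -> \sum_s Q e s ^+ 2 <= V) ->
  expect cw (fun w => (good (edges_of w))%:R * mark_sum w ^+ 2) <= alpha * V.
Proof.
move=> V0 hV.
have -> : expect cw (fun w => (good (edges_of w))%:R * mark_sum w ^+ 2) =
  \sum_s \sum_t expect cw (fun w => (good (edges_of w))%:R *
     (Q (edges_of w) s * Q (edges_of w) t * (Y s.1.1 (w s) * Y t.1.1 (w t)))).
  rewrite /expect; under [RHS]eq_bigr do rewrite exchange_big /=.
  rewrite [RHS]exchange_big /=; apply: eq_bigr => w _.
  under [RHS]eq_bigr do rewrite -mulr_sumr -mulr_sumr.
  rewrite -!mulr_sumr; congr (_ * (_ * _)); rewrite /mark_sum expr2 mulr_suml.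
  apply: eq_bigr => s _; rewrite mulr_sumr; apply: eq_bigr => t _; ring.
apply: (@le_trans _ _ (\sum_s (alpha * \sum_(e : edge_field) (good e)%:R * Q e s ^+ 2 * \prod_u flag_weight p (e u)))).
  apply: ler_sum => s _; apply: le_trans (ler_sum _ (fun t _ => score_pair s t)) _.
  by rewrite (bigD1 s) //= eqxx mul1r [X in _ + X]big1 ?addr0 // => t; rewrite eq_sym => /negbTE ->; rewrite mul0r.
rewrite -mulr_sumr ler_wpM2l // exchange_big /=.
apply: (@le_trans _ _ (\sum_(e : edge_field) V * \prod_u flag_weight p (e u))); last first.
  by rewrite -mulr_sumr sum_edge_weight mulr1.
apply: ler_sum => e _; rewrite -mulr_suml ler_wpM2r ?prodr_ge0 // => [u _|]; first exact: fw0.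
rewrite -mulr_sumr; case: (boolP (good e)) => he; last by rewrite mul0r.
by rewrite mul1r hV.
Qed.

Lemma cond_chebyshev (V a : R) : 0 <= V -> 0 < a ->
  (forall e, good e -> \sum_s Q e s ^+ 2 <= V) ->
  prob cw (fun w => good (edges_of w) /\ a <= `|mark_sum w|) <= alpha * V / a ^+ 2.
Proof.
move=> V0 a_0 hV; have hl : is_law cw by apply: config_law.
rewrite ler_pdivlMr ?exprn_gt0 //; apply: le_trans (cond_second_moment V0 hV).
rewrite -ler_pdivlMr ?exprn_gt0 //.
have -> : expect cw (fun w => (good (edges_of w))%:R * mark_sum w ^+ 2) / a ^+ 2 =
  expect cw (fun w => (good (edges_of w))%:R * (mark_sum w ^+ 2 / a ^+ 2)).
  by rewrite /expect mulr_suml; apply: eq_bigr => w _; rewrite !mulrA.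
apply: prob_le_expect => // w; first by rewrite mulr_ge0 // divr_ge0 ?sqr_ge0.
move=> [-> h]; rewrite mul1r ler_pdivlMr ?exprn_gt0 // mul1r.
rewrite -[mark_sum w ^+ 2]real_normK ?num_real // lerXn2r ?nnegrE // ltW //.
Qed.

End Marks.

(** * Motion between the communities for a fixed configuration *)

Section Recursions.
Variable R : realType.

(** Here c T is the sum of rho^(T-1-k) x k. Comparing it with the partial sum
    of the x k, as in a summation by parts, no smallness of the single terms is
    needed. *)
Lemma damped_sum (rho Y : R) (x c : nat -> R) (T : nat) : 0 <= rho -> rho <= 1 -> 0 <= Y ->
  c 0%N = 0 -> (forall k, c k.+1 = rho * c k + x k) ->
  (forall t, (t <= T)%N -> `|\sum_(k < t) x k| <= Y) -> `|c T| <= 2 * Y.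
Proof.
move=> r0 r1 Y0 c0 cS hx.
have key t : (t <= T)%N -> `|c t - \sum_(k < t) x k| <= Y.
  elim: t => [|t IH] ht; first by rewrite big_ord0 c0 subrr normr0.
  have := IH (ltnW ht); have := hx t (ltnW ht); rewrite cS big_ord_recr /=.
  set S := \sum_(k < t) x k; rewrite !ler_norml => /andP[h1 h2] /andP[h3 h4].
  have -> : rho * c t + x t - (S + x t) = rho * (c t - S) - (1 - rho) * S by ring.
  apply/andP; split; nra.
have h1 := key T (leqnn T); have h2 := hx T (leqnn T).
have -> : c T = (c T - \sum_(k < T) x k) + \sum_(k < T) x k by rewrite subrK.
apply: le_trans (ler_normD _ _) _; lra.
Qed.

(** The other way to sum the same recursion: small terms and a geometric
    series. *)
Lemma damped_sup (rho xi : R) (x c : nat -> R) (T : nat) : 0 <= rho -> rho < 1 -> 0 <= xi ->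
  c 0%N = 0 -> (forall k, c k.+1 = rho * c k + x k) ->
  (forall k, (k < T)%N -> `|x k| <= xi) -> `|c T| <= xi / (1 - rho).
Proof.
move=> r0 r1 x0 c0 cS; have d0 : 0 < 1 - rho by rewrite subr_gt0.
elim: T => [|T IH] hx; first by rewrite c0 normr0 divr_ge0 // ltW.
have h1 : `|c T| <= xi / (1 - rho) by apply: IH => k hk; apply: hx; apply: ltnW.
have h2 := hx T (ltnSn T).
rewrite cS; apply: le_trans (ler_normD _ _) _; rewrite normrM (ger0_norm r0).
have -> : xi / (1 - rho) = rho * (xi / (1 - rho)) + xi by field; rewrite gt_eqF.
by apply: lerD => //; rewrite ler_wpM2l.
Qed.
End Recursions.

Section Communities.
Variables (R : realType) (m n : nat) (hm : (1 < m)%N) (w : config m n).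
Hypothesis d0 : forall u, (0 < degr w u)%N.
Let P : (vertex m n -> R) -> vertex m n -> R := walk (@full_dst m) w.
Let P0 : (vertex m n -> R) -> vertex m n -> R := walk (@base_dst m) w.
Let Pt t : (vertex m n -> R) -> vertex m n -> R := iwalk (@full_dst m) w t.
Let P0t t : (vertex m n -> R) -> vertex m n -> R := iwalk (@base_dst m) w t.

Definition score_avg (Y : 'I_m -> mark m -> R) (u : vertex m n) : R :=
  (degr w u)%:R^-1 * \sum_y (adj w u y)%:R * Y u.1 (w (slot_of u y)).

(** The probability that the next step uses a rewired edge. *)
Definition crossing (u : vertex m n) : R := score_avg (fun _ c => c.1.2%:R) u.

Lemma score_avg_sub Y a u : score_avg (fun i c => Y i c - a i) u = score_avg Y u - a u.1.
Proof.
rewrite /score_avg; under eq_bigr do rewrite mulrBr.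
rewrite sumrB mulrBr; congr (_ - _).
rewrite -mulr_suml -natr_sum -/(degr w u) mulrA mulVf ?mul1r //.
by rewrite pnatr_eq0 -lt0n.
Qed.

Lemma crossing_ge0 u : 0 <= crossing u.
Proof. by rewrite mulr_ge0 ?invr_ge0 // sumr_ge0 // => y _; rewrite mulr_ge0. Qed.

(** The two operators differ only along rewired edges. *)
Lemma walk_base_diff phi eta u : (forall v, `|phi v| <= eta) ->
  `|P phi u - P0 phi u| <= 2 * eta * crossing u.
Proof.
move=> hphi; rewrite /P /P0 /walk -mulrBr normrM ger0_norm ?invr_ge0 // /crossing /score_avg.
rewrite mulrCA ler_wpM2l ?invr_ge0 // -sumrB mulr_sumr.
apply: le_trans (ler_norm_sum _ _ _) _; apply: ler_sum => y _.
rewrite -mulrBr normrM ger0_norm // mulrCA ler_wpM2l // /full_dst /base_dst.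
case: (w _) => -[e r] k /=; case: r; rewrite ?mulr1 ?mulr0 ?subrr ?normr0 //.
by apply: le_trans (ler_normB _ _) _; have := hphi (k, y); have := hphi (u.1, y); lra.
Qed.

Lemma poisson_telescope phi t u :
  \sum_(k < t) Pt k (fun v => phi v - P phi v) u = phi u - Pt t phi u.
Proof.
elim: t => [|t IH]; first by rewrite big_ord0 /Pt /= subrr.
rewrite big_ord_recr /= IH /Pt (iwalkD _ w t phi (fun v => - P phi v)).
have -> : iwalk (@full_dst m) w t (fun v => - P phi v) u = - iwalk (@full_dst m) w t.+1 phi u.
  rewrite iwalkS -mulN1r -iwalkZ; congr (iwalk _ _ _ _ u).
  by apply/funext => v; rewrite mulN1r.
by rewrite addrA subrK.
Qed.

(** Let phi be the sum of P_0^k g over k < Lc, so that g = phi - P_0 phi +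
    P_0^Lc g. Replace P_0 by P: the increments of phi telescope along the walk,
    and the price is twice the bound on phi for every rewired edge used. *)
Lemma poisson_bound g (Lc : nat) eta zeta t u : 0 <= eta -> 0 <= zeta ->
  (forall v, `|\sum_(k < Lc) P0t k g v| <= eta) -> (forall v, `|P0t Lc g v| <= zeta) ->
  `|\sum_(k < t) Pt k g u| <= t%:R * zeta + 2 * eta + 2 * eta * \sum_(k < t) Pt k crossing u.
Proof.
move=> e0 z0 hphi hz.
pose phi v := \sum_(k < Lc) P0t k g v.
have gE : g = fun v => P0t Lc g v + ((phi v - P phi v) + (P phi v - P0 phi v)).
  apply/funext => v.
  have -> : P0 phi v = \sum_(k < Lc) P0t k.+1 g v.
    by rewrite /P0 /phi /P0t; have := iwalk_sum (@base_dst m) w 1 (fun k : 'I_Lc => P0t k g) v.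
  have -> : phi v - P phi v + (P phi v - \sum_(k < Lc) P0t k.+1 g v) =
     phi v - \sum_(k < Lc) P0t k.+1 g v by rewrite addrA subrK.
  rewrite /phi; elim: (Lc) => [|l IH]; first by rewrite !big_ord0 subrr addr0.
  rewrite !big_ord_recr /=; move: IH => /=; lra.
have -> : \sum_(k < t) Pt k g u = \sum_(k < t) Pt k (P0t Lc g) u +
   (\sum_(k < t) Pt k (fun v => phi v - P phi v) u + \sum_(k < t) Pt k (fun v => P phi v - P0 phi v) u).
  rewrite -!big_split; apply: eq_bigr => k _ /=.
  by rewrite {1}gE /Pt iwalkD (iwalkD _ w k (fun v => phi v - P phi v)).
apply: le_trans (ler_normD _ _) _; rewrite -addrA; apply: lerD.
  apply: le_trans (ler_norm_sum _ _ _) _.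
  rewrite -[t in t%:R]card_ord mulr_natl -sumr_const; apply: ler_sum => k _.
  exact: iwalk_abs.
apply: le_trans (ler_normD _ _) _; apply: lerD.
  rewrite poisson_telescope; apply: le_trans (ler_normB _ _) _.
  have h1 := hphi u.
  have h2 : `|Pt t phi u| <= eta by apply: iwalk_abs.
  by rewrite -/(phi u) in h1; lra.
apply: le_trans (ler_norm_sum _ _ _) _; rewrite mulr_sumr; apply: ler_sum => k _.
rewrite -iwalkZ ler_norml; apply/andP; split.
  have -> : - Pt k (fun v => 2 * eta * crossing v) u = Pt k (fun v => - (2 * eta * crossing v)) u.
    rewrite /Pt -mulN1r -iwalkZ; congr (iwalk _ _ _ _ u).
    by apply/funext => v; rewrite mulN1r.
  apply: iwalk_le => v; have := @walk_base_diff phi eta v hphi; rewrite ler_norml => /andP[] //.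
by apply: iwalk_le => v; have := @walk_base_diff phi eta v hphi; rewrite ler_norml => /andP[].
Qed.

(** Centred, so that it is an approximate eigenfunction of the walk. *)
Definition ind (j : 'I_m) (v : vertex m n) : R := (v.1 == j)%:R - m%:R^-1.

Variable alpha : R.
Hypotheses (a0 : 0 <= alpha) (a1 : alpha <= 1 / 2).
(** The second eigenvalue of the mean transition matrix between communities,
    kmat. *)
Definition rho : R := 1 - alpha * (m%:R / (m%:R - 1)).
Definition kmat (i j : 'I_m) : R := if i == j then 1 - alpha else alpha / (m%:R - 1).

(** Subtracting the mean kmat centres the score; what remains is the
    fluctuation due to the rewiring mark of one edge. *)
Definition dest_score (j : 'I_m) (i : 'I_m) (c : mark m) : R := (full_dst i c == j)%:R - kmat i j.
Definition rewire_score (i : 'I_m) (c : mark m) : R := c.1.2%:R - alpha.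

Let m10 : 0 < m%:R - 1 :> R.
Proof. by rewrite subr_gt0 ltr1n. Qed.
Let m0 : m%:R != 0 :> R.
Proof. by rewrite pnatr_eq0 -lt0n ltnW. Qed.

Lemma rho_ge0 : 0 <= rho.
Proof.
have m2 : 2 <= m%:R :> R by rewrite (ler_nat R 2).
rewrite /rho subr_ge0 mulrA ler_pdivrMr // mul1r.
have : alpha * m%:R <= 1 / 2 * m%:R by rewrite ler_wpM2r.
lra.
Qed.

Lemma rho_le1 : rho <= 1.
Proof. by rewrite /rho gerBl mulr_ge0 // divr_ge0 // ltW. Qed.

Lemma kmatE i j : kmat i j = m%:R^-1 + rho * ((i == j)%:R - m%:R^-1).
Proof.
rewrite /kmat /rho; case: (i == j).
  by rewrite (_ : true%:R = 1 :> R) //; field; rewrite m0 gt_eqF.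
by rewrite (_ : false%:R = 0 :> R) //; field; rewrite m0 gt_eqF.
Qed.

(** Without the last term, ind j would be an eigenfunction with eigenvalue
    rho. *)
Lemma walk_ind j u : P (ind j) u = rho * ind j u + score_avg (dest_score j) u.
Proof.
have -> : P (ind j) u = score_avg (fun i c => (full_dst i c == j)%:R - m%:R^-1) u by [].
rewrite (score_avg_sub (fun i c => (full_dst i c == j)%:R) (fun=> m%:R^-1)).
rewrite (score_avg_sub (fun i c => (full_dst i c == j)%:R) (fun i => kmat i j)) kmatE /ind.
ring.
Qed.

Lemma crossing_score u : crossing u = score_avg rewire_score u + alpha.
Proof. by rewrite (score_avg_sub (fun i c => c.1.2%:R) (fun=> alpha)) subrK. Qed.

Lemma ind_step j t u :
  Pt t.+1 (ind j) u = rho * Pt t (ind j) u + Pt t (score_avg (dest_score j)) u.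
Proof.
rewrite /Pt iwalkS.
have -> : walk (@full_dst m) w (ind j) = fun v => rho * ind j v + score_avg (dest_score j) v.
  by apply/funext => v; rewrite -walk_ind.
by rewrite iwalkD iwalkZ.
Qed.

Lemma ind_abs j u : `|ind j u| <= 1.
Proof.
have h : 0 <= m%:R^-1 :> R by rewrite invr_ge0.
have h' : m%:R^-1 <= 1 :> R by rewrite invf_le1 ?ltr0n ?ler1n // ltnW.
have [e|e] : (u.1 == j)%:R = 1 :> R \/ (u.1 == j)%:R = 0 :> R by case: (_ == _); [left|right].
  by rewrite /ind e ler_norml; apply/andP; split; lra.
by rewrite /ind e ler_norml; apply/andP; split; lra.
Qed.

(** The number of rewired edges used up to time t enters the estimate through
    poisson_bound. The same estimate, applied to the score of the rewirings
    themselves, bounds this number by about 2 t alpha: the bound reappears on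
    the right with the factor 2 eta <= 1/2 and is absorbed. *)
Lemma ind_dev_slow (Lc : nat) eta zeta (T : nat) u :
  0 <= eta -> eta <= 1 / 4 -> 0 <= zeta ->
  (forall v, `|\sum_(k < Lc) P0t k (score_avg rewire_score) v| <= eta) ->
  (forall v, `|P0t Lc (score_avg rewire_score) v| <= zeta) ->
  (forall j v, `|\sum_(k < Lc) P0t k (score_avg (dest_score j)) v| <= eta) ->
  (forall j v, `|P0t Lc (score_avg (dest_score j)) v| <= zeta) ->
  forall j, `|Pt T (ind j) u - rho ^+ T * ind j u| <=
    2 * (T%:R * zeta + 2 * eta + 4 * eta * (T%:R * alpha + T%:R * zeta + 2 * eta)).
Proof.
move=> e0 e4 z0 hr1 hr2 hj1 hj2 j.
have cr t : 0 <= \sum_(k < t) Pt k crossing u.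
  by apply: sumr_ge0 => k _; rewrite -(iwalk_const (@full_dst m) k 0 u d0); apply: iwalk_le => v; apply: crossing_ge0.
have hc t : \sum_(k < t) Pt k crossing u <= 2 * (t%:R * alpha + t%:R * zeta + 2 * eta).
  have := poisson_bound t u e0 z0 hr1 hr2.
  have <- : \sum_(k < t) Pt k crossing u - t%:R * alpha = \sum_(k < t) Pt k (score_avg rewire_score) u.
    rewrite -[t in t%:R]card_ord mulr_natl -sumr_const -sumrB; apply: eq_bigr => k _.
    have -> : crossing = fun v => score_avg rewire_score v + alpha by apply/funext => v; exact: crossing_score.
    by rewrite /Pt iwalkD (iwalk_const _ _ _ _ d0) addrK.
  have h1 : 2 * eta * (\sum_(k < t) Pt k crossing u) <= 1 / 2 * \sum_(k < t) Pt k crossing u.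
    rewrite ler_wpM2r //; move: e4; lra.
  rewrite ler_norml => /andP[_ h]; move: h h1; lra.
pose c t := Pt t (ind j) u - rho ^+ t * ind j u.
apply: (@damped_sum R rho _ (fun k => Pt k (score_avg (dest_score j)) u) c T rho_ge0 rho_le1).
- have T0 : 0 <= T%:R :> R by [].
  by rewrite !addr_ge0 ?mulr_ge0 ?addr_ge0 ?mulr_ge0.
- by rewrite /c /Pt /= mul1r subrr.
- by move=> k; rewrite /c ind_step [rho ^+ k.+1]exprS; ring.
move=> t tT; apply: le_trans (poisson_bound t u e0 z0 (hj1 j) (hj2 j)) _.
have tR : t%:R <= T%:R :> R by rewrite ler_nat.
have hct := hc t.
have h1 : t%:R * zeta <= T%:R * zeta by rewrite ler_wpM2r.
have h2 : t%:R * alpha <= T%:R * alpha by rewrite ler_wpM2r.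
have h3 : 2 * eta * (\sum_(k < t) Pt k crossing u) <= 2 * eta * (2 * (T%:R * alpha + T%:R * zeta + 2 * eta)).
  by rewrite ler_wpM2l ?mulr_ge0 //; move: hct; lra.
move: h3; lra.
Qed.

(** Since 1 - rho >= alpha, terms of size xi sum to xi / alpha. *)
Lemma ind_dev_fast (T1 T : nat) xi u : 0 < alpha -> 0 <= xi ->
  (forall j k, (T1 <= k)%N -> `|Pt k (score_avg (dest_score j)) u| <= xi) ->
  forall j, `|Pt (T1 + T) (ind j) u| <= rho ^+ T + xi / alpha.
Proof.
move=> ap x0 hx j.
have rl : alpha <= 1 - rho.
  rewrite /rho opprB addrC subrK ler_peMr // ler_pdivlMr // mul1r.
  by rewrite gerBl.
have r1 : rho < 1 by have := ap; lra.
pose c t := Pt (T1 + t) (ind j) u - rho ^+ t * Pt T1 (ind j) u.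
have hc : `|c T| <= xi / (1 - rho).
  apply: (@damped_sup R rho xi (fun k => Pt (T1 + k) (score_avg (dest_score j)) u) c T rho_ge0 r1 x0).
  - by rewrite /c addn0 expr0 mul1r subrr.
  - by move=> k; rewrite /c addnS ind_step [rho ^+ k.+1]exprS; ring.
  - by move=> k _; apply: hx; rewrite leq_addr.
have -> : Pt (T1 + T) (ind j) u = rho ^+ T * Pt T1 (ind j) u + c T by rewrite /c addrC subrK.
apply: le_trans (ler_normD _ _) _; apply: lerD.
  rewrite normrM ger0_norm ?exprn_ge0 ?rho_ge0 // ler_piMr ?exprn_ge0 ?rho_ge0 //.
  by apply: iwalk_abs => // v; apply: ind_abs.
apply: le_trans hc _; rewrite ler_wpM2l // lef_pV2 ?posrE // (lt_le_trans ap rl) //.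
Qed.

(** A test function is the sum of its averages over the communities and of a
    function with zero community sums. The factor 2 in f0 keeps the latter
    bounded by 1. *)
Lemma tv_community (a e1 e2 : R) t x :
  (forall f : vertex m n -> R, (forall v, `|f v| <= 1) -> (forall j, \sum_y f (j, y) = 0) ->
     `|Pt t f x| <= e1) ->
  (forall j, `|Pt t (ind j) x - a * ind j x| <= e2) ->
  tv_dist (srw_law (graph_of w) (point_mass R x) t) (community_law a x) <= e1 + m%:R * e2.
Proof.
move=> h1 h2; apply: tv_dist_le => f hf.
have n0 : (0 < n)%N by case: x {h1 h2} => i z; rewrite (leq_ltn_trans _ (ltn_ord z)).
have n0' : n%:R != 0 :> R by rewrite pnatr_eq0 -lt0n.
pose av (j : 'I_m) : R := n%:R^-1 * \sum_y f (j, y).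
have av1 j : `|av j| <= 1.
  rewrite normrM ger0_norm ?invr_ge0 // ler_pdivrMl ?ltr0n // mulr1.
  apply: le_trans (ler_norm_sum _ _ _) _.
  by rewrite -[n in leRHS]card_ord -sumr_const; apply: ler_sum => y _; apply: hf.
pose f0 v := 2^-1 * (f v - av v.1).
have hf0 v : `|f0 v| <= 1.
  rewrite normrM ger0_norm ?invr_ge0 // ler_pdivrMl // mulr1.
  apply: le_trans (ler_normB _ _) _; have := hf v; have := av1 v.1; lra.
have hf0s j : \sum_y f0 (j, y) = 0.
  rewrite -mulr_sumr sumrB /= sumr_const card_ord -[_ *+ n]mulr_natl /av mulrA divff // mul1r.
  by rewrite subrr mulr0.
have fE : f = fun v => 2 * f0 v + \sum_j av j * (ind j v + m%:R^-1).
  apply/funext => v; rewrite /f0 mulrA divff ?mul1r //.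
  have -> : \sum_j av j * (ind j v + m%:R^-1) = av v.1.
    rewrite (bigD1 v.1) //= /ind subrK eqxx mulr1 big1 ?addr0 // => j.
    by rewrite eq_sym subrK => /negbTE ->; rewrite mulr0.
  by rewrite subrK.
have -> : \sum_v (srw_law (graph_of w) (point_mass R x) t v - community_law a x v) * f v =
   Pt t f x - \sum_j av j * (m%:R^-1 + a * ind j x).
  under eq_bigr do rewrite mulrBl.
  rewrite sumrB point_mass_walk //; congr (_ - _).
  rewrite sum_vertex; apply: eq_bigr => j _.
  under eq_bigr do rewrite ffunE /=.
  rewrite -mulr_sumr /av /ind; ring.
have -> : Pt t f x = 2 * Pt t f0 x + \sum_j av j * (Pt t (ind j) x + m%:R^-1).
  rewrite {1}fE /Pt iwalkD iwalkZ iwalk_sum; congr (_ + _); apply: eq_bigr => j _.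
  by rewrite iwalkZ iwalkD (iwalk_const _ _ _ _ d0).
have -> : 2 * Pt t f0 x + \sum_j av j * (Pt t (ind j) x + m%:R^-1) -
  \sum_j av j * (m%:R^-1 + a * ind j x) =
  2 * Pt t f0 x + \sum_j av j * (Pt t (ind j) x - a * ind j x).
  rewrite -addrA -sumrB; congr (_ + _); apply: eq_bigr => j _; ring.
have k1 : Pt t f0 x <= e1 by apply: le_trans (h1 f0 hf0 hf0s); apply: ler_norm.
have k2 : \sum_j av j * (Pt t (ind j) x - a * ind j x) <= m%:R * e2.
  rewrite -[m in leRHS]card_ord mulr_natl -sumr_const; apply: ler_sum => j _.
  apply: le_trans (ler_norm _) _; rewrite normrM; apply: le_trans (ler_piMl _ (av1 j)) _ => //.
have e20 : 0 <= m%:R * e2.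
  by rewrite mulr_ge0 //; apply: le_trans (h2 x.1).
lra.
Qed.

End Communities.

(** * Linear functionals of the scores *)

Lemma bool_natr (R : realType) (b : bool) : b%:R = 1 :> R \/ b%:R = 0 :> R.
Proof. by case: b; [left|right]. Qed.

Section Scores.
Variables (R : realType) (m n : nat) (p alpha : R).
Hypotheses (hm : (1 < m)%N) (p0 : 0 <= p) (p1 : p <= 1) (a0 : 0 <= alpha) (a1 : alpha <= 1 / 2).

(** None stands for the score of the rewirings, Some j for that of the edges
    leading to community j: all of them need the same estimates. *)
Definition score (o : option 'I_m) : 'I_m -> mark m -> R :=
  if o is Some j then dest_score alpha j else rewire_score alpha.

Lemma rewire_is_score : is_score p alpha (@rewire_score R m alpha).
Proof.
have f0 e : 0 <= flag_weight p e := flag_weight_ge0 e p0 p1.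
move=> i; split.
- move=> c; rewrite /rewire_score; case: (bool_natr R c.1.2) => ->;
    by rewrite ler_norml; apply/andP; split; move: a0 a1; lra.
- move=> e; rewrite (sum_flag_mark p alpha i e) big_bool /= /rewire_score /= -!mulr_suml -!mulr_sumr.
  by rewrite !sum_target //; rewrite (_ : (nat_of_bool true)%:R = 1 :> R) // (_ : (nat_of_bool false)%:R = 0 :> R) //; ring.
- move=> e; rewrite (sum_flag_mark p alpha i e (fun c => rewire_score alpha i c ^+ 2)) big_bool /= /rewire_score /= -!mulr_suml -!mulr_sumr.
  rewrite !sum_target // ler_wpM2l //.
  rewrite (_ : (nat_of_bool true)%:R = 1 :> R) // (_ : (nat_of_bool false)%:R = 0 :> R) //.
  have -> : alpha * 1 * (1 - alpha) ^+ 2 + (1 - alpha) * 1 * (0 - alpha) ^+ 2 = alpha - alpha ^+ 2 by ring.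
  by rewrite gerBl sqr_ge0.
Qed.

Lemma sum_target_ind (i j : 'I_m) : \sum_k target_weight R i k * (k == j)%:R = target_weight R i j.
Proof. by rewrite (bigD1 j) //= eqxx mulr1 big1 ?addr0 // => k /negbTE ->; rewrite mulr0. Qed.

Lemma dest_is_score (j : 'I_m) : is_score p alpha (dest_score alpha j).
Proof.
have f0 e : 0 <= flag_weight p e := flag_weight_ge0 e p0 p1.
have m10 : 0 < m%:R - 1 :> R by rewrite subr_gt0 ltr1n.
have m1 : 1 <= m%:R - 1 :> R by rewrite lerBrDr -[1 + 1]/(2%:R) ler_nat.
have k01 i : 0 <= kmat alpha i j <= 1.
  rewrite /kmat; case: ifP => _; first by apply/andP; split; move: a0 a1; lra.
  rewrite divr_ge0 ?(ltW m10) //= ler_pdivrMr // mul1r; move: a0 a1 m1; lra.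
move=> i; have /andP[k0 k1] := k01 i; set b := kmat alpha i j in k0 k1.
pose D (r : bool) (k : 'I_m) : R := (full_dst i (true, r, k) == j)%:R.
have dE e r k : dest_score alpha j i (e, r, k) = D r k - b by [].
have S1 : \sum_k target_weight R i k * D false k = (i == j)%:R.
  by rewrite /D /= -mulr_suml sum_target // mul1r.
have S2 : \sum_k target_weight R i k * D true k = target_weight R i j.
  exact: sum_target_ind.
have sq r k : (D r k - b) ^+ 2 = D r k * (1 - 2 * b) + b ^+ 2.
  by rewrite /D; case: (bool_natr R (full_dst i (true, r, k) == j)) => ->; ring.
have lin r : \sum_k target_weight R i k * (D r k - b) = \sum_k target_weight R i k * D r k - b.
  under eq_bigr do rewrite mulrBr.
  by rewrite sumrB -mulr_suml sum_target // mul1r.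
have lin2 r : \sum_k target_weight R i k * (D r k - b) ^+ 2 =
    (\sum_k target_weight R i k * D r k) * (1 - 2 * b) + b ^+ 2.
  under eq_bigr do rewrite sq mulrDr mulrA.
  by rewrite big_split /= -!mulr_suml sum_target // mul1r.
have fac (f : bool -> 'I_m -> R) : \sum_r \sum_k flag_weight alpha r * target_weight R i k * f r k =
   alpha * (\sum_k target_weight R i k * f true k) + (1 - alpha) * (\sum_k target_weight R i k * f false k).
  by rewrite big_bool /= !mulr_sumr; congr (_ + _); apply: eq_bigr => k _; rewrite mulrA.
have cases : (b = 1 - alpha /\ (i == j)%:R = 1 :> R /\ target_weight R i j = 0) \/
   (b = alpha * target_weight R i j /\ (i == j)%:R = 0 :> R /\ b <= alpha).
  rewrite /b /kmat /target_weight eq_sym; case: (eqVneq j i) => _ /=; [left|right] => //.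
  by split => //; split => //; rewrite ler_pdivrMr // ler_peMr.
split.
- move=> [[e r] k]; rewrite dE /D; case: (bool_natr R (full_dst i (true, r, k) == j)) => ->;
    by rewrite ler_norml; apply/andP; split; lra.
- move=> e; rewrite (sum_flag_mark p alpha i e) /=.
  under eq_bigr do under eq_bigr do rewrite dE.
  rewrite (fac (fun r k => D r k - b)) !lin S1 S2.
  by case: cases => -[e1 [e2 e3]]; rewrite e2 ?e3 e1; ring.
move=> e; rewrite (sum_flag_mark p alpha i e (fun c => dest_score alpha j i c ^+ 2)) /=.
rewrite ler_wpM2l //.
under eq_bigr do under eq_bigr do rewrite dE.
rewrite (fac (fun r k => (D r k - b) ^+ 2)) !lin2 S1 S2.
case: cases => -[e1 [e2 e3]]; rewrite e2.
  rewrite e3 e1.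
  have -> : alpha * (0 * (1 - 2 * (1 - alpha)) + (1 - alpha) ^+ 2) +
     (1 - alpha) * (1 * (1 - 2 * (1 - alpha)) + (1 - alpha) ^+ 2) = alpha - alpha ^+ 2 by ring.
  by rewrite gerBl sqr_ge0.
have -> : alpha * (target_weight R i j * (1 - 2 * b) + b ^+ 2) +
   (1 - alpha) * (0 * (1 - 2 * b) + b ^+ 2) = alpha * target_weight R i j * (1 - 2 * b) + b ^+ 2 by ring.
rewrite -e1; apply: le_trans e3.
have -> : b * (1 - 2 * b) + b ^+ 2 = b - b ^+ 2 by ring.
by rewrite gerBl sqr_ge0.
Qed.

Lemma score_is_score (o : option 'I_m) : is_score p alpha (score o).
Proof. by case: o => [j|]; [exact: dest_is_score|exact: rewire_is_score]. Qed.

End Scores.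

Section Weighted.
Variables (R : realType) (m n : nat).
Implicit Types (w : config m n) (u v : vertex m n).

Lemma adj_unmarked w u y : adj (unmarked (edges_of w)) u y = adj w u y.
Proof. by rewrite /adj /unmarked !ffunE. Qed.

Lemma degr_unmarked w u : degr (unmarked (edges_of w)) u = degr w u.
Proof. by apply: eq_bigr => y _; rewrite adj_unmarked. Qed.

Lemma arc_unmarked w u v : arc (@base_dst m) (unmarked (edges_of w)) u v = arc (@base_dst m) w u v.
Proof. by rewrite /arc adj_unmarked /base_dst. Qed.

Lemma enoise_unmarked p kd w : enoise (@base_dst m) p kd (unmarked (edges_of w)) = enoise (@base_dst m) p kd w :> ((vertex m n -> R) -> _).
Proof.
apply/funext => f; apply/funext => u; rewrite /enoise degr_unmarked; congr (_ * _).
by apply: eq_bigr => v _; rewrite /noise arc_unmarked.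
Qed.

Variable q : {ffun slot m n -> bool} -> vertex m n -> R.

(** The coefficients of the slots when the score averages are summed with the
    coefficients q of the vertices; see mark_sumE. *)
Definition slot_weight (e : {ffun slot m n -> bool}) (s : slot m n) : R :=
  q e s.1 * ((adj (unmarked e) s.1 s.2)%:R / (degr (unmarked e) s.1)%:R).

Lemma mark_sumE Y w : mark_sum Y slot_weight w = \sum_u q (edges_of w) u * score_avg w Y u.
Proof.
rewrite /mark_sum; transitivity (\sum_(u : vertex m n) \sum_y slot_weight (edges_of w) (u, y) * Y u.1 (w (u, y))).
  by rewrite pair_bigA /=; apply: eq_bigr => -[u y].
apply: eq_bigr => u _; rewrite /score_avg !mulr_sumr; apply: eq_bigr => y _.
rewrite /slot_weight /= adj_unmarked degr_unmarked.
have -> : slot_of u y = (u, y) by case: u.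
ring.
Qed.

Variables (e : {ffun slot m n -> bool}) (D : R).
Hypotheses (D0 : 0 < D) (hD : forall u, D <= (degr (unmarked e) u)%:R).

Let dpos u : 0 < (degr (unmarked e) u)%:R :> R := lt_le_trans D0 (hD u).

Lemma slot_weight_le B s : (forall u, `|q e u| <= B) -> `|slot_weight e s| <= B / D.
Proof.
move=> hB; rewrite /slot_weight normrM; apply: ler_pM => //.
rewrite ger0_norm ?divr_ge0 //.
apply: (@le_trans _ _ (1 / (degr (unmarked e) s.1)%:R)).
  by rewrite ler_wpM2r ?invr_ge0 //; case: adj.
by rewrite div1r lef_pV2 ?posrE.
Qed.

Lemma slot_weight_l1 : \sum_s `|slot_weight e s| = \sum_u `|q e u|.
Proof.
transitivity (\sum_(u : vertex m n) \sum_y `|slot_weight e (u, y)|).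
  by rewrite pair_bigA /=; apply: eq_bigr => -[u y].
apply: eq_bigr => u _; rewrite /slot_weight.
under eq_bigr do rewrite normrM [X in _ * X]ger0_norm ?divr_ge0 //=.
rewrite -mulr_sumr -mulr_suml -natr_sum -/(degr _ u) divff ?mulr1 //.
by rewrite gt_eqF.
Qed.

(** Averaging over at least D out-edges divides the variance by D. *)
Lemma slot_weight_l2 : \sum_s slot_weight e s ^+ 2 <= (\sum_u q e u ^+ 2) / D.
Proof.
have -> : \sum_s slot_weight e s ^+ 2 = \sum_(u : vertex m n) \sum_y slot_weight e (u, y) ^+ 2.
  by rewrite pair_bigA /=; apply: eq_bigr => -[u y].
rewrite mulr_suml; apply: ler_sum => u _; rewrite /slot_weight /=.
have h y : (q e u * ((adj (unmarked e) u y)%:R / (degr (unmarked e) u)%:R)) ^+ 2 =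
   q e u ^+ 2 * (degr (unmarked e) u)%:R ^- 2 * (adj (unmarked e) u y)%:R.
  by case: adj; rewrite ?mul0r ?mulr0 ?expr0n //= mulr1 div1r exprMn exprVn.
under eq_bigr do rewrite h.
rewrite -mulr_sumr -natr_sum -/(degr _ u) -mulrA ler_wpM2l ?sqr_ge0 //.
have -> : (degr (unmarked e) u)%:R ^- 2 * (degr (unmarked e) u)%:R = (degr (unmarked e) u)%:R^-1 :> R.
  by field; rewrite gt_eqF.
by rewrite lef_pV2 ?posrE.
Qed.

End Weighted.

Section Functional.
Variables (R : realType) (m n : nat) (p : R) (kd : 'I_m -> 'I_m -> R).
Implicit Types (w : config m n) (u v : vertex m n) (f g : vertex m n -> R).
Variable dst : 'I_m -> mark m -> 'I_m.

Lemma enoise_lin w (I : finType) (c : I -> R) (f : I -> vertex m n -> R) v :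
  enoise dst p kd w (fun v => \sum_i c i * f i v) v = \sum_i c i * enoise dst p kd w (f i) v.
Proof.
rewrite /enoise /kernel_apply; under eq_bigr do rewrite mulr_sumr.
rewrite exchange_big mulr_sumr; apply: eq_bigr => i _ /=.
rewrite mulrCA; congr (_ * _); rewrite mulr_sumr; apply: eq_bigr => x _; ring.
Qed.

Lemma iter_enoise_lin w l (I : finType) (c : I -> R) (f : I -> vertex m n -> R) v :
  iter l (enoise dst p kd w) (fun v => \sum_i c i * f i v) v =
  \sum_i c i * iter l (enoise dst p kd w) (f i) v.
Proof.
elim: l v => //= l IH v; rewrite -enoise_lin; congr (enoise _ _ _ _ _ v).
by apply/funext.
Qed.

(** The coefficients of the linear functional which applies l noise steps and
    then sums over community i. *)
Definition comm_functional w l (i : 'I_m) u : R :=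
  \sum_y iter l (enoise dst p kd w) (fun v => (v == u)%:R) (i, y).

Lemma comm_functionalE w l i f :
  \sum_y iter l (enoise dst p kd w) f (i, y) = \sum_u comm_functional w l i u * f u.
Proof.
have {1}-> : f = fun v => \sum_u f u * (v == u)%:R.
  apply/funext => v; rewrite (bigD1 v) //= eqxx mulr1 big1 ?addr0 // => u.
  by rewrite eq_sym => /negbTE ->; rewrite mulr0.
under eq_bigr do rewrite iter_enoise_lin.
rewrite exchange_big; apply: eq_bigr => u _ /=.
by rewrite /comm_functional mulr_suml; apply: eq_bigr => y _; rewrite mulrC.
Qed.

(** By duality, testing the functional against its own coefficients. *)
Lemma comm_functional_l2 w l i (e : R) : 0 <= e ->
  (forall f : vertex m n -> R, l2 (enoise dst p kd w f) <= e * l2 f) ->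
  \sum_u comm_functional w l i u ^+ 2 <= n%:R * e ^+ l ^+ 2.
Proof.
move=> e0 he; set q := comm_functional w l i.
have h1 : l2 q ^+ 2 <= Num.sqrt n%:R * (e ^+ l * l2 q).
  rewrite l2_sq.
  have -> : \sum_v q v ^+ 2 = \sum_y iter l (enoise dst p kd w) q (i, y).
    by rewrite comm_functionalE; apply: eq_bigr => u _; rewrite expr2.
  apply: le_trans (ler_norm _) _; apply: le_trans (ler_norm_sum _ _ _) _.
  apply: le_trans (l1_le_l2 _) _; rewrite card_ord ler_wpM2l ?sqrtr_ge0 //.
  by apply: le_trans (l2_block _ i) _; apply: iter_enoise_l2.
have h2 : l2 q <= Num.sqrt n%:R * e ^+ l.
  have [q0|q0] := eqVneq (l2 q) 0; first by rewrite q0 mulr_ge0 ?sqrtr_ge0 ?exprn_ge0.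
  have q1 : 0 < l2 q by rewrite lt_def q0 l2_ge0.
  by rewrite -(ler_pM2r q1) -expr2 -mulrA.
rewrite -l2_sq; apply: (@le_trans _ _ ((Num.sqrt n%:R * e ^+ l) ^+ 2)).
  by rewrite lerXn2r ?nnegrE ?l2_ge0 ?mulr_ge0 ?sqrtr_ge0 ?exprn_ge0.
by rewrite exprMn sqr_sqrtr.
Qed.
End Functional.

(** * Scores of a typical configuration *)

Section Events.
Variables (R : realType) (m : nat) (hm : (1 < m)%N).
Variables (lam : R) (hlam : 1 < lam) (alpha : nat -> R).
Hypothesis halpha : forall n, 0 < alpha n /\ alpha n <= 1 / 2.
Variable dl : R.
Hypotheses (dlE : dl = degree_const lam) (dl0 : 0 < dl).

(** The part of the typical event which concerns the unrewired graph, as a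
    condition on the edges alone: conditional estimates can be made on it. *)
Definition good_edges n (e : {ffun slot m n -> bool}) : bool :=
  `[< (forall u, dl * ln n%:R <= (degr (unmarked e) u)%:R) /\
      forall f : vertex m n -> R, l2 (enoise (@base_dst m) (edge_prob lam n) (@base_mean R m) (unmarked e) f)
        <= rate (1 / 4) n * l2 f >].

Lemma whp_good_edges (Bad : forall n, config m n -> Prop) :
  (forall d : R, 0 < d -> \forall n \near \oo, cfg_prob lam alpha (fun w => good_edges (edges_of w) /\ Bad n w) <= d) ->
  whp lam alpha (fun n w => ~ Bad n w).
Proof.
move=> hB d d0.
have q4 : 0 < 1 / 4 :> R by lra.
have ht : whp lam alpha (@typical R m lam alpha dl (1 / 4)).
  by rewrite dlE; apply: typical_whp.
near=> n.
have hl : is_law (@config_weight R m n (edge_prob lam n) (alpha n)) by near: n; exact: near_law.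
have h1 : cfg_prob lam alpha (fun w => ~ @typical R m lam alpha dl (1 / 4) n w) <= d / 2.
  by near: n; apply: ht; rewrite divr_gt0.
have h2 : cfg_prob lam alpha (fun w => good_edges (edges_of w) /\ Bad n w) <= d / 2.
  by near: n; apply: hB; rewrite divr_gt0.
apply: (@le_trans _ _ (cfg_prob lam alpha (fun w => ~ @typical R m lam alpha dl (1 / 4) n w \/
    (good_edges (edges_of w) /\ Bad n w)))).
  apply: prob_le => // w /contrapT hw.
  have [ht'|] := pselect (@typical R m lam alpha dl (1 / 4) n w); last by left.
  right; split => //; apply/asboolP; case: ht' => t1 _ _ t4; split.
    by move=> u; rewrite degr_unmarked.
  by move=> f; rewrite enoise_unmarked.
apply: le_trans (prob_or _ _ hl) _.
by move: h1 h2; rewrite /cfg_prob; lra.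
Unshelve. all: by end_near. Qed.

Let sc n (o : option 'I_m) := score (alpha n) o.

Lemma score_chernoff n (o : option 'I_m) q (B a La : R) :
  0 <= edge_prob lam n -> edge_prob lam n <= 1 -> 0 < ln n%:R :> R ->
  0 < B -> 0 <= La ->
  (forall e, @good_edges n e -> forall u, `|q e u| <= B) ->
  (forall e, @good_edges n e -> \sum_u `|q e u| <= 1) ->
  cfg_prob lam alpha (fun w => good_edges (edges_of w) /\
     a <= `|\sum_u q (edges_of w) u * score_avg w (@sc n o) u|) <=
  2 * expR (- (La * a / (B / (dl * ln n%:R))) + alpha n * expR La * (La ^+ 2 / (B / (dl * ln n%:R)))).
Proof.
move=> p0 p1 L0 B0 La0 hB h1.
have aa0 := alpha_ge0 halpha n; have aa1 := alpha_le1 halpha n.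
have [_ ah] := halpha n.
have D0 : 0 < dl * ln n%:R by rewrite mulr_gt0.
have Q0 : 0 < B / (dl * ln n%:R) by rewrite divr_gt0.
have hl : is_law (@config_weight R m n (edge_prob lam n) (alpha n)) by apply: config_law.
have hs := score_is_score hm p0 p1 aa0 ah o.
have one (q' : {ffun slot m n -> bool} -> vertex m n -> R) :
    (forall e u, `|q' e u| = `|q e u|) ->
    cfg_prob lam alpha (fun w => good_edges (edges_of w) /\
      a <= \sum_u q' (edges_of w) u * score_avg w (@sc n o) u) <=
   expR (- (La * a / (B / (dl * ln n%:R))) + alpha n * expR La * (La ^+ 2 / (B / (dl * ln n%:R)))).
  move=> hq'.
  have := @cond_chernoff R m n (edge_prob lam n) (alpha n) hm p0 p1 aa0 aa1 _ hs (@good_edges n)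
    (slot_weight q') La (B / (dl * ln n%:R)) a La0 Q0.
  move=> h; apply: le_trans (h _ _).
  - by apply: prob_le => // w; rewrite mark_sumE.
  - move=> e he s; have /asboolP[hd _] := he.
    by apply: slot_weight_le => // u; rewrite hq' hB.
  - move=> e he; have /asboolP[hd _] := he.
    by rewrite (slot_weight_l1 _ D0 hd); under eq_bigr do rewrite hq'; apply: h1.
apply: (@le_trans _ _ (cfg_prob lam alpha (fun w =>
   (good_edges (edges_of w) /\ a <= \sum_u q (edges_of w) u * score_avg w (@sc n o) u) \/
   (good_edges (edges_of w) /\ a <= \sum_u (- q (edges_of w) u) * score_avg w (@sc n o) u)))).
  apply: prob_le => // w [hg ha].
  have eN : \sum_u (- q (edges_of w) u) * score_avg w (@sc n o) u = - \sum_u q (edges_of w) u * score_avg w (@sc n o) u.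
    by rewrite -sumrN; apply: eq_bigr => u _; rewrite mulNr.
  rewrite eN; have [h|h] := leP 0 (\sum_u q (edges_of w) u * score_avg w (@sc n o) u).
    by left; split => //; rewrite ger0_norm in ha.
  by right; split => //; rewrite ltr0_norm in ha.
apply: le_trans (prob_or _ _ hl) _.
have := one q (fun _ _ => erefl).
have := one (fun e u => - q e u) (fun _ _ => normrN _).
by rewrite /cfg_prob; lra.
Qed.

(** The time at which a product of degrees of order ln n reaches n. *)
Definition tau n : R := ln n%:R / ln (ln n%:R).
(** After 16 tau steps the noise, of norm at most L^(-1/4), has decayed to
    n^(-4). *)
Definition horizon n : nat := (Num.truncn (16 * tau n)).+1.

Lemma near_lnln_ge (M : R) : \forall n \near \oo, M <= ln (ln n%:R).
Proof.
near=> n.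
have h : expR M <= ln n%:R :> R by near: n; exact: near_ln_ge.
rewrite -[M]expRK ler_ln ?posrE ?expR_gt0 //.
exact: lt_le_trans (expR_gt0 _) h.
Unshelve. all: by end_near. Qed.

(** There are (m + 1) m n pairs, so the power n^(-7) leaves ample room. *)
Lemma union_bound (Bad : forall n, option 'I_m * vertex m n -> config m n -> Prop) :
  (\forall n \near \oo, forall ou, cfg_prob lam alpha (Bad n ou) <= 2 * expR (- (7 * ln n%:R))) ->
  forall d : R, 0 < d -> \forall n \near \oo, cfg_prob lam alpha (fun w => exists ou, Bad n ou w) <= d.
Proof.
move=> hB d d0; near=> n.
have hl : is_law (@config_weight R m n (edge_prob lam n) (alpha n)) by near: n; exact: near_law.
have h : forall ou, cfg_prob lam alpha (Bad n ou) <= 2 * expR (- (7 * ln n%:R)) by near: n.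
have n1 : 1 <= n%:R :> R by near: n; exact: near_nat_ge.
have hn : (m.+1 * m)%:R * 2 / d <= n%:R by near: n; exact: near_nat_ge.
have n0 : 0 < n%:R :> R := lt_le_trans ltr01 n1.
apply: le_trans (prob_exists _ hl) _.
apply: le_trans (ler_sum _ (fun ou _ => h ou)) _.
rewrite sumr_const card_prod card_option card_prod !card_ord -[leLHS]mulr_natl.
rewrite mulnA natrM expRN expRM_natl lnK ?posrE //.
have e : n%:R ^- 7 <= n%:R ^- 2 :> R.
  by rewrite lef_pV2 ?posrE ?exprn_gt0 // ler_weXn2l.
apply: (@le_trans _ _ ((m.+1 * m)%:R * n%:R * (2 * n%:R ^- 2))).
  by rewrite ler_wpM2l ?mulr_ge0 // ler_wpM2l.
have -> : (m.+1 * m)%:R * n%:R * (2 * n%:R ^- 2) = (m.+1 * m)%:R * 2 / n%:R :> R.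
  by field; rewrite gt_eqF.
by rewrite ler_pdivrMr // -ler_pdivrMl // mulrC.
Unshelve. all: by end_near. Qed.

(** Chernoff: an average over about L marks has the exponent - 8 L for a
    constant exponential parameter, and the variance term is at most L because
    alpha = o(1). This leaves n^(-7). *)
Lemma score_small_whp (e1 : R) : 0 < e1 ->
  (forall c : R, 0 < c -> \forall n \near \oo, alpha n <= c) ->
  whp lam alpha (fun n w => forall o u, `|score_avg w (@sc n o) u| <= e1).
Proof.
move=> e10 hA.
(* The first term of the exponent is then - 8 ln n. *)
pose La := 8 / (e1 * dl).
have La0 : 0 < La by rewrite divr_gt0 // mulr_gt0.
have c0 : 0 < (expR La * La ^+ 2 * dl)^-1.
  by rewrite invr_gt0 (mulr_gt0 _ dl0) // (mulr_gt0 (expR_gt0 _)) // exprn_gt0.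
apply: (whp_near hm hlam halpha _ (@whp_good_edges (fun n w => exists ou : option 'I_m * vertex m n, e1 <= `|score_avg w (@sc n ou.1) ou.2|) _)).
  near=> n => w hw o u; rewrite leNgt; apply/negP => h; apply: hw.
  by exists (o, u); apply: ltW.
move=> d d0.
apply: filterS (@union_bound (fun n ou w => good_edges (edges_of w) /\ e1 <= `|score_avg w (@sc n ou.1) ou.2|) _ d d0).
  move=> n; apply: le_trans; rewrite /cfg_prob /prob le_eqVlt; apply/orP; left; apply/eqP.
  apply: eq_bigr => w _; congr (_ * (nat_of_bool _)%:R); apply: asbool_equiv_eq; split.
    by move=> [hg [ou h]]; exists ou.
  by move=> [ou [hg h]]; split => //; exists ou.
near=> n.
have [p0 p1] : 0 <= edge_prob lam n /\ edge_prob lam n <= 1 by near: n; exact: near_edge_prob.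
have L1 : 1 <= ln n%:R :> R by near: n; exact: near_ln_ge.
have ac : alpha n <= (expR La * La ^+ 2 * dl)^-1 by near: n; apply: hA.
have L0 : 0 < ln n%:R :> R := lt_le_trans ltr01 L1.
move=> [ o u].
pose q (e : {ffun slot m n -> bool}) (v : vertex m n) : R := (v == u)%:R.
have hq f : \sum_v q f v = 1 by rewrite (bigD1 u) //= /q eqxx big1 ?addr0 // => v /negbTE ->.
have := @score_chernoff n o q 1 e1 La p0 p1 L0 ltr01 (ltW La0).
have -> : (fun w => good_edges (edges_of w) /\ e1 <= `|\sum_u q (edges_of w) u * score_avg w (@sc n o) u|) =
  (fun w => good_edges (edges_of w) /\ e1 <= `|score_avg w (@sc n (o, u).1) (o, u).2|).
  apply/funext => w; congr (_ /\ _ <= `|_|).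
  by rewrite (bigD1 u) //= /q eqxx mul1r big1 ?addr0 // => v /negbTE ->; rewrite mul0r.
move=> h; apply: le_trans (h _ _) _.
- by move=> e _ v; rewrite /q; case: (_ == _); rewrite ?normr1 ?normr0.
- by move=> e _; rewrite -[leRHS](hq e); apply: ler_sum => v _; rewrite /q ger0_norm.
rewrite ler_pM2l // ler_expR.
have -> : La * e1 / (1 / (dl * ln n%:R)) = 8 * ln n%:R.
  by rewrite /La; field; rewrite !gt_eqF.
have -> : La ^+ 2 / (1 / (dl * ln n%:R)) = La ^+ 2 * dl * ln n%:R by field; rewrite !gt_eqF.
have k0 : 0 < expR La * La ^+ 2 * dl.
  by rewrite (mulr_gt0 _ dl0) // (mulr_gt0 (expR_gt0 _)) // exprn_gt0.
have : alpha n * expR La * (La ^+ 2 * dl * ln n%:R) <= ln n%:R.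
  have -> : alpha n * expR La * (La ^+ 2 * dl * ln n%:R) = alpha n * (expR La * La ^+ 2 * dl) * ln n%:R by ring.
  by rewrite ler_piMl ?(ltW L0) // -ler_pdivlMr // div1r.
lra.
Unshelve. all: by end_near. Qed.

(** After one step of the unrewired walk the average runs over about L^2 marks,
    which brings it below e1 / horizon. This gains one factor horizon over
    score_small_whp, enough to sum over the horizon. *)
Lemma score_walk_small_whp (e1 Ca : R) : 0 < e1 -> 0 < Ca ->
  (\forall n \near \oo, alpha n * tau n <= Ca) ->
  whp lam alpha (fun n w => forall o u,
    `|walk (@base_dst m) w (score_avg w (@sc n o)) u| <= e1 / (horizon n)%:R).
Proof.
move=> e10 Ca0 hA.
(* The variance term is then at most half of the first term of the exponent, as
   horizon <= 17 tau; and 238 below is 7 * 34. *)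
pose La := Num.min 1 (e1 / (34 * Ca * expR 1)).
have La0 : 0 < La by rewrite lt_min ltr01 divr_gt0 // !mulr_gt0 ?expR_gt0.
have La1 : La <= 1 by rewrite ge_min lexx.
have La2 : La <= e1 / (34 * Ca * expR 1) by rewrite ge_min lexx orbT.
apply: (whp_near hm hlam halpha _ (@whp_good_edges (fun n w => exists ou : option 'I_m * vertex m n,
   e1 / (horizon n)%:R <= `|walk (@base_dst m) w (score_avg w (@sc n ou.1)) ou.2|) _)).
  near=> n => w hw o u; rewrite leNgt; apply/negP => h; apply: hw.
  by exists (o, u); apply: ltW.
move=> d d0.
apply: filterS (@union_bound (fun n ou w => good_edges (edges_of w) /\
    e1 / (horizon n)%:R <= `|walk (@base_dst m) w (score_avg w (@sc n ou.1)) ou.2|) _ d d0).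
  move=> n; apply: le_trans; rewrite /cfg_prob /prob le_eqVlt; apply/orP; left; apply/eqP.
  apply: eq_bigr => w _; congr (_ * (nat_of_bool _)%:R); apply: asbool_equiv_eq; split.
    by move=> [hg [ou h]]; exists ou.
  by move=> [ou [hg h]]; split => //; exists ou.
near=> n.
have [p0 p1] : 0 <= edge_prob lam n /\ edge_prob lam n <= 1 by near: n; exact: near_edge_prob.
have L1 : 1 <= ln n%:R :> R by near: n; exact: near_ln_ge.
have lL1 : 1 <= ln (ln n%:R) :> R by near: n; exact: near_lnln_ge.
have lL2 : 238 / (La * e1 * dl ^+ 2) <= ln (ln n%:R) :> R by near: n; exact: near_lnln_ge.
have at1 : alpha n * tau n <= Ca by near: n.
have L0 : 0 < ln n%:R :> R := lt_le_trans ltr01 L1.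
have lL0 : 0 < ln (ln n%:R) :> R := lt_le_trans ltr01 lL1.
move=> [ o u].
set L := ln n%:R in L0 L1 lL0 lL1 lL2 *.
have ta1 : 1 <= tau n.
  rewrite /tau ler_pdivlMr // mul1r.
  have := @le_ln1Dx R (L - 1); rewrite addrCA subrr addr0 -/L => h.
  by apply: le_trans (h _) _; move: L0; lra.
have hz0 : 0 < (horizon n)%:R :> R by rewrite ltr0n.
have hz : (horizon n)%:R <= 17 * tau n.
  rewrite /horizon -natr1.
  have t0 : 0 <= 16 * tau n by move: ta1; lra.
  by have /andP[h _] := truncn_itv t0; move: ta1 h; lra.
have D0 : 0 < dl * L by rewrite mulr_gt0.
pose q (e : {ffun slot m n -> bool}) (v : vertex m n) : R :=
  (degr (unmarked e) u)%:R^-1 * (arc (@base_dst m) (unmarked e) u v)%:R.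
have B0 : 0 < 1 / (dl * L) by rewrite divr_gt0.
have := @score_chernoff n o q (1 / (dl * L)) (e1 / (horizon n)%:R) La p0 p1 L0 B0 (ltW La0).
have -> : (fun w => good_edges (edges_of w) /\ e1 / (horizon n)%:R <= `|\sum_u q (edges_of w) u * score_avg w (@sc n o) u|) =
  (fun w => good_edges (edges_of w) /\ e1 / (horizon n)%:R <= `|walk (@base_dst m) w (score_avg w (@sc n (o, u).1)) (o, u).2|).
  apply/funext => w; congr (_ /\ _ <= `|_|).
  rewrite walk_kernel_apply /kernel_apply mulr_sumr; apply: eq_bigr => v _.
  by rewrite /q degr_unmarked arc_unmarked -mulrA.
move=> h; apply: le_trans (h _ _) _.
- move=> e he v; have /asboolP[hd _] := he.
  have du : 0 < (degr (unmarked e) u)%:R :> R := lt_le_trans D0 (hd u).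
  rewrite /q ger0_norm ?mulr_ge0 ?invr_ge0 // div1r.
  apply: (@le_trans _ _ ((degr (unmarked e) u)%:R^-1)).
    by rewrite ler_piMr ?invr_ge0 //; case: arc.
  by rewrite lef_pV2 ?posrE.
- move=> e he; have /asboolP[hd _] := he.
  have du : 0 < (degr (unmarked e) u)%:R :> R := lt_le_trans D0 (hd u).
  under eq_bigr do rewrite ger0_norm ?mulr_ge0 ?invr_ge0 //.
  by rewrite -mulr_sumr -degr_arc mulVf // gt_eqF.
rewrite ler_pM2l // ler_expR.
have -> : La * (e1 / (horizon n)%:R) / (1 / (dl * L) / (dl * L)) = La * e1 * dl ^+ 2 * L * (L / (horizon n)%:R).
  by field; rewrite !gt_eqF.
have -> : La ^+ 2 / (1 / (dl * L) / (dl * L)) = La ^+ 2 * dl ^+ 2 * L ^+ 2 by field; rewrite !gt_eqF.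
have h1 : ln L / 17 <= L / (horizon n)%:R.
  rewrite ler_pdivlMr //; apply: (@le_trans _ _ (ln L / 17 * (17 * tau n))).
    by rewrite ler_wpM2l // divr_ge0 // ltW.
  rewrite /tau -/L le_eqVlt; apply/orP; left; apply/eqP; field; exact: lt0r_neq0.
have h2 : alpha n * L <= Ca * ln L.
  by rewrite -ler_pdivrMr // -mulrA; exact: at1.
have h3 : alpha n * expR La * (La ^+ 2 * dl ^+ 2 * L ^+ 2) <= La * e1 * dl ^+ 2 * L * (ln L / 34).
  have -> : alpha n * expR La * (La ^+ 2 * dl ^+ 2 * L ^+ 2) = (alpha n * L) * (expR La * La) * (La * dl ^+ 2 * L) by ring.
  have -> : La * e1 * dl ^+ 2 * L * (ln L / 34) = (ln L * (e1 / 34)) * (La * dl ^+ 2 * L) by ring.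
  rewrite ler_wpM2r ?mulr_ge0 ?exprn_ge0 ?(ltW La0) ?(ltW L0) ?(ltW dl0) //.
  apply: (@le_trans _ _ (Ca * ln L * (expR 1 * La))).
    apply: ler_pM; rewrite ?mulr_ge0 ?expR_ge0 ?(ltW La0) ?(ltW L0) ?(alpha_ge0 halpha) //.
    by rewrite ler_wpM2r ?(ltW La0) // ler_expR.
  rewrite mulrAC mulrC; rewrite ler_wpM2l ?(ltW lL0) //.
  move: La2; rewrite ler_pdivlMr ?mulr_gt0 ?expR_gt0 //; lra.
have h4 : 7 * L <= La * e1 * dl ^+ 2 * L * (ln L / 34).
  have k0 : 0 < La * e1 * dl ^+ 2 by rewrite !mulr_gt0 // exprn_gt0.
  rewrite ler_pdivrMr // in lL2.
  have -> : La * e1 * dl ^+ 2 * L * (ln L / 34) = (ln L * (La * e1 * dl ^+ 2)) / 34 * L by ring.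
  by rewrite ler_wpM2r ?(ltW L0) //; move: lL2; lra.
have h5 : La * e1 * dl ^+ 2 * L * (ln L / 17) <= La * e1 * dl ^+ 2 * L * (L / (horizon n)%:R).
  by rewrite ler_wpM2l // !mulr_ge0 ?exprn_ge0 ?(ltW La0) ?(ltW e10) ?(ltW dl0) ?(ltW L0).
have e5 : La * e1 * dl ^+ 2 * L * (ln L / 17) = 2 * (La * e1 * dl ^+ 2 * L * (ln L / 34)) by field.
rewrite e5 in h5.
lra.
Unshelve. all: by end_near. Qed.
End Events.

Section Events2.
Variables (R : realType) (m : nat) (hm : (1 < m)%N).
Variables (lam : R) (hlam : 1 < lam) (alpha : nat -> R).
Hypothesis halpha : forall n, 0 < alpha n /\ alpha n <= 1 / 2.
Variable dl : R.
Hypotheses (dlE : dl = degree_const lam) (dl0 : 0 < dl).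
Let sc n (o : option 'I_m) := score (alpha n) o.
Let en n (w : config m n) : (vertex m n -> R) -> vertex m n -> R :=
  enoise (@base_dst m) (edge_prob lam n) (@base_mean R m) w.

Lemma near_rate_le (eps M : R) : eps < 2^-1 -> 0 < M -> \forall n \near \oo, rate eps n <= M.
Proof.
move=> he M0.
have e0 : 0 < 2^-1 - eps by rewrite subr_gt0.
have [L0 hL0] := near_powR_ge M^-1 e0.
near=> n.
have hL : L0 <= ln n%:R by near: n; exact: near_ln_ge.
have h := hL0 _ hL.
rewrite /rate -opprB powRN -[leRHS]invrK lef_pV2 // ?posrE ?invr_gt0 //.
by apply: lt_le_trans h; rewrite invr_gt0.
Unshelve. all: by end_near. Qed.

Lemma sum_half (N : nat) : \sum_(l < N) 2^-1 ^+ l <= 2 :> R.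
Proof.
have -> : \sum_(k < N) 2^-1 ^+ k = 2 - 2 * 2^-1 ^+ N :> R.
  elim: N => [|N IH]; first by rewrite big_ord0 expr0; lra.
  rewrite big_ord_recr /= IH exprS; lra.
by rewrite gerBl mulr_ge0 // exprn_ge0 // invr_ge0.
Qed.

Lemma functional_chebyshev n (o : option 'I_m) (i : 'I_m) (l : nat) (a : R) :
  0 <= edge_prob lam n -> edge_prob lam n <= 1 -> 0 < ln n%:R :> R -> 0 < a ->
  cfg_prob lam alpha (fun w => good_edges lam dl (edges_of w) /\
     a <= `|\sum_y iter l (@en n w) (score_avg w (@sc n o)) (i, y)|) <=
  alpha n * (n%:R * rate (1 / 4) n ^+ l ^+ 2 / (dl * ln n%:R)) / a ^+ 2.
Proof.
move=> p0 p1 L0 a_0.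
have aa0 := alpha_ge0 halpha n; have aa1 := alpha_le1 halpha n.
have [_ ah] := halpha n.
have D0 : 0 < dl * ln n%:R by rewrite mulr_gt0.
have hl : is_law (@config_weight R m n (edge_prob lam n) (alpha n)) by apply: config_law.
have hs := score_is_score hm p0 p1 aa0 ah o.
pose q (e : {ffun slot m n -> bool}) := comm_functional (edge_prob lam n) (@base_mean R m) (@base_dst m) (unmarked e) l i.
have r0 : 0 <= rate (1 / 4) n :> R by rewrite powR_ge0.
have V0 : 0 <= n%:R * rate (1 / 4) n ^+ l ^+ 2 / (dl * ln n%:R).
  by rewrite divr_ge0 ?(ltW D0) // mulr_ge0 // sqr_ge0.
have := @cond_chebyshev R m n (edge_prob lam n) (alpha n) hm p0 p1 aa0 aa1 _ hs (@good_edges R m lam dl n)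
  (slot_weight q) _ a V0 a_0.
move=> h; apply: le_trans (h _); last first.
  move=> e /asboolP[hd he]; apply: le_trans (slot_weight_l2 _ D0 hd) _.
  rewrite ler_wpM2r ?invr_ge0 ?(ltW D0) //; exact: comm_functional_l2.
apply: prob_le => // w; rewrite mark_sumE => -[hg ha]; split => //.
apply: le_trans ha _; rewrite le_eqVlt; apply/orP; left; apply/eqP; congr (`|_|).
rewrite comm_functionalE; apply: eq_bigr => u _; congr (_ * _).
rewrite /q /comm_functional; apply: eq_bigr => y _.
by rewrite enoise_unmarked.
Qed.

(** The community sums have variance of order alpha n / L times a geometric
    factor. Chebyshev makes them o(alpha n) as alpha n L tends to infinity, and
    the geometric factor makes the union over l harmless. *)
Lemma functional_small_whp (c : R) : 0 < c ->
  (forall M : R, \forall n \near \oo, M <= alpha n * n%:R * ln n%:R) ->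
  whp lam alpha (fun n w => forall o i l, (l < horizon R n)%N ->
    `|\sum_y iter l (@en n w) (score_avg w (@sc n o)) (i, y)| <= c * alpha n * n%:R * 2^-1 ^+ l).
Proof.
move=> c0 hA.
pose Bad n (oil : option 'I_m * 'I_m * 'I_(horizon R n)) (w : config m n) :=
  c * alpha n * n%:R * 2^-1 ^+ oil.2 <= `|\sum_y iter oil.2 (@en n w) (score_avg w (@sc n oil.1.1)) (oil.1.2, y)|.
apply: (whp_near hm hlam halpha _ (whp_good_edges hm hlam halpha dlE (Bad := fun n w => exists oil, Bad n oil w) _)).
  near=> n => w hw o i l hl; rewrite leNgt; apply/negP => h; apply: hw.
  by exists (o, i, Ordinal hl); apply: ltW.
move=> d d0; near=> n.
have hl : is_law (@config_weight R m n (edge_prob lam n) (alpha n)) by near: n; exact: near_law.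
have [p0 p1] : 0 <= edge_prob lam n /\ edge_prob lam n <= 1 by near: n; exact: near_edge_prob.
have L1 : 1 <= ln n%:R :> R by near: n; exact: near_ln_ge.
have n1 : 1 <= n%:R :> R by near: n; exact: near_nat_ge.
have hM : (m.+1 * m)%:R * 2 / (c ^+ 2 * dl * d) <= alpha n * n%:R * ln n%:R by near: n; exact: hA.
have hr : rate (1 / 4) n <= 1 / 4 :> R.
  by near: n; apply: near_rate_le; lra.
have L0 : 0 < ln n%:R :> R := lt_le_trans ltr01 L1.
have n0 : 0 < n%:R :> R := lt_le_trans ltr01 n1.
have [ap _] := halpha n.
have r0 : 0 <= rate (1 / 4) n :> R by rewrite powR_ge0.
set L := ln n%:R in hM L1 L0.
have M0 : 0 < c ^+ 2 * dl * (alpha n * n%:R * L).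
  by rewrite mulr_gt0 ?mulr_gt0 // exprn_gt0.
apply: (@le_trans _ _ (cfg_prob lam alpha (fun w => exists oil, good_edges lam dl (edges_of w) /\ Bad n oil w))).
  by apply: prob_le => // w [hg [oil h]]; exists oil.
apply: le_trans (prob_exists _ hl) _.
apply: (@le_trans _ _ (\sum_(oil : option 'I_m * 'I_m * 'I_(horizon R n))
   (c ^+ 2 * dl * (alpha n * n%:R * L))^-1 * 2^-1 ^+ oil.2)).
  apply: ler_sum => -[ [ o i] l] _ /=.
  have a_0 : 0 < c * alpha n * n%:R * 2^-1 ^+ l.
    by rewrite !mulr_gt0 // exprn_gt0 // invr_gt0.
  apply: le_trans (functional_chebyshev o i l p0 p1 L0 a_0) _.
  have -> : alpha n * (n%:R * rate (1 / 4) n ^+ l ^+ 2 / (dl * ln n%:R)) / (c * alpha n * n%:R * 2^-1 ^+ l) ^+ 2 =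
    (c ^+ 2 * dl * (alpha n * n%:R * L))^-1 * (2 * rate (1 / 4) n) ^+ l ^+ 2.
    rewrite [(2 * rate (1 / 4) n) ^+ l]exprMn exprVn -/L.
    have t0 : 2 ^+ l != 0 :> R by rewrite expf_neq0.
    move: t0; move: (2 ^+ l) (rate (1 / 4) n ^+ l) => s t s0; field.
    by rewrite s0 !gt_eqF.
  rewrite ler_wpM2l ?invr_ge0 ?(ltW M0) // -exprM mulnC exprM lerXn2r ?nnegrE ?sqr_ge0 ?invr_ge0 //.
  by rewrite exprMn expr2; move: hr r0; nra.
rewrite -(pair_bigA _ (fun (oi : option 'I_m * 'I_m) (l : 'I_(horizon R n)) =>
  (c ^+ 2 * dl * (alpha n * n%:R * L))^-1 * 2^-1 ^+ l)) /=.
apply: (@le_trans _ _ (\sum_(oi : option 'I_m * 'I_m) (c ^+ 2 * dl * (alpha n * n%:R * L))^-1 * 2)).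
  apply: ler_sum => oi _; rewrite -mulr_sumr ler_wpM2l ?invr_ge0 ?(ltW M0) //; exact: sum_half.
rewrite sumr_const card_prod card_option card_ord -[leLHS]mulr_natl mulrCA ler_pdivrMl //.
move: hM; rewrite ler_pdivrMr; last by rewrite !mulr_gt0 // exprn_gt0.
by move=> h; apply: le_trans (le_trans _ h) _; rewrite le_eqVlt; apply/orP; left; apply/eqP; ring.
Unshelve. all: by end_near. Qed.

(** The expected square of the norm is of order alpha n / L; Markov loses the
    factor L^(1/4). *)
Lemma score_l2_whp (o : option 'I_m) :
  whp lam alpha (fun n w => l2 (score_avg w (@sc n o)) ^+ 2 <= alpha n * (m * n)%:R / (dl * ln n%:R) / rate (1 / 4) n).
Proof.
apply: (whp_near hm hlam halpha _ (whp_good_edges hm hlam halpha dlE (Bad := fun n w =>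
   alpha n * (m * n)%:R / (dl * ln n%:R) / rate (1 / 4) n <= l2 (score_avg w (@sc n o)) ^+ 2) _)).
  by near=> n => w hw; rewrite leNgt; apply/negP => h; apply: hw; apply: ltW.
move=> d d0; near=> n.
have hl : is_law (@config_weight R m n (edge_prob lam n) (alpha n)) by near: n; exact: near_law.
have [p0 p1] : 0 <= edge_prob lam n /\ edge_prob lam n <= 1 by near: n; exact: near_edge_prob.
have L1 : 1 <= ln n%:R :> R by near: n; exact: near_ln_ge.
have n1 : 1 <= n%:R :> R by near: n; exact: near_nat_ge.
have hr : rate (1 / 4) n <= d by near: n; apply: near_rate_le => //; lra.
have L0 : 0 < ln n%:R :> R := lt_le_trans ltr01 L1.
have n0 : 0 < n%:R :> R := lt_le_trans ltr01 n1.
have [ap ah] := halpha n.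
have aa0 := alpha_ge0 halpha n; have aa1 := alpha_le1 halpha n.
have D0 : 0 < dl * ln n%:R by rewrite mulr_gt0.
have hs := score_is_score hm p0 p1 aa0 ah o.
have r0 : 0 < rate (1 / 4) n :> R by rewrite powR_gt0.
have mn0 : 0 < (m * n)%:R :> R by rewrite natrM mulr_gt0 // ltr0n ltnW.
pose q (u : vertex m n) (e : {ffun slot m n -> bool}) (v : vertex m n) : R := (v == u)%:R.
have qsq u e : \sum_v q u e v ^+ 2 = 1.
  by rewrite (bigD1 u) //= /q eqxx expr1n big1 ?addr0 // => v /negbTE ->; rewrite expr0n.
have mom u : expect (@config_weight R m n (edge_prob lam n) (alpha n))
   (fun w => (good_edges lam dl (edges_of w))%:R * score_avg w (@sc n o) u ^+ 2) <= alpha n * (dl * ln n%:R)^-1.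
  have := @cond_second_moment R m n (edge_prob lam n) (alpha n) hm p0 p1 aa0 aa1 _ hs (@good_edges R m lam dl n)
    (slot_weight (q u)) (dl * ln n%:R)^-1.
  rewrite invr_ge0 (ltW D0) => /(_ isT) h; apply: le_trans (h _); last first.
    move=> e /asboolP[hd he]; apply: le_trans (slot_weight_l2 _ D0 hd) _.
    by rewrite qsq div1r.
  rewrite le_eqVlt; apply/orP; left; apply/eqP; apply: eq_bigr => w _.
  rewrite mark_sumE; congr (_ * (_ * _ ^+ 2)).
  by rewrite (bigD1 u) //= /q eqxx mul1r big1 ?addr0 // => v /negbTE ->; rewrite mul0r.
set A := alpha n * (m * n)%:R / (dl * ln n%:R).
have A0 : 0 < A by rewrite divr_gt0 // mulr_gt0.
have Ar0 : 0 < A / rate (1 / 4) n by rewrite divr_gt0.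
apply: (@le_trans _ _ ((\sum_(u : vertex m n) expect (@config_weight R m n (edge_prob lam n) (alpha n))
   (fun w => (good_edges lam dl (edges_of w))%:R * score_avg w (@sc n o) u ^+ 2)) / (A / rate (1 / 4) n))).
  have -> : (\sum_(u : vertex m n) expect (@config_weight R m n (edge_prob lam n) (alpha n))
     (fun w => (good_edges lam dl (edges_of w))%:R * score_avg w (@sc n o) u ^+ 2)) / (A / rate (1 / 4) n) =
   expect (@config_weight R m n (edge_prob lam n) (alpha n))
     (fun w => (good_edges lam dl (edges_of w))%:R * (l2 (score_avg w (@sc n o)) ^+ 2 / (A / rate (1 / 4) n))).
    rewrite /expect exchange_big mulr_suml; apply: eq_bigr => w _ /=.
    by rewrite l2_sq -mulr_sumr -mulr_sumr !mulrA.
  apply: prob_le_expect => // w; first by rewrite mulr_ge0 // divr_ge0 ?sqr_ge0 // ltW.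
  by move=> [-> h]; rewrite [leRHS]mul1r ler_pdivlMr // [leLHS]mul1r.
rewrite ler_pdivrMr //; apply: le_trans (ler_sum _ (fun u _ => mom u)) _.
rewrite sumr_const card_prod !card_ord -[leLHS]mulr_natl.
have -> : (m * n)%:R * (alpha n * (dl * ln n%:R)^-1) = A by rewrite /A; ring.
rewrite [leRHS]mulrCA -[leLHS]mulr1 ler_wpM2l ?(ltW A0) //.
by rewrite ler_pdivlMr // [leLHS]mul1r.
Unshelve. all: by end_near. Qed.

End Events2.

(** * Mixing inside the communities *)

Section Mixing.
Variables (R : realType) (m : nat) (hm : (1 < m)%N).
Variables (lam : R) (hlam : 1 < lam) (alpha : nat -> R).
Hypothesis halpha : forall n, 0 < alpha n /\ alpha n <= 1 / 2.
Variable dl : R.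
Hypotheses (dlE : dl = degree_const lam) (dl0 : 0 < dl).
Let lam0 : 0 < lam := lt_trans ltr01 hlam.

(** The exponent for which the noise bound to the power (1 + eta) tau is n^(-
    1/2 - eta / 4). *)
Definition slack (eta : R) : R := eta / (4 * (1 + eta)).

Lemma slack_gt0 eta : 0 < eta -> 0 < slack eta.
Proof. by move=> h; rewrite divr_gt0 // mulr_gt0 // addr_gt0. Qed.

Lemma slack_lt eta : 0 < eta -> slack eta < 1 / 4.
Proof. by move=> h; rewrite /slack ltr_pdivrMr; [lra|rewrite mulr_gt0 // addr_gt0]. Qed.

(** Here the entropic time appears: L^(- t / 2) compensates the factor sqrt n,
    the norm of a bounded function, at t = tau. The exponent slack and the
    factor L are paid by eta. *)
Lemma rate_pow_small (eta M : R) : 0 < eta -> 0 < M ->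
  \forall n \near \oo, forall t : nat, (1 + eta) * tau R n <= t%:R ->
    rate (slack eta) n ^+ t * Num.sqrt (m * n)%:R * ln n%:R <= M.
Proof.
move=> e0 M0.
have s1 : 0 < 1 + eta by rewrite addr_gt0.
near=> n.
have L1 : 1 <= ln n%:R :> R by near: n; exact: near_ln_ge.
have lL1 : 1 <= ln (ln n%:R) :> R by near: n; exact: near_lnln_ge.
have n1 : 1 <= n%:R :> R by near: n; exact: near_nat_ge.
have hL : 32 * Num.sqrt m%:R / (M * eta ^+ 2) <= ln n%:R by near: n; exact: near_ln_ge.
move=> t ht.
have n0 : 0 < n%:R :> R := lt_le_trans ltr01 n1.
have L0 : 0 < ln n%:R :> R := lt_le_trans ltr01 L1.
have lL0 : 0 < ln (ln n%:R) :> R := lt_le_trans ltr01 lL1.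
set L := ln n%:R in L0 L1 lL0 lL1 hL *.
have rE : rate (slack eta) n ^+ t <= expR (- (L / 2 + eta / 4 * L)).
  rewrite /rate -/L /powR gt_eqF // -expRM_natl ler_expR.
  have h : L * (1 + eta) <= t%:R * ln L.
    by rewrite -ler_pdivrMr // mulrAC mulrC; exact: ht.
  have h' : (2^-1 - slack eta) * (L * (1 + eta)) = L / 2 + eta / 4 * L.
    by rewrite /slack; field; rewrite gt_eqF.
  have k0 : 0 <= 2^-1 - slack eta by have := slack_lt e0; lra.
  have := ler_wpM2l k0 h; rewrite h'; lra.
have sn : Num.sqrt n%:R = expR (L / 2) :> R.
  by rewrite -powR12_sqrt // /powR gt_eqF // mulrC.
apply: (@le_trans _ _ (expR (- (L / 2 + eta / 4 * L)) * Num.sqrt (m * n)%:R * L)).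
  by rewrite ler_wpM2r ?(ltW L0) // ler_wpM2r ?sqrtr_ge0.
rewrite natrM sqrtrM // sn opprD expRD.
have -> : expR (- (L / 2)) * expR (- (eta / 4 * L)) * (Num.sqrt m%:R * expR (L / 2)) * L =
   (expR (- (L / 2)) * expR (L / 2)) * (expR (- (eta / 4 * L)) * (Num.sqrt m%:R * L)) by ring.
rewrite -expRD addNr expR0 mul1r expRN ler_pdivrMl ?expR_gt0 //.
have x0 : 0 <= eta / 4 * L by rewrite mulr_ge0 ?divr_ge0 ?(ltW e0) ?(ltW L0).
have h2 := expR_ge1Dxn 1 x0.
rewrite ler_pdivrMr in hL; last by rewrite mulr_gt0 // exprn_gt0.
apply: (@le_trans _ _ ((eta / 4 * L) ^+ 2 / 2 * M)).
  have h3 := ler_wpM2r (ltW L0) hL; have -> : (eta / 4 * L) ^+ 2 / 2 * M = (L * (M * eta ^+ 2) * L) / 32 by field.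
  by move: h3; lra.
rewrite ler_wpM2r ?(ltW M0) //; apply: le_trans h2.
by rewrite (_ : 2`!%:R = 2 :> R) // lerDr.
Unshelve. all: by end_near. Qed.

Lemma bounded_l2 n (f : vertex m n -> R) : (forall v, `|f v| <= 1) -> l2 f <= Num.sqrt (m * n)%:R.
Proof.
move=> hf; apply: l2_le; first exact: sqrtr_ge0.
rewrite sqr_sqrtr //; apply: (@le_trans _ _ (\sum_(v : vertex m n) 1)).
  by apply: ler_sum => v _; rewrite -real_normK ?num_real // expr_le1.
by rewrite sumr_const card_prod !card_ord.
Qed.

Lemma sum_geom_tail (r K : R) (t : nat) : 0 <= r -> r <= 1 / 2 -> 0 <= K ->
  \sum_(l < t) (if (l == 0 :> nat)%N then 0 else K * r ^+ l) <= 2 * K * r.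
Proof.
move=> r0 r1 K0.
have h : forall t, \sum_(l < t.+1) (if (l == 0 :> nat)%N then 0 else K * r ^+ l) <= 2 * K * r - 2 * K * r * r ^+ t.
  elim=> [|s IH]; first by rewrite big_ord1 /= expr0 mulr1 subrr.
  rewrite big_ord_recr /=; apply: le_trans (lerD IH (lexx _)) _.
  rewrite exprS; have : 0 <= K * r * r ^+ s by rewrite !mulr_ge0 ?exprn_ge0.
  set z := r ^+ s; move=> hz; have : K * r * z * r <= K * r * z * (1 / 2) by rewrite ler_wpM2l.
  lra.
case: t => [|t]; first by rewrite big_ord0 !mulr_ge0.
by apply: le_trans (h t) _; rewrite gerBl !mulr_ge0 ?exprn_ge0.
Qed.

(** The first drift term vanishes because f has zero community sums, and the
    later ones carry at least one power of the noise bound. *)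
Lemma mix_inside_whp (eta e : R) : 0 < eta -> 0 < e ->
  whp lam alpha (fun n (w : config m n) => forall t : nat, (1 + eta) * tau R n <= t%:R ->
    forall (f : vertex m n -> R) x, (forall v, `|f v| <= 1) -> (forall j, \sum_y f (j, y) = 0) ->
    `|iwalk (@full_dst m) w t f x| <= e).
Proof.
move=> et0 e0.
have s0 := slack_gt0 et0; have s4 := slack_lt et0.
have ht : whp lam alpha (@typical R m lam alpha dl (slack eta)).
  by rewrite dlE; apply: typical_whp.
apply: (whp_near hm hlam halpha _ ht).
have e2 : 0 < e / 2 by rewrite divr_gt0.
pose Km := lam * m%:R / dl.
have Km0 : 0 < Km by rewrite divr_gt0 // mulr_gt0 // ltr0n ltnW.
have KmE : Km = lam * m%:R / dl by [].
clearbody Km.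
near=> n => w [hd _ hE _] t htt f x f1 fs.
have L1 : 1 <= ln n%:R :> R by near: n; exact: near_ln_ge.
have n1 : 1 <= n%:R :> R by near: n; exact: near_nat_ge.
have [p0 p1] : 0 <= edge_prob lam n /\ edge_prob lam n <= 1 by near: n; exact: near_edge_prob.
have hr : rate (slack eta) n <= 1 / 2 :> R by near: n; apply: near_rate_le; lra.
have hr2 : rate (slack eta) n <= e / (4 * Km) :> R.
  by near: n; apply: near_rate_le; [lra|rewrite divr_gt0 // mulr_gt0].
have hp : forall t : nat, (1 + eta) * tau R n <= t%:R ->
    rate (slack eta) n ^+ t * Num.sqrt (m * n)%:R * ln n%:R <= e / 2.
  by near: n; apply: rate_pow_small.
have L0 : 0 < ln n%:R :> R := lt_le_trans ltr01 L1.
have n0 : 0 < n%:R :> R := lt_le_trans ltr01 n1.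
have D0 : 0 < dl * ln n%:R by rewrite mulr_gt0.
have r0 : 0 <= rate (slack eta) n :> R by rewrite powR_ge0.
set r := rate (slack eta) n in hr hr2 hp r0 hE.
have fl := bounded_l2 f1.
have := @iwalk_expand R m n (@full_dst m) (edge_prob lam n) (@full_mean R m alpha n) w r
  (fun l => if (l == 0)%N then 0 else Km * r ^+ l) t f x r0 hE.
move=> h; apply: le_trans (h _) _.
  move=> l v _; case: eqP => [->|_].
    by rewrite /= /edrift /drift big1 ?mulr0 ?normr0 // => j _; rewrite fs mulr0.
  have := edrift_abs (iter l (enoise (@full_dst m) (edge_prob lam n) (@full_mean R m alpha n) w) f) v
     D0 p0 (full_mean_01 hm halpha n) hd.
  move=> h'; apply: le_trans h' _.
  apply: (@le_trans _ _ (edge_prob lam n / (dl * ln n%:R) * Num.sqrt (m * n)%:R * (r ^+ l * Num.sqrt (m * n)%:R))).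
    rewrite ler_wpM2l //; first by rewrite mulr_ge0 ?sqrtr_ge0 // divr_ge0 ?(ltW D0).
    by apply: le_trans (iter_enoise_l2 _ _ r0 hE) _; rewrite ler_wpM2l ?exprn_ge0.
  have -> : edge_prob lam n / (dl * ln n%:R) * Num.sqrt (m * n)%:R * (r ^+ l * Num.sqrt (m * n)%:R) =
    edge_prob lam n / (dl * ln n%:R) * (Num.sqrt (m * n)%:R ^+ 2) * r ^+ l by ring.
  rewrite sqr_sqrtr // natrM /edge_prob KmE le_eqVlt; apply/orP; left; apply/eqP; field.
  by rewrite !gt_eqF.
have e1 : \sum_(l < t) (if (l == 0 :> nat)%N then 0 else Km * r ^+ l) <= e / 2.
  apply: le_trans (sum_geom_tail t r0 hr (ltW Km0)) _.
  by move: hr2; rewrite ler_pdivlMr ?mulr_gt0 //; lra.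
have e3 : r ^+ t * l2 f <= e / 2.
  apply: le_trans (hp t htt); apply: (@le_trans _ _ (r ^+ t * Num.sqrt (m * n)%:R)).
    by rewrite ler_wpM2l ?exprn_ge0.
  by rewrite ler_peMr // mulr_ge0 ?sqrtr_ge0 ?exprn_ge0.
lra.
Unshelve. all: by end_near. Qed.

End Mixing.

(** * Decay of the community memory *)

Lemma rate_exponent (R : realType) (H l L : R) : 16 * L <= H * l ->
  H * ((1 / 4 - 2^-1) * l) <= - (4 * L).
Proof. by move=> h; lra. Qed.

Section CommunityMixing.
Variables (R : realType) (m : nat) (hm : (1 < m)%N).
Variables (lam : R) (hlam : 1 < lam) (alpha : nat -> R).
Hypothesis halpha : forall n, 0 < alpha n /\ alpha n <= 1 / 2.
Variable dl : R.
Hypotheses (dlE : dl = degree_const lam) (dl0 : 0 < dl).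
Let lam0 : 0 < lam := lt_trans ltr01 hlam.

Lemma near_tau_ge (M : R) : \forall n \near \oo, M <= tau R n.
Proof.
near=> n.
have L1 : (2 * Num.max M 1) ^+ 2 <= ln n%:R :> R by near: n; exact: near_ln_ge.
have L2 : 2 <= ln n%:R :> R by near: n; exact: near_ln_ge.
have lL : 0 < ln (ln n%:R) :> R by rewrite ln_gt0 //; lra.
set L := ln n%:R in L1 L2 lL.
have L0 : 0 < L by lra.
have m1 : 1 <= Num.max M 1 by rewrite le_max lexx orbT.
apply: (@le_trans _ _ (Num.max M 1)); first by rewrite le_max lexx.
rewrite /tau ler_pdivlMr // -/L.
have h := ln_le_sqrt L0.
have s0 : 0 < Num.sqrt L by rewrite sqrtr_gt0.
have h2 : 2 * Num.max M 1 <= Num.sqrt L.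
  have x0 : 0 <= 2 * Num.max M 1 by move: m1; lra.
  have : (2 * Num.max M 1) ^+ 2 <= Num.sqrt L ^+ 2 by rewrite sqr_sqrtr // (ltW L0).
  by rewrite ler_pXn2r ?nnegrE // (ltW s0).
apply: (@le_trans _ _ (Num.max M 1 * (2 * Num.sqrt L))); first by rewrite ler_wpM2l // (le_trans ler01).
have -> : Num.max M 1 * (2 * Num.sqrt L) = (2 * Num.max M 1) * Num.sqrt L by ring.
rewrite -[leRHS]sqr_sqrtr ?(ltW L0) // expr2 ler_wpM2r ?(ltW s0) //.
Unshelve. all: by end_near. Qed.

Lemma near_alpha_small (Ca : R) : 0 < Ca -> (\forall n \near \oo, alpha n * tau R n <= Ca) ->
  forall c : R, 0 < c -> \forall n \near \oo, alpha n <= c.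
Proof.
move=> Ca0 hA c c0; near=> n.
have h : alpha n * tau R n <= Ca by near: n.
have ht : Ca / c <= tau R n by near: n; exact: near_tau_ge.
have h2 : alpha n * (Ca / c) <= Ca.
  by apply: le_trans h; rewrite ler_wpM2l ?(alpha_ge0 halpha).
rewrite mulrA ler_pdivrMr // in h2.
by rewrite -(ler_pM2r Ca0) [c * _]mulrC.
Unshelve. all: by end_near. Qed.

(** The potential of a score over the horizon is bounded by one term of size e1
    and horizon terms of size e1 / horizon. Beyond the horizon a small multiple
    of alpha is left, which is negligible over times of order 1 / alpha. *)
Lemma slow_whp (Ca B e : R) : 0 < Ca -> 0 <= B -> 0 < e ->
  (\forall n \near \oo, alpha n * tau R n <= Ca) ->
  (forall M : R, \forall n \near \oo, M <= alpha n * n%:R * ln n%:R) ->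
  whp lam alpha (fun n (w : config m n) => forall t : nat, t%:R * alpha n <= B ->
    forall j x, `|iwalk (@full_dst m) w t (ind R j) x - rho m (alpha n) ^+ t * ind R j x| <= e).
Proof.
move=> Ca0 B0 e0 hA hM.
(* The estimates at the end add up to at most e1 (52 B + 72). *)
pose e1 := Num.min (1 / 8) (e / (52 * B + 72)).
have k0 : 0 < 52 * B + 72 by lra.
have e10 : 0 < e1 by rewrite lt_min !divr_gt0.
have e18 : e1 <= 1 / 8 by rewrite ge_min lexx.
have e1e : e1 * (52 * B + 72) <= e by rewrite -ler_pdivlMr // ge_min lexx orbT.
have e11 : e1 <= 1 by lra.
clearbody e1.
pose c := e1 * dl / (2 * lam).
have c0 : 0 < c by rewrite divr_gt0 // mulr_gt0.
have cE : c = e1 * dl / (2 * lam) by [].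
clearbody c.
have w1 := score_small_whp hm hlam halpha dlE dl0 e10 (near_alpha_small Ca0 hA).
have w2 := score_walk_small_whp hm hlam halpha dlE dl0 e10 Ca0 hA.
have w3 := functional_small_whp hm hlam halpha dlE dl0 c0 hM.
have q4 : 0 < 1 / 4 :> R by lra.
have w4 : whp lam alpha (@typical R m lam alpha dl (1 / 4)).
  by rewrite dlE; apply: typical_whp.
apply: (whp_near hm hlam halpha _ (whp_and hm hlam halpha w1 (whp_and hm hlam halpha w2 (whp_and hm hlam halpha w3 w4)))).
near=> n => w [h1 [h2 [h3 [hd _ _ hE]]]] t tB j x.
have L1 : 1 <= ln n%:R :> R by near: n; exact: near_ln_ge.
have lL1 : 1 <= ln (ln n%:R) :> R by near: n; exact: near_lnln_ge.
have n1 : 1 <= n%:R :> R by near: n; exact: near_nat_ge.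
have nm : m%:R / e1 <= n%:R :> R by near: n; exact: near_nat_ge.
have a1 : 1 <= alpha n * n%:R * ln n%:R by near: n; exact: hM.
have [p0 p1] : 0 <= edge_prob lam n /\ edge_prob lam n <= 1 by near: n; exact: near_edge_prob.
have L0 : 0 < ln n%:R :> R := lt_le_trans ltr01 L1.
have lL0 : 0 < ln (ln n%:R) :> R := lt_le_trans ltr01 lL1.
have n0 : 0 < n%:R :> R := lt_le_trans ltr01 n1.
have D0 : 0 < dl * ln n%:R by rewrite mulr_gt0.
have [ap ah] := halpha n.
have d0 u : (0 < degr w u)%N by rewrite -(ltr_nat R); apply: lt_le_trans (hd u).
have r0 : 0 <= rate (1 / 4) n :> R by rewrite powR_ge0.
set L := ln n%:R in L0 L1 lL0 lL1 hd D0 a1 *.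
have Ln : L <= n%:R.
  have := @le_ln1Dx R (n%:R - 1); rewrite addrCA subrr addr0 => h.
  by apply: le_trans (h _) _; move: n0; lra.
have sums (o : option 'I_m) v : `|\sum_(k < horizon R n) iwalk (@base_dst m) w k (score_avg w (score (alpha n) o)) v| <= 2 * e1.
  rewrite /horizon big_ord_recl -/(horizon R n); apply: le_trans (ler_normD _ _) _.
  apply: (@le_trans _ _ (e1 + e1)); last by lra.
  apply: lerD; first exact: h1.
  apply: le_trans (ler_norm_sum _ _ _) _.
  apply: (@le_trans _ _ (\sum_(i < Num.truncn (16 * tau R n)) e1 / (horizon R n)%:R)).
    apply: ler_sum => i _; rewrite [nat_of_ord _]/= iwalkS; apply: iwalk_abs; last by move=> v'; apply: h2.
    by rewrite divr_ge0 // ltW.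
  rewrite sumr_const card_ord -[leLHS]mulr_natl mulrCA ler_piMr ?(ltW e10) //.
  by rewrite ler_pdivrMr ?ltr0n // mul1r ler_nat.
have far (o : option 'I_m) v : `|iwalk (@base_dst m) w (horizon R n) (score_avg w (score (alpha n) o)) v| <= 2 * e1 * alpha n.
  have := @iwalk_expand R m n (@base_dst m) (edge_prob lam n) (@base_mean R m) w (rate (1 / 4) n)
    (fun l => lam / dl * (c * alpha n * 2^-1 ^+ l)) (horizon R n) (score_avg w (score (alpha n) o)) v r0 hE.
  move=> h; apply: le_trans (h _) _.
    move=> l v' hl; rewrite /edrift /drift normrM ger0_norm ?invr_ge0 //.
    rewrite (bigD1 v'.1) //= /base_mean eqxx mul1r [X in _ + X]big1 ?addr0 => [|i /negbTE hi]; last by rewrite eq_sym hi mul0r.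
    rewrite normrM (ger0_norm p0).
    apply: (@le_trans _ _ ((dl * L)^-1 * (edge_prob lam n * (c * alpha n * n%:R * 2^-1 ^+ l)))).
      apply: ler_pM.
      - by rewrite invr_ge0.
      - by rewrite mulr_ge0.
      - by rewrite lef_pV2 ?posrE ?ltr0n.
      - by rewrite ler_wpM2l //; apply: h3.
    rewrite /edge_prob -/L le_eqVlt; apply/orP; left; apply/eqP; field.
    by rewrite !gt_eqF.
  have s1 : \sum_(l < horizon R n) lam / dl * (c * alpha n * 2^-1 ^+ l) <= e1 * alpha n.
    under eq_bigr do rewrite mulrA.
    rewrite -mulr_sumr; apply: (@le_trans _ _ (lam / dl * (c * alpha n) * 2)).
      have k1 : 0 <= lam / dl * (c * alpha n).
        by apply: mulr_ge0; [apply: divr_ge0|apply: mulr_ge0]; apply: ltW.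
      by rewrite ler_wpM2l // sum_half.
    rewrite cE le_eqVlt; apply/orP; left; apply/eqP; field.
    by rewrite !gt_eqF.
  have s2 : rate (1 / 4) n ^+ horizon R n * l2 (score_avg w (score (alpha n) o)) <= e1 * alpha n.
    have l2le : l2 (score_avg w (score (alpha n) o)) <= Num.sqrt (m * n)%:R.
      by apply: bounded_l2 => v'; exact: le_trans (h1 o v') e11.
    have smn : Num.sqrt (m * n)%:R <= (m * n)%:R :> R.
      have mn1 : 1 <= (m * n)%:R :> R.
        by rewrite ler1n muln_gt0 ltnW //= -(ltr_nat R).
      rewrite -(ler_pXn2r (n := 2)) ?nnegrE ?sqrtr_ge0 // sqr_sqrtr // expr2.
      by rewrite ler_peMr.
    have rE : rate (1 / 4) n ^+ horizon R n <= n%:R ^- 4 :> R.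
      have -> : n%:R ^- 4 = expR (- (4 * L)) :> R by rewrite expRN expRM_natl lnK // posrE.
      rewrite /rate -/L /powR gt_eqF // -expRM_natl ler_expR.
      have h16 : 16 * tau R n <= (horizon R n)%:R by apply: ltW; apply: truncnS_gt.
      have h17 : 16 * L <= (horizon R n)%:R * ln L.
        by rewrite -ler_pdivrMr // -mulrA.
      exact: rate_exponent h17.
    apply: (@le_trans _ _ (n%:R ^- 4 * (m * n)%:R)).
      by apply: ler_pM; rewrite ?exprn_ge0 ?l2_ge0 // (le_trans l2le).
    have -> : n%:R ^- 4 * (m * n)%:R = (m%:R / n%:R) * n%:R ^- 2 :> R by rewrite natrM; field; rewrite gt_eqF.
    have an : n%:R ^- 2 <= alpha n.
      rewrite -[leLHS]mul1r ler_pdivrMr ?exprn_gt0 //; apply: le_trans a1 _.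
      by rewrite -mulrA expr2 ler_wpM2l ?(ltW ap) // ler_wpM2l // ltW.
    apply: ler_pM => //.
    by rewrite ler_pdivrMr // mulrC -ler_pdivrMr.
  have -> : 2 * e1 * alpha n = e1 * alpha n + e1 * alpha n by ring.
  exact: lerD.
have e14 : 2 * e1 <= 1 / 4 by lra.
have h2e1 : 0 <= 2 * e1 by lra.
have z0 : 0 <= 2 * e1 * alpha n by rewrite mulr_ge0 // ltW.
have := @ind_dev_slow R m n hm w d0 (alpha n) (ltW ap) ah (horizon R n) (2 * e1) (2 * e1 * alpha n) t x
  h2e1 e14 z0 (sums None) (far None) (fun j => sums (Some j)) (fun j => far (Some j)) j.
move=> h; apply: le_trans h _.
have tz : t%:R * (2 * e1 * alpha n) <= 2 * e1 * B.
  have -> : t%:R * (2 * e1 * alpha n) = 2 * e1 * (t%:R * alpha n) by ring.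
  by rewrite ler_wpM2l.
have b3 : t%:R * alpha n + t%:R * (2 * e1 * alpha n) + 2 * (2 * e1) <= B + B + 1.
  have : 2 * e1 * B <= 1 * B by rewrite ler_wpM2r //; lra.
  lra.
have b4 : 4 * (2 * e1) * (t%:R * alpha n + t%:R * (2 * e1 * alpha n) + 2 * (2 * e1)) <= 8 * e1 * (B + B + 1).
  have -> : 4 * (2 * e1) = 8 * e1 by ring.
  by rewrite ler_wpM2l // mulr_ge0 // (ltW e10).
apply: le_trans e1e.
have e1B : 0 <= e1 * B by rewrite mulr_ge0 // ltW.
move: tz b4 e1B; lra.
Unshelve. all: by end_near. Qed.

(** From time T1 on, the expansion of the walk applied to a score has three
    parts, each at most a small multiple of alpha: the noise part by
    rate_pow_small, the first drift term by the estimate on community sums, the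
    other drift terms by the norm of the score. *)
Lemma fast_whp (eta e : R) : 0 < eta -> 0 < e ->
  (forall M : R, \forall n \near \oo, M <= alpha n * tau R n) ->
  whp lam alpha (fun n (w : config m n) => forall T1 t : nat, (1 + eta) * tau R n <= T1%:R ->
    forall j x, `|iwalk (@full_dst m) w (T1 + t) (ind R j) x| <= rho m (alpha n) ^+ t + e).
Proof.
move=> et0 e0 hA.
have s0 := slack_gt0 et0; have s4 := slack_lt et0.
pose Km := lam * m%:R / dl.
have m0 : 0 < m%:R :> R by rewrite ltr0n ltnW.
have Km0 : 0 < Km by rewrite divr_gt0 // mulr_gt0.
have KmE : Km = lam * m%:R / dl by [].
clearbody Km.
pose c := e / (3 * Km).
have c0 : 0 < c by rewrite divr_gt0 // mulr_gt0.
have cE : Km * c = e / 3 by rewrite /c; field; rewrite gt_eqF.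
clearbody c.
have e3 : 0 < e / 3 by rewrite divr_gt0.
have hM (M : R) : \forall n \near \oo, M <= alpha n * n%:R * ln n%:R.
  near=> n.
  have L1 : 1 <= ln n%:R :> R by near: n; exact: near_ln_ge.
  have lL1 : 1 <= ln (ln n%:R) :> R by near: n; exact: near_lnln_ge.
  have n1 : 1 <= n%:R :> R by near: n; exact: near_nat_ge.
  have h : M <= alpha n * tau R n by near: n; exact: hA.
  have [ap _] := halpha n.
  have L0 : 0 < ln n%:R :> R := lt_le_trans ltr01 L1.
  have lL0 : 0 < ln (ln n%:R) :> R := lt_le_trans ltr01 lL1.
  apply: le_trans h _; rewrite -mulrA ler_wpM2l ?(ltW ap) //.
  apply: (@le_trans _ _ (1 * ln n%:R)); last by rewrite ler_wpM2r ?(ltW L0).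
  by rewrite mul1r /tau ler_pdivrMr // ler_peMr ?(ltW L0).
have w1 := functional_small_whp hm hlam halpha dlE dl0 c0 hM.
have w2 : whp lam alpha (fun n (w : config m n) => forall j : 'I_m,
    l2 (score_avg w (score (alpha n) (Some j))) ^+ 2 <= alpha n * (m * n)%:R / (dl * ln n%:R) / rate (1 / 4) n).
  by apply: (whp_forall hm hlam halpha) => j; apply: score_l2_whp.
have w3 : whp lam alpha (@typical R m lam alpha dl (slack eta)).
  by rewrite dlE; apply: typical_whp.
apply: (whp_near hm hlam halpha _ (whp_and hm hlam halpha w1 (whp_and hm hlam halpha w2 w3))).
near=> n => w [h1 [h2 [hd _ hE _]]] T1 t hT1 j x.
have L1 : 1 <= ln n%:R :> R by near: n; exact: near_ln_ge.
have lL1 : 1 <= ln (ln n%:R) :> R by near: n; exact: near_lnln_ge.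
have n1 : 1 <= n%:R :> R by near: n; exact: near_nat_ge.
have a1 : 1 <= alpha n * tau R n by near: n; exact: hA.
have [p0 p1] : 0 <= edge_prob lam n /\ edge_prob lam n <= 1 by near: n; exact: near_edge_prob.
have hr : rate (slack eta) n <= 1 / 2 :> R by near: n; apply: near_rate_le; have := s4; lra.
have hr2 : rate (slack eta) n <= (e / (6 * Km)) ^+ 2 * dl / m%:R :> R.
  near: n; apply: near_rate_le; first by have := s4; lra.
  by rewrite divr_gt0 // mulr_gt0 // exprn_gt0 // divr_gt0 // mulr_gt0.
have hp : forall t : nat, (1 + eta) * tau R n <= t%:R ->
    rate (slack eta) n ^+ t * Num.sqrt (m * n)%:R * ln n%:R <= e / 3.
  by near: n; apply: rate_pow_small.
have L0 : 0 < ln n%:R :> R := lt_le_trans ltr01 L1.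
have lL0 : 0 < ln (ln n%:R) :> R := lt_le_trans ltr01 lL1.
have n0 : 0 < n%:R :> R := lt_le_trans ltr01 n1.
have D0 : 0 < dl * ln n%:R by rewrite mulr_gt0.
have [ap ah] := halpha n.
have d0 u : (0 < degr w u)%N by rewrite -(ltr_nat R); apply: lt_le_trans (hd u).
have r0 : 0 <= rate (slack eta) n :> R by rewrite powR_ge0.
have rq : rate (slack eta) n <= rate (1 / 4) n :> R.
  by rewrite /rate ler_powR //; have := s4; lra.
have q0 : 0 < rate (1 / 4) n :> R by rewrite powR_gt0.
set r := rate (slack eta) n in hr hr2 hp r0 hE rq.
set q := rate (1 / 4) n in rq q0 h2.
set L := ln n%:R in L0 L1 hd D0 h2 hp *.
have aL : 1 <= alpha n * L.
  apply: le_trans a1 _; rewrite ler_wpM2l ?(ltW ap) //.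
  by rewrite /tau ler_pdivrMr // ler_peMr ?(ltW L0).
have mn0 : 0 <= (m * n)%:R :> R by [].
have key (j' : 'I_m) k : (T1 <= k)%N ->
    `|iwalk (@full_dst m) w k (score_avg w (score (alpha n) (Some j'))) x| <= e * alpha n.
  pose g := score_avg w (score (alpha n) (Some j')).
  rewrite -/g.
have g1 : l2 g <= Num.sqrt (m * n)%:R.
  apply: bounded_l2 => v; rewrite /g /score_avg normrM ger0_norm ?invr_ge0 //.
  rewrite ler_pdivrMl ?ltr0n // mulr1; apply: le_trans (ler_norm_sum _ _ _) _.
  rewrite /degr natr_sum; apply: ler_sum => y _; rewrite normrM ger0_norm //.
  have [hs _ _] := score_is_score hm p0 p1 (ltW ap) ah (Some j') v.1.
  exact: (ler_piMr _ (hs _)).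
have g2 : l2 g ^+ 2 <= alpha n * (m * n)%:R / (dl * L) / q := h2 j'.
move=> hk.
  have hk' : (1 + eta) * tau R n <= k%:R by apply: le_trans hT1 _; rewrite ler_nat.
  (* For l = 0 the drift of the score is bounded through its community sums, for
     l > 0 through the norm of its image under the noise. *)
  have := @iwalk_expand R m n (@full_dst m) (edge_prob lam n) (@full_mean R m alpha n) w r
    (fun l => (l == 0)%N%:R * (e / 3 * alpha n) + (if (l == 0)%N then 0 else (edge_prob lam n / (dl * L) * Num.sqrt (m * n)%:R * l2 g) * r ^+ l)) k g x r0 hE.
  have C0 : 0 <= edge_prob lam n / (dl * L) * Num.sqrt (m * n)%:R * l2 g.
    by apply: mulr_ge0; [apply: mulr_ge0; [apply: divr_ge0 => //; apply: ltW|exact: sqrtr_ge0]|exact: l2_ge0].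
  move=> h; apply: le_trans (h _) _.
    move=> l v _; case: (posnP l) => [->|l0].
      rewrite (_ : (nat_of_bool true)%:R = 1 :> R) // mul1r addr0 /= /edrift /drift.
      rewrite normrM ger0_norm ?invr_ge0 // normrM (ger0_norm p0).
      apply: (@le_trans _ _ ((dl * L)^-1 * (edge_prob lam n * \sum_(i < m) (c * alpha n * n%:R)))).
        apply: ler_pM.
        - by rewrite invr_ge0.
        - by rewrite mulr_ge0.
        - by rewrite lef_pV2 ?posrE ?ltr0n.
        rewrite ler_wpM2l //; apply: le_trans (ler_norm_sum _ _ _) _; apply: ler_sum => i _.
        have /andP[k0 k1] := full_mean_01 hm halpha n v.1 i.
        rewrite normrM (ger0_norm k0); apply: le_trans (ler_piMl _ k1) _ => //.
        have := h1 (Some j') i 0%N (ltn0Sn _); rewrite expr0 mulr1; exact.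
      rewrite sumr_const card_ord -[_ *+ m]mulr_natl /edge_prob -/L -cE KmE le_eqVlt; apply/orP; left; apply/eqP; field.
      by rewrite !gt_eqF.
    rewrite mul0r add0r.
    apply: le_trans (edrift_abs (iter l (enoise (@full_dst m) (edge_prob lam n) (@full_mean R m alpha n) w) g) v
     D0 p0 (full_mean_01 hm halpha n) hd) _.
    rewrite -[leRHS]mulrA ler_wpM2l //.
      by apply: mulr_ge0; [apply: divr_ge0 => //; apply: ltW|exact: sqrtr_ge0].
    by rewrite [l2 g * _]mulrC; apply: iter_enoise_l2.
  have x1 : r ^+ k * l2 g <= e / 3 * alpha n.
    apply: (@le_trans _ _ (r ^+ k * Num.sqrt (m * n)%:R)); first by rewrite ler_wpM2l ?exprn_ge0.
    have h3 := hp k hk'.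
    rewrite -ler_pdivrMr //; apply: le_trans h3; rewrite ler_wpM2l //.
      by rewrite mulr_ge0 ?sqrtr_ge0 ?exprn_ge0.
    by rewrite -[leLHS]mul1r ler_pdivrMr // mulrC.
  have x2 : \sum_(l < k) (l == 0 :> nat)%N%:R * (e / 3 * alpha n) <= e / 3 * alpha n.
    case: (k) => [|k']; first by rewrite big_ord0 mulr_ge0 // ltW.
    rewrite big_ord_recl /= mul1r big1 ?addr0 // => i _; by rewrite mul0r.
  have x3 : \sum_(l < k) (if (l == 0 :> nat)%N then 0 else (edge_prob lam n / (dl * L) * Num.sqrt (m * n)%:R * l2 g) * r ^+ l) <= e / 3 * alpha n.
    apply: le_trans (sum_geom_tail k r0 hr C0) _.
    have k1 : 0 <= e / 3 * alpha n by rewrite mulr_ge0 // ltW.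
    have k2 : 0 <= 2 * (edge_prob lam n / (dl * L) * Num.sqrt (m * n)%:R * l2 g) * r.
      by rewrite mulr_ge0 // mulr_ge0.
    rewrite -(ler_pXn2r (n := 2)) ?nnegrE //.
    have -> : (2 * (edge_prob lam n / (dl * L) * Num.sqrt (m * n)%:R * l2 g) * r) ^+ 2 =
       4 * (edge_prob lam n / (dl * L)) ^+ 2 * Num.sqrt (m * n)%:R ^+ 2 * r ^+ 2 * l2 g ^+ 2 by ring.
    rewrite sqr_sqrtr //.
    apply: (@le_trans _ _ (4 * (edge_prob lam n / (dl * L)) ^+ 2 * (m * n)%:R * r ^+ 2 * (alpha n * (m * n)%:R / (dl * L) / q))).
      have kk : 0 <= 4 * (edge_prob lam n / (dl * L)) ^+ 2 * (m * n)%:R * r ^+ 2.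
        apply: mulr_ge0; last exact: sqr_ge0.
        by apply: mulr_ge0 => //; apply: mulr_ge0 => //; exact: sqr_ge0.
      by rewrite ler_wpM2l.
    have -> : 4 * (edge_prob lam n / (dl * L)) ^+ 2 * (m * n)%:R * r ^+ 2 * (alpha n * (m * n)%:R / (dl * L) / q) =
       4 * Km ^+ 2 * (alpha n / (dl * L)) * (r * (r / q)).
      rewrite /edge_prob -/L KmE natrM; field.
      by rewrite !gt_eqF.
    have kK : 0 <= 4 * Km ^+ 2 * (alpha n / (dl * L)).
      apply: mulr_ge0; last by apply: divr_ge0; apply: ltW.
      by apply: mulr_ge0 => //; exact: sqr_ge0.
    apply: (@le_trans _ _ (4 * Km ^+ 2 * (alpha n / (dl * L)) * (r * 1))).
      by rewrite ler_wpM2l // ler_wpM2l // ler_pdivrMr // mul1r.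
    rewrite mulr1.
    apply: (@le_trans _ _ (4 * Km ^+ 2 * (alpha n / (dl * L)) * ((e / (6 * Km)) ^+ 2 * dl / m%:R))).
      by rewrite ler_wpM2l.
    have -> : 4 * Km ^+ 2 * (alpha n / (dl * L)) * ((e / (6 * Km)) ^+ 2 * dl / m%:R) = (e / 3) ^+ 2 * alpha n / (L * m%:R).
      by field; rewrite !gt_eqF.
    have -> : (e / 3 * alpha n) ^+ 2 = (e / 3) ^+ 2 * alpha n * alpha n by ring.
    have kk2 : 0 <= (e / 3) ^+ 2 * alpha n by apply: mulr_ge0; [exact: sqr_ge0|exact: ltW].
    rewrite ler_wpM2l // invfM; apply: (@le_trans _ _ (L^-1 * 1)).
      by rewrite ler_wpM2l ?invr_ge0 ?(ltW L0) // invf_le1 // ler1n ltnW.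
    by rewrite mulr1 -[leLHS]mul1r ler_pdivrMr.
  rewrite big_split /=.
  have -> : e * alpha n = e / 3 * alpha n + (e / 3 * alpha n + e / 3 * alpha n) by field.
  by apply: lerD => //; apply: lerD.
have xi0 : 0 <= e * alpha n by rewrite mulr_ge0 // ltW.
have := @ind_dev_fast R m n hm w d0 (alpha n) (ltW ap) ah T1 t (e * alpha n) x ap xi0 key j.
by rewrite mulfK ?gt_eqF.
Unshelve. all: by end_near. Qed.

End CommunityMixing.

(** * The entropic time *)

Section Entropy.
Variables (R : realType) (m : nat) (hm : (1 < m)%N).
Variables (lam : R) (hlam : 1 < lam) (alpha : nat -> R).
Hypothesis halpha : forall n, 0 < alpha n /\ alpha n <= 1 / 2.
Let lam0 : 0 < lam := lt_trans ltr01 hlam.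

Lemma entropy_expect n (x : vertex m n) :
  entropy m n (edge_prob lam n) (alpha n) =
  expect (@config_weight R m n (edge_prob lam n) (alpha n)) (fun w => ln (maxn (degr w x) 1)%:R).
Proof.
rewrite (entropyE _ _ x) /entropy_at dbm_meanE; apply: eq_bigr => w _.
by rewrite outdeg_graph_of.
Qed.

(** A concavity bound, to be averaged over the degree with a of order ln n. *)
Lemma ln_le_tangent (a y : R) : 0 < a -> 0 < y -> ln y <= ln a + y / a.
Proof.
move=> a0 y0; have h : 0 < y / a by rewrite divr_gt0.
have -> : ln y = ln a + ln (y / a) by rewrite -lnM ?posrE // mulrCA divff ?gt_eqF // mulr1.
rewrite lerD2l; have := @le_ln1Dx R (y / a - 1); rewrite addrCA subrr addr0 => h'.
by apply: le_trans (h' _) _; move: h; lra.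
Qed.

Lemma near_entropy_upper (eta : R) : 0 < eta ->
  \forall n \near \oo, entropy m n (edge_prob lam n) (alpha n) <= (1 + eta) * ln (ln n%:R).
Proof.
move=> e0; pose C := expR (lam * (1 + expR 1)) + 1.
near=> n.
have hl : is_law (@config_weight R m n (edge_prob lam n) (alpha n)) by near: n; exact: near_law.
have [p0 p1] : 0 <= edge_prob lam n /\ edge_prob lam n <= 1 by near: n; exact: near_edge_prob.
have L1 : 1 <= ln n%:R :> R by near: n; exact: near_ln_ge.
have lL1 : C / eta <= ln (ln n%:R) :> R by near: n; exact: near_lnln_ge.
have n1 : 1 <= n%:R :> R by near: n; exact: near_nat_ge.
have n0 : 0 < n%:R :> R := lt_le_trans ltr01 n1.
have L0 : 0 < ln n%:R :> R := lt_le_trans ltr01 L1.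
set L := ln n%:R in L0 L1 lL1 *.
have hn : (0 < n)%N by rewrite -(ltr_nat R).
pose i : 'I_m := Ordinal (ltnW hm); pose z : 'I_n := Ordinal hn.
rewrite (@entropy_expect n (i, z)).
pose X (w : config m n) x y := block_hit (@base_dst m) i i (w (i, x, y)).
have hX : subpoisson (@config_weight R m n (edge_prob lam n) (alpha n)) X (edge_prob lam n * base_mean R i i).
  by rewrite -(block_hit_base hm lam alpha); apply: config_subpoisson; rewrite ?(alpha_ge0 halpha) ?(alpha_le1 halpha).
have hmgf := edges_mgf hX (fun x' _ => x' == z) L^-1.
rewrite row_area /base_mean eqxx mulr1 in hmgf.
have step : expect (@config_weight R m n (edge_prob lam n) (alpha n)) (fun w => ln (maxn (degr w (i, z)) 1)%:R) <=
   expect (@config_weight R m n (edge_prob lam n) (alpha n)) (fun w => (ln L + 1) + expR (L^-1 * edges R X (fun x' _ => x' == z) w)).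
  apply: ler_expect => // w.
  have dE := degr_base_row R w i z.
  have rE : \sum_y (block_hit (@base_dst m) i i (w (i, z, y)))%:R = edges R X (fun x' _ => x' == z) w.
    by rewrite -row_edges.
  rewrite rE in dE.
  set S := edges _ _ _ _ in dE *.
  have m1 : 0 < (maxn (degr w (i, z)) 1)%:R :> R by rewrite ltr0n leq_max ltnSn orbT.
  apply: le_trans (ln_le_tangent L0 m1) _; rewrite -addrA lerD2l.
  have mle : (maxn (degr w (i, z)) 1)%:R <= (degr w (i, z))%:R + 1 :> R.
    by rewrite natr1 ler_nat geq_max leqnSn.
  apply: (@le_trans _ _ ((S + 1) / L)).
    by rewrite ler_wpM2r ?invr_ge0 ?(ltW L0) //; apply: le_trans mle _; rewrite lerD2r.
  have -> : (S + 1) / L = L^-1 + L^-1 * S by ring.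
  apply: lerD; first by rewrite invf_le1.
  by apply: le_trans (expR_ge1Dx _); rewrite lerDr.
apply: le_trans step _.
have -> : expect (@config_weight R m n (edge_prob lam n) (alpha n)) (fun w => (ln L + 1) + expR (L^-1 * edges R X (fun x' _ => x' == z) w)) =
   (ln L + 1) + expect (@config_weight R m n (edge_prob lam n) (alpha n)) (fun w => expR (L^-1 * edges R X (fun x' _ => x' == z) w)).
  rewrite /expect; under eq_bigr do rewrite mulrDr.
  by rewrite big_split /= -mulr_suml (proj2 hl) mul1r.
have b1 : edge_prob lam n * (n%:R * (expR L^-1 - 1)) <= lam * (1 + expR 1).
  have i1 : `|L^-1| <= 1 by rewrite ger0_norm ?invr_ge0 ?(ltW L0) // invf_le1.
  have h := expR_quadB i1.
  have -> : edge_prob lam n * (n%:R * (expR L^-1 - 1)) = lam * (L * (expR L^-1 - 1)).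
    by rewrite /edge_prob -/L; field; rewrite gt_eqF.
  rewrite ler_wpM2l ?(ltW lam0) //.
  apply: le_trans (ler_wpM2l (ltW L0) h) _.
  have -> : L * (L^-1 + L^-1 ^+ 2 * expR 1) = 1 + L^-1 * expR 1 by field; rewrite gt_eqF.
  by rewrite lerD2l ler_piMl ?expR_ge0 // invf_le1.
have b2 : expect (@config_weight R m n (edge_prob lam n) (alpha n)) (fun w => expR (L^-1 * edges R X (fun x' _ => x' == z) w)) <= expR (lam * (1 + expR 1)).
  by apply: le_trans hmgf _; rewrite ler_expR.
rewrite ler_pdivrMr // mulrC in lL1.
apply: (@le_trans _ _ (ln L + C)); first by rewrite /C -addrA lerD2l addrC lerD2r.
by rewrite mulrDl mul1r lerD2l.
Unshelve. all: by end_near. Qed.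

Lemma near_entropy_lower (eta : R) : 0 < eta -> eta < 1 ->
  \forall n \near \oo, (1 - eta) * ln (ln n%:R) <= entropy m n (edge_prob lam n) (alpha n).
Proof.
move=> e0 e1.
have q4 : 0 < 1 / 4 :> R by lra.
have dc0 := degree_const_gt0 hlam.
pose dl := degree_const lam.
have ht := typical_whp hm hlam halpha q4.
have e2 : 0 < eta / 2 by rewrite divr_gt0.
near=> n.
have hl : is_law (@config_weight R m n (edge_prob lam n) (alpha n)) by near: n; exact: near_law.
have L1 : 1 <= ln n%:R :> R by near: n; exact: near_ln_ge.
have Ld : dl^-1 <= ln n%:R :> R by near: n; exact: near_ln_ge.
have lL1 : `|ln dl| / (eta / 2) <= ln (ln n%:R) :> R by near: n; exact: near_lnln_ge.
have n1 : 1 <= n%:R :> R by near: n; exact: near_nat_ge.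
have h1 : cfg_prob lam alpha (fun w => ~ @typical R m lam alpha dl (1 / 4) n w) <= eta / 2.
  by near: n; apply: ht.
have n0 : 0 < n%:R :> R := lt_le_trans ltr01 n1.
have L0 : 0 < ln n%:R :> R := lt_le_trans ltr01 L1.
set L := ln n%:R in L0 L1 lL1 Ld *.
have hn : (0 < n)%N by rewrite -(ltr_nat R).
pose i : 'I_m := Ordinal (ltnW hm); pose z : 'I_n := Ordinal hn.
rewrite (@entropy_expect n (i, z)).
have dL1 : 1 <= dl * L by rewrite -ler_pdivrMl // mulr1.
have ldL : 0 <= ln (dl * L) by rewrite ln_ge0.
have step : (1 - eta / 2) * ln (dl * L) <= expect (@config_weight R m n (edge_prob lam n) (alpha n)) (fun w => ln (maxn (degr w (i, z)) 1)%:R).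
  apply: (@le_trans _ _ (expect (@config_weight R m n (edge_prob lam n) (alpha n))
     (fun w => ln (dl * L) - ln (dl * L) * `[< ~ @typical R m lam alpha dl (1 / 4) n w >]%:R))).
    have -> : expect (@config_weight R m n (edge_prob lam n) (alpha n))
     (fun w => ln (dl * L) - ln (dl * L) * `[< ~ @typical R m lam alpha dl (1 / 4) n w >]%:R) =
     ln (dl * L) - ln (dl * L) * cfg_prob lam alpha (fun w => ~ @typical R m lam alpha dl (1 / 4) n w).
      rewrite /cfg_prob /prob mulr_sumr; set A := ln (dl * L).
      transitivity (\sum_(w : config m n) @config_weight R m n (edge_prob lam n) (alpha n) w * A -
        \sum_(w : config m n) A * (@config_weight R m n (edge_prob lam n) (alpha n) w * `[< ~ @typical R m lam alpha dl (1 / 4) n w >]%:R)).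
        by rewrite -sumrB; apply: eq_bigr => w _; rewrite mulrBr; congr (_ - _); rewrite mulrCA.
      by rewrite -mulr_suml (proj2 hl) mul1r.
    have h2 := ler_wpM2l ldL h1; lra.
  apply: ler_expect => // w; case: asboolP => hw.
    by rewrite mulr1 subrr ln_ge0 // ler1n leq_max ltnSn orbT.
  rewrite mulr0 subr0; move: hw => /contrapT[hd _ _ _].
  rewrite ler_ln ?posrE ?(lt_le_trans ltr01 dL1) // ?ltr0n ?leq_max ?ltnSn ?orbT //.
  by apply: le_trans (hd (i, z)) _; rewrite ler_nat leq_maxl.
apply: le_trans step.
rewrite lnM ?posrE // ler_pdivrMr // in lL1 *.
have h3 : - ln L * (eta / 2) <= ln dl.
  by rewrite mulNr lerNl; apply: le_trans lL1; rewrite -normrN ler_norm.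
have lnL0 : 0 <= ln L by rewrite ln_ge0.
have e3 : 0 <= 1 - eta / 2 by lra.
have h4 : (1 - eta / 2) * (ln L - ln L * (eta / 2)) <= (1 - eta / 2) * (ln dl + ln L).
  rewrite ler_wpM2l //; move: h3; rewrite mulNr; lra.
apply: le_trans h4.
have -> : (1 - eta / 2) * (ln L - ln L * (eta / 2)) = (1 - eta) * ln L + (eta / 2) ^+ 2 * ln L by field.
by rewrite lerDl mulr_ge0 // sqr_ge0.
Unshelve. all: by end_near. Qed.

(** The entropic time, defined through the mean of the logarithm of the degree,
    is asymptotic to tau because the degrees are concentrated on the scale ln
    n. *)
Lemma near_t_ent (eta : R) : 0 < eta ->
  \forall n \near \oo, (1 - eta) * tau R n <= t_ent m lam alpha n /\ t_ent m lam alpha n <= (1 + eta) * tau R n.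
Proof.
move=> e0.
pose x := Num.min (1 / 2) (eta / 4).
have e1 : 0 < x by rewrite lt_min !divr_gt0.
have x1 : x <= 1 / 2 by rewrite ge_min lexx.
have x2 : x <= eta / 4 by rewrite ge_min lexx orbT.
clearbody x.
have x3 : 0 < 1 - x by lra.
have x4 : x < 1 by lra.
near=> n.
have L1 : 1 <= ln n%:R :> R by near: n; exact: near_ln_ge.
have lL1 : 1 <= ln (ln n%:R) :> R by near: n; exact: near_lnln_ge.
have h1 : entropy m n (edge_prob lam n) (alpha n) <= (1 + eta) * ln (ln n%:R).
  by near: n; apply: near_entropy_upper.
have h2 : (1 - x) * ln (ln n%:R) <= entropy m n (edge_prob lam n) (alpha n).
  by near: n; apply: near_entropy_lower.
have L0 : 0 < ln n%:R :> R := lt_le_trans ltr01 L1.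
have lL0 : 0 < ln (ln n%:R) :> R := lt_le_trans ltr01 lL1.
rewrite /t_ent /tau.
set H := entropy _ _ _ _ in h1 h2 *; set L := ln n%:R in L0 L1 lL0 lL1 h1 h2 *.
have H0 : 0 < H by apply: lt_le_trans h2; rewrite mulr_gt0.
split.
  rewrite mulrA ler_pdivrMr // mulrAC ler_pdivlMr //.
  have h3 : (1 - eta) * H <= ln L.
    have [en|en] := leP eta 1.
      have h4 : (1 - eta) * H <= (1 - eta) * ((1 + eta) * ln L) by rewrite ler_wpM2l // subr_ge0.
      apply: le_trans h4 _.
      have -> : (1 - eta) * ((1 + eta) * ln L) = ln L - eta ^+ 2 * ln L by ring.
      by rewrite gerBl mulr_ge0 ?sqr_ge0 // ltW.
    apply: le_trans (ltW lL0); rewrite mulr_le0_ge0 ?(ltW H0) //; lra.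
  by rewrite mulrAC mulrC ler_wpM2l // ltW.
rewrite mulrA ler_pdivrMr // mulrAC ler_pdivlMr // [(1 + eta) * L]mulrC -mulrA ler_wpM2l ?(ltW L0) //.
apply: (@le_trans _ _ ((1 + eta) * ((1 - x) * ln L))); last by rewrite ler_wpM2l // addr_ge0 // ltW.
rewrite mulrA ler_peMl ?(ltW lL0) //.
have : eta * x <= eta * (1 / 2) by rewrite ler_wpM2l // ltW.
lra.
Unshelve. all: by end_near. Qed.

End Entropy.

(** * From operator estimates to total variation *)

Section TotalVariation.
Variables (R : realType) (m : nat) (hm : (1 < m)%N).
Variables (lam : R) (hlam : 1 < lam) (alpha : nat -> R).
Hypothesis halpha : forall n, 0 < alpha n /\ alpha n <= 1 / 2.
Let lam0 : 0 < lam := lt_trans ltr01 hlam.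
Let m0 : (0 < m)%N := ltnW hm.

Lemma cvg_in_pr0_of_whp (t : nat -> nat) (l : R) :
  (forall e : R, 0 < e -> whp lam alpha (fun n (w : config m n) => forall x, `|tv_to_stat R (graph_of w) x (t n) - l| <= e)) ->
  cvg_in_pr0 (edge_prob lam) alpha (fun n (G : digraph m n) => max_tv_gap G (t n) l).
Proof.
move=> h eps e0.
have gapE n : dbm_pr (edge_prob lam n) (alpha n) (fun G : digraph m n => eps < `|max_tv_gap G (t n) l|) =
   cfg_prob lam alpha (fun w : config m n => eps < `|max_tv_gap (graph_of w) (t n) l|).
  transitivity (dbm_mean (edge_prob lam n) (alpha n) (fun G : digraph m n => (eps < `|max_tv_gap G (t n) l|)%R%:R)).
    rewrite /dbm_pr /dbm_mean big_mkcond; apply: eq_bigr => G _.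
    by case: ifP; rewrite ?mulr1 ?mulr0.
  by rewrite dbm_meanE; apply: eq_bigr => w _; rewrite asboolb.
apply/cvgrPdist_le => d d0; near=> n.
have hl : is_law (@config_weight R m n (edge_prob lam n) (alpha n)) by near: n; exact: near_law.
have hn : cfg_prob lam alpha (fun w : config m n => ~ forall x, `|tv_to_stat R (graph_of w) x (t n) - l| <= eps) <= d.
  by near: n; apply: h.
rewrite sub0r normrN gapE ger0_norm ?prob_ge0 //; apply: le_trans hn; apply: prob_le => // w hw hx.
move: hw; rewrite ltNge => /negP; apply.
rewrite ger0_norm.
  by apply: bigmax_le => [|x _]; [exact: ltW|exact: hx].
by rewrite /max_tv_gap; elim/big_rec: _ => // x y _ hy; rewrite le_max hy orbT.
Unshelve. all: by end_near. Qed.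

(** The law at time t n keeps the community of the starting point with weight a
    n and is spread evenly over the communities otherwise. *)
Definition memory (t : nat -> nat) (a : nat -> R) : Prop :=
  forall e : R, 0 < e -> whp lam alpha (fun n (w : config m n) =>
    forall j x, `|iwalk (@full_dst m) w (t n) (ind R j) x - a n * ind R j x| <= e).

(** Late enough for the walk to mix inside the communities. *)
Definition late (t : nat -> nat) : Prop :=
  exists2 eta : R, 0 < eta & \forall n \near \oo, (1 + eta) * tau R n <= (t n)%:R.

Lemma typical_pos : whp lam alpha (fun n (w : config m n) => forall u, (0 < degr w u)%N).
Proof.
have dc0 := degree_const_gt0 hlam.
apply: (whp_near hm hlam halpha _ (degree_whp hm hlam halpha)); near=> n => w hd u.
have L1 : 1 <= ln n%:R :> R by near: n; exact: near_ln_ge.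
rewrite -(ltr_nat R); apply: lt_le_trans (hd u); rewrite mulr_gt0 //.
exact: lt_le_trans ltr01 L1.
Unshelve. all: by end_near. Qed.

Lemma tv_memory_whp t a : memory t a -> late t -> forall e : R, 0 < e ->
  whp lam alpha (fun n (w : config m n) => forall x,
    tv_dist (srw_law (graph_of w) (point_mass R x) (t n)) (community_law (a n) x) <= e).
Proof.
move=> hM [eta et0 hlate] e e0.
have mp : 0 < m%:R + 1 :> R by [].
have e1 : 0 < e / (m%:R + 1) by rewrite divr_gt0.
have w1 := hM _ e1.
have w2 := mix_inside_whp hm hlam halpha (erefl _) (degree_const_gt0 hlam) et0 e1.
apply: (whp_near hm hlam halpha _ (whp_and hm hlam halpha typical_pos (whp_and hm hlam halpha w1 w2))).
near=> n => w [h0 [h1 h2]] x.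
have ht : (1 + eta) * tau R n <= (t n)%:R by near: n.
have -> : e = e / (m%:R + 1) + m%:R * (e / (m%:R + 1)) by field; rewrite gt_eqF.
by apply: tv_community => // f f1 fs; apply: h2.
Unshelve. all: by end_near. Qed.

Definition stat_uniform : Prop := forall e : R, 0 < e ->
  whp lam alpha (fun n (w : config m n) => tv_dist (stat_law R (graph_of w)) (uniform_law R m n) <= e).

Lemma mscale : 0 <= (m%:R - 1) / m%:R :> R /\ (m%:R - 1) / m%:R <= 1 :> R.
Proof.
have mp : 0 < m%:R :> R by rewrite ltr0n.
by split; [rewrite divr_ge0 // subr_ge0 ler1n|rewrite ler_pdivrMr // mul1r gerBl].
Qed.

(** At a late time at which the memory is at most e, all starting points give
    nearly the uniform law. *)
Lemma stat_uniform_of : (forall e : R, 0 < e -> exists t a, [/\ memory t a, late t,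
     forall n, 0 <= a n & \forall n \near \oo, a n <= e]) -> stat_uniform.
Proof.
move=> h e e0.
have e2 : 0 < e / 2 by rewrite divr_gt0.
have [t [a [hM hl a0 ha]]] := h _ e2.
apply: (whp_near hm hlam halpha _ (whp_and hm hlam halpha typical_pos (tv_memory_whp hM hl e2))).
near=> n => w [h0 h1].
have han : a n <= e / 2 by near: n.
apply: (@stat_law_close _ _ _ w (t n)) => // [|x]; first exact: ltW.
apply: le_trans (tv_dist_triangle _ _ (community_law (a n) x)) _.
rewrite (community_law_tv x (a0 n) m0).
have [s0 s1] := mscale; have := h1 x; have := a0 n => p1 p2.
have p3 : (m%:R - 1) / m%:R * a n <= a n by rewrite ler_piMl.
lra.
Unshelve. all: by end_near. Qed.

Lemma tv_limit_whp t a (l : R) : memory t a -> late t -> (forall n, 0 <= a n) ->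
  (a n @[n --> \oo] --> l) -> stat_uniform -> forall e : R, 0 < e ->
  whp lam alpha (fun n (w : config m n) => forall x, `|tv_to_stat R (graph_of w) x (t n) - (m%:R - 1) / m%:R * l| <= e).
Proof.
move=> hM hl a0 ha hs e e0.
have e3 : 0 < e / 3 by rewrite divr_gt0.
have /cvgrPdist_le ha' := ha.
apply: (whp_near hm hlam halpha _ (whp_and hm hlam halpha (hs _ e3) (tv_memory_whp hM hl e3))).
near=> n => w [h0 h1] x.
have han : `|l - a n| <= e / 3.
  by near: n; apply: ha'.
rewrite /tv_to_stat; set mu := srw_law _ _ _; set st := stat_law _ _ in h0 *; set U := uniform_law _ _ _ in h0 *.
have k1 := tv_dist_diff mu st U.
have k2 : `|tv_dist mu U - tv_dist (community_law (a n) x) U| <= e / 3.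
  rewrite tv_distC [tv_dist (community_law _ _) _]tv_distC.
  apply: le_trans (tv_dist_diff _ _ _) _; exact: h1.
rewrite (community_law_tv x (a0 n) m0) in k2.
have [s0 s1] := mscale.
have k3 : `|(m%:R - 1) / m%:R * a n - (m%:R - 1) / m%:R * l| <= e / 3.
  rewrite -mulrBr normrM (ger0_norm s0) distrC; apply: le_trans han.
  by rewrite ler_piMl.
have -> : tv_dist mu st - (m%:R - 1) / m%:R * l = (tv_dist mu st - tv_dist mu U) +
   ((tv_dist mu U - (m%:R - 1) / m%:R * a n) + ((m%:R - 1) / m%:R * a n - (m%:R - 1) / m%:R * l)) by ring.
apply: le_trans (ler_normD _ _) _.
have -> : e = e / 3 + (e / 3 + e / 3) by field.
apply: lerD; first exact: le_trans k1 h0.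
by apply: le_trans (ler_normD _ _) _; apply: lerD.
Unshelve. all: by end_near. Qed.

(** The walk can reach at most (C L)^t vertices, which is at most n^(1 - eta /
    2), and the stationary law is almost uniform. *)
Lemma tv_early_whp (t : nat -> nat) (eta : R) : 0 < eta -> eta < 1 ->
  (\forall n \near \oo, (t n)%:R <= (1 - eta) * tau R n) -> stat_uniform -> forall e : R, 0 < e ->
  whp lam alpha (fun n (w : config m n) => forall x, `|tv_to_stat R (graph_of w) x (t n) - 1| <= e).
Proof.
move=> et0 et1 ht hs e e0.
have e2 : 0 < e / 2 by rewrite divr_gt0.
have q4 : 0 < 1 / 4 :> R by lra.
have wt := typical_whp hm hlam halpha q4.
apply: (whp_near hm hlam halpha _ (whp_and hm hlam halpha typical_pos (whp_and hm hlam halpha (hs _ e2) wt))).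
(* The constant in the upper bound for the degrees of a typical configuration. *)
pose C := expR 1 * lam + 2.
have C1 : 1 <= C.
  have : 0 <= expR 1 * lam by rewrite mulr_ge0 ?expR_ge0 ?(ltW lam0).
  by rewrite /C; lra.
near=> n => w [h0 [h1 [_ hC _ _]]] x.
have htn : (t n)%:R <= (1 - eta) * tau R n by near: n.
have L1 : 1 <= ln n%:R :> R by near: n; exact: near_ln_ge.
have L2 : 2 / eta * (2 / e) <= ln n%:R :> R by near: n; exact: near_ln_ge.
have lL1 : 1 <= ln (ln n%:R) :> R by near: n; exact: near_lnln_ge.
have lL2 : 2 * ln C / eta <= ln (ln n%:R) :> R by near: n; exact: near_lnln_ge.
have n1 : 1 <= n%:R :> R by near: n; exact: near_nat_ge.
have n0 : 0 < n%:R :> R := lt_le_trans ltr01 n1.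
have L0 : 0 < ln n%:R :> R := lt_le_trans ltr01 L1.
have lL0 : 0 < ln (ln n%:R) :> R := lt_le_trans ltr01 lL1.
have hn : (0 < n)%N by rewrite -(ltr_nat R).
set L := ln n%:R in L0 L1 L2 lL0 lL1 lL2 hC.
have C0 : 0 < C := lt_le_trans ltr01 C1.
have CL0 : 0 < C * L by rewrite mulr_gt0.
pose De := Num.truncn (C * L).
have DeL : De%:R <= C * L by have /andP[] := truncn_itv (ltW CL0).
have hDe u : (degr w u <= De)%N.
  rewrite /De -ltnS -(ltr_nat R); apply: le_lt_trans (hC u) _.
  exact: truncnS_gt.
rewrite /tv_to_stat; set mu := srw_law _ _ _; set st := stat_law _ _ in h1 *; set U := uniform_law _ _ _ in h1 *.
have k1 := tv_dist_diff mu st U.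
have k2 : 1 - (De ^ t n)%:R / (m * n)%:R <= tv_dist mu U by apply: tv_lower.
have k3 : tv_dist mu U <= 1.
  apply: tv_dist_le => f f1.
  have -> : \sum_v (mu v - U v) * f v = iwalk (@full_dst m) w (t n) f x - \sum_v U v * f v.
    by under eq_bigr do rewrite mulrBl; rewrite sumrB point_mass_walk.
  have b1 : `|iwalk (@full_dst m) w (t n) f x| <= 1 by apply: iwalk_abs.
  have b2 : `|\sum_v U v * f v| <= 1.
    apply: le_trans (ler_norm_sum _ _ _) _; rewrite -[leRHS](uniform_sum1 R m0 hn).
    apply: ler_sum => v _; rewrite normrM ffunE ger0_norm ?invr_ge0 // ler_piMr ?invr_ge0 //.
  move: b1 b2; rewrite !ler_norml => /andP[_ b1] /andP[b2 _]; lra.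
have k4 : (De ^ t n)%:R / (m * n)%:R <= e / 2.
  have pw : (De ^ t n)%:R <= expR ((1 - eta / 2) * L).
    rewrite natrX; apply: (@le_trans _ _ ((C * L) ^+ t n)).
      by rewrite lerXn2r ?nnegrE // ltW.
    rewrite -[C * L]lnK ?posrE // -expRM_natl ler_expR lnM ?posrE //.
    have lC0 : 0 <= ln C by rewrite ln_ge0.
    apply: (@le_trans _ _ ((1 - eta) * tau R n * (ln C + ln L))).
      by rewrite ler_wpM2r // addr_ge0 // ltW.
    have ha : ln C <= eta / 2 * ln L.
      by move: lL2; rewrite ler_pdivrMr //; lra.
    have -> : (1 - eta) * tau R n * (ln C + ln L) = (1 - eta) * (L / ln L) * ln C + (1 - eta) * L.
      by rewrite /tau -/L; field; rewrite gt_eqF.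
    have hb : (1 - eta) * (L / ln L) * ln C <= 1 * (L / ln L) * (eta / 2 * ln L).
      apply: ler_pM => //.
        by rewrite mulr_ge0 ?divr_ge0 ?(ltW L0) ?(ltW lL0) // subr_ge0 ltW.
      by rewrite ler_wpM2r ?divr_ge0 ?(ltW L0) ?(ltW lL0) // gerBl ltW.
    have hc : 1 * (L / ln L) * (eta / 2 * ln L) = eta / 2 * L by field; rewrite gt_eqF.
    rewrite hc in hb; lra.
  have mn0 : 0 < (m * n)%:R :> R by rewrite ltr0n muln_gt0 m0.
  rewrite ler_pdivrMr //; apply: le_trans pw _.
  apply: (@le_trans _ _ (e / 2 * n%:R)); last by rewrite ler_wpM2l ?(ltW e2) // ler_nat leq_pmull.
  have -> : n%:R = expR L :> R by rewrite lnK.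
  have -> : expR L = expR ((1 - eta / 2) * L) * expR (eta / 2 * L) by rewrite -expRD; congr expR; ring.
  rewrite mulrCA ler_peMr ?expR_ge0 //.
  rewrite -ler_pdivrMl // mulr1 invf_div.
  apply: le_trans (expR_ge1Dx _).
  have : 2 / e <= eta / 2 * L.
    by rewrite -ler_pdivrMl ?divr_gt0 // invf_div.
  lra.
move: k1; rewrite ler_norml => /andP[k5 k6].
by rewrite ler_norml; apply/andP; split; lra.
Unshelve. all: by end_near. Qed.

End TotalVariation.

(** * The three regimes *)

Section Regimes.
Variables (R : realType) (m : nat) (hm : (1 < m)%N).
Variables (lam : R) (hlam : 1 < lam) (alpha : nat -> R).
Hypothesis halpha : forall n, 0 < alpha n /\ alpha n <= 1 / 2.
Let c : R := m%:R / (m%:R - 1).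
Let te := t_ent m lam alpha.

Lemma c_ge1 : 1 <= c.
Proof. by rewrite /c ler_pdivlMr ?m1_gt0 // mul1r gerBl. Qed.

Lemma rhoE n : rho m (alpha n) = 1 - alpha n * c.
Proof. by []. Qed.

Lemma near_cvg_le (u : nat -> R) (l M : R) : u n @[n --> \oo] --> l -> l < M ->
  \forall n \near \oo, u n <= M.
Proof.
move=> /cvgrPdist_le h lM.
have d0 : 0 < M - l by rewrite subr_gt0.
near=> n.
have : `|l - u n| <= M - l by near: n; apply: h.
by rewrite distrC => /(le_trans (ler_norm _)); lra.
Unshelve. all: by end_near. Qed.

Lemma near_cvg_ge (u : nat -> R) (l M : R) : u n @[n --> \oo] --> l -> M < l ->
  \forall n \near \oo, M <= u n.
Proof.
move=> /cvgrPdist_le h lM.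
have d0 : 0 < l - M by rewrite subr_gt0.
near=> n.
have : `|l - u n| <= l - M by near: n; apply: h.
by move=> /(le_trans (ler_norm _)); lra.
Unshelve. all: by end_near. Qed.

Lemma near_te_gt0 : \forall n \near \oo, 0 < te n.
Proof.
have h2 : 0 < 1 / 2 :> R by lra.
near=> n.
have ht : 2 <= tau R n by near: n; exact: near_tau_ge.
have [h _] : (1 - 1 / 2) * tau R n <= te n /\ te n <= (1 + 1 / 2) * tau R n.
  by near: n; apply: near_t_ent.
lra.
Unshelve. all: by end_near. Qed.

(** Taking the integer part of s n changes the exponent by a quantity of order
    alpha, which tends to zero, and 1 - y lies between e^(- y / (1 - y)) and
    e^(- y). *)
Lemma rho_pow_cvg (s : nat -> R) (x : R) : (\forall n \near \oo, 0 <= s n) ->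
  alpha n @[n --> \oo] --> 0 -> s n * alpha n @[n --> \oo] --> x ->
  rho m (alpha n) ^+ Num.truncn (s n) @[n --> \oo] --> expR (- (x * c)).
Proof.
move=> s0 ha hs.
have c1 := c_ge1.
pose t n : R := (Num.truncn (s n))%:R.
have htx : t n * alpha n @[n --> \oo] --> x.
  apply: (@squeeze_cvgr _ _ _ _ (fun n => s n * alpha n - alpha n) (fun n => s n * alpha n)) => //.
    near=> n; have [ap _] := halpha n.
    have sn0 : 0 <= s n by near: n.
    have /andP[h1 h2] := truncn_itv sn0.
    rewrite -natr1 in h2.
    have -> : s n * alpha n - alpha n = (s n - 1) * alpha n by ring.
    by rewrite !ler_wpM2r ?(ltW ap) // /t; lra.
  by rewrite -[x]subr0; apply: cvgB.
have hac : 1 - alpha n * c @[n --> \oo] --> (1 : R).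
  by rewrite -[X in _ --> X]subr0; apply: cvgB; [exact: cvg_cst|rewrite -[X in _ --> X](mul0r c); apply: cvgMl].
have up : expR (- (t n * alpha n * c)) @[n --> \oo] --> expR (- (x * c)).
  apply: continuous_cvg; first exact: continuous_expR.
  by apply: cvgN; apply: cvgMl.
have lo : expR (- (t n * alpha n * c / (1 - alpha n * c))) @[n --> \oo] --> expR (- (x * c)).
  apply: continuous_cvg; first exact: continuous_expR.
  apply: cvgN; rewrite -[X in _ --> X]mulr1 -[X in _ * X]invr1.
  by apply: cvgM; [apply: cvgMl|apply: cvgV => //; exact: oner_neq0].
apply: (squeeze_cvgr _ lo up).
have e2 : 0 < (2 * c)^-1 by rewrite invr_gt0 mulr_gt0 // (lt_le_trans ltr01 c1).
near=> n; have [ap _] := halpha n.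
have asm : alpha n <= (2 * c)^-1 by near: n; apply: near_cvg_le ha _.
have y1 : alpha n * c <= 1 / 2.
  have cp : 0 < c := lt_le_trans ltr01 c1.
  apply: le_trans (ler_wpM2r (ltW cp) asm) _.
  by have -> : (2 * c)^-1 * c = 1 / 2; [field; rewrite gt_eqF|exact: lexx].
rewrite rhoE; set y := alpha n * c in y1 *.
have y0 : 0 <= y by rewrite mulr_ge0 ?(ltW ap) // (le_trans ler01).
have y2 : 0 < 1 - y by lra.
have -> : - (t n * alpha n * c) = (Num.truncn (s n))%:R * (- y) by rewrite /t /y; ring.
have -> : - (t n * alpha n * c / (1 - y)) = (Num.truncn (s n))%:R * (- (y / (1 - y))).
  by rewrite /t /y; field; rewrite gt_eqF.
rewrite !expRM_natl; apply/andP; split.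
  rewrite lerXn2r ?nnegrE ?expR_ge0 ?(ltW y2) // expRN -[leRHS]invrK lef_pV2 ?posrE ?invr_gt0 ?expR_gt0 //.
  apply: le_trans (expR_ge1Dx _).
  by have -> : 1 + y / (1 - y) = (1 - y)^-1; [field; rewrite gt_eqF|exact: lexx].
by rewrite lerXn2r ?nnegrE ?expR_ge0 ?(ltW y2) // expR_ge1Dx.
Unshelve. all: by end_near. Qed.

Lemma late_trunc (s : nat -> R) (b : R) : 1 < b -> (\forall n \near \oo, b * tau R n <= s n) ->
  late R (fun n => Num.truncn (s n)).
Proof.
move=> b1 hs; exists ((b - 1) / 2); first by rewrite divr_gt0 // subr_gt0.
near=> n.
have h : b * tau R n <= s n by near: n.
have ht : 2 / (b - 1) <= tau R n by near: n; exact: near_tau_ge.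
have b0 : 0 < b - 1 by rewrite subr_gt0.
have t0 : 0 <= tau R n by apply: le_trans ht; rewrite divr_ge0 // ltW.
have s0 : 0 <= s n by apply: le_trans h; rewrite mulr_ge0 //; lra.
have /andP[_ h2] := truncn_itv s0.
rewrite -natr1 in h2.
rewrite ler_pdivrMr // in ht.
have : (b - 1) / 2 * tau R n = b * tau R n - tau R n - (tau R n * (b - 1)) / 2 by field.
lra.
Unshelve. all: by end_near. Qed.

Lemma late_te (b : R) : 1 < b -> late R (fun n => Num.truncn (b * te n)).
Proof.
move=> b1; have e0 : 0 < (b - 1) / (2 * b) by rewrite divr_gt0 ?subr_gt0 ?mulr_gt0 // (lt_trans ltr01).
apply: (@late_trunc _ ((1 + b) / 2)); first by lra.
near=> n.
have [h _] : (1 - (b - 1) / (2 * b)) * tau R n <= te n /\ te n <= (1 + (b - 1) / (2 * b)) * tau R n.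
  by near: n; apply: near_t_ent.
have b0 : 0 < b by lra.
have -> : (1 + b) / 2 = b * (1 - (b - 1) / (2 * b)) by field; rewrite gt_eqF.
by rewrite -mulrA ler_wpM2l // ltW.
Unshelve. all: by end_near. Qed.

Lemma early_te (b : R) : 0 < b -> b < 1 -> stat_uniform m lam alpha -> forall e : R, 0 < e ->
  whp lam alpha (fun n (w : config m n) => forall x, `|tv_to_stat R (graph_of w) x (Num.truncn (b * te n)) - 1| <= e).
Proof.
move=> b0 b1 hs e e0.
have et0 : 0 < (1 - b) / 2 by rewrite divr_gt0 // subr_gt0.
have et1 : (1 - b) / 2 < 1 by lra.
have ep : 0 < (1 - b) / (2 * b) by rewrite divr_gt0 ?subr_gt0 // mulr_gt0.
apply: (tv_early_whp hm hlam halpha et0 et1 _ hs e0).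
near=> n.
have [_ h] : (1 - (1 - b) / (2 * b)) * tau R n <= te n /\ te n <= (1 + (1 - b) / (2 * b)) * tau R n.
  by near: n; apply: near_t_ent.
have t0 : 0 < te n by near: n; exact: near_te_gt0.
have s0 : 0 <= b * te n by rewrite mulr_ge0 // ltW.
have /andP[h2 _] := truncn_itv s0.
apply: le_trans h2 _.
have -> : 1 - (1 - b) / 2 = b * (1 + (1 - b) / (2 * b)) by field; rewrite gt_eqF.
by rewrite -mulrA ler_wpM2l // ltW.
Unshelve. all: by end_near. Qed.

(** Between (1 + eta / 2) tau and (1 + eta) tau the number of steps is large
    compared with 1 / alpha, and the memory of the community is lost. *)
Lemma memory_fast (b : R) : 1 < b -> (forall M : R, \forall n \near \oo, M <= alpha n * tau R n) ->
  memory m lam alpha (fun n => Num.truncn (b * te n)) (fun=> 0).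
Proof.
move=> b1 hA e e0.
have [eta et0 hlate] := late_te b1.
have e2 : 0 < e / 2 by rewrite divr_gt0.
have et2 : 0 < eta / 2 by rewrite divr_gt0.
have w1 := fast_whp hm hlam halpha (erefl _) (degree_const_gt0 hlam) et2 e2 hA.
apply: (whp_near hm hlam halpha _ w1).
near=> n => w h j x.
have ht : (1 + eta) * tau R n <= (Num.truncn (b * te n))%:R by near: n.
have hta : 4 / eta <= tau R n by near: n; exact: near_tau_ge.
have hat : (2 / e) * (4 / eta) <= alpha n * tau R n by near: n; exact: hA.
have [ap ah] := halpha n.
have t0 : 0 <= tau R n by apply: le_trans hta; rewrite divr_ge0 // ltW.
set t := Num.truncn (b * te n) in ht *.
pose T1 := (Num.truncn ((1 + eta / 2) * tau R n)).+1.
have y0 : 0 <= (1 + eta / 2) * tau R n by rewrite mulr_ge0 // addr_ge0 // ltW.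
have T1l : (1 + eta / 2) * tau R n <= T1%:R by apply: ltW; apply: truncnS_gt.
have T1u : T1%:R <= (1 + eta / 2) * tau R n + 1.
  by rewrite /T1 -natr1 lerD2r; have /andP[] := truncn_itv y0.
rewrite ler_pdivrMr // in hta.
have gap : eta / 4 * tau R n <= t%:R - T1%:R.
  have -> : eta / 4 * tau R n = (1 + eta) * tau R n - (1 + eta / 2) * tau R n - tau R n * eta / 4 by field.
  by move: ht T1u hta; lra.
have Tt : (T1 <= t)%N.
  rewrite -(ler_nat R) -subr_ge0; apply: le_trans gap; rewrite mulr_ge0 //; lra.
rewrite mul0r subr0 -(subnKC Tt); apply: le_trans (h T1 (t - T1)%N T1l j x) _.
have r0 := rho_ge0 hm ah.
have rl : rho m (alpha n) <= expR (- alpha n).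
  apply: le_trans (_ : 1 - alpha n <= _); last exact: expR_ge1Dx.
  by rewrite rhoE lerD2l lerN2 ler_peMr ?(ltW ap) // c_ge1.
have pw : rho m (alpha n) ^+ (t - T1) <= e / 2.
  apply: (@le_trans _ _ (expR (- alpha n) ^+ (t - T1))); first by rewrite lerXn2r ?nnegrE ?expR_ge0.
  rewrite -expRM_natl mulrN expRN -[leRHS]invrK lef_pV2 ?posrE ?invr_gt0 ?expR_gt0 //.
  apply: le_trans (expR_ge1Dx _); rewrite natrB //.
  have h3 : alpha n * (eta / 4 * tau R n) <= alpha n * (t%:R - T1%:R) by rewrite ler_wpM2l // ltW.
  have h4 : 2 / e <= alpha n * (eta / 4 * tau R n).
    have -> : alpha n * (eta / 4 * tau R n) = (alpha n * tau R n) / (4 / eta) by field; rewrite gt_eqF.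
    by rewrite ler_pdivlMr // divr_gt0.
  rewrite invf_div; move: h3 h4; rewrite [_ * alpha n]mulrC; lra.
by rewrite [leRHS]splitr lerD2r.
Unshelve. all: by end_near. Qed.

Lemma stat_fast : (forall M : R, \forall n \near \oo, M <= alpha n * tau R n) -> stat_uniform m lam alpha.
Proof.
move=> hA; apply: stat_uniform_of => // e e0.
exists (fun n => Num.truncn (2 * te n)), (fun=> 0); split => //.
- by apply: memory_fast => //; lra.
- by apply: late_te; lra.
by near=> n; apply: ltW.
Unshelve. all: by end_near. Qed.

Section Slow.
Variable Ca : R.
Hypotheses (Ca0 : 0 < Ca) (hA : \forall n \near \oo, alpha n * tau R n <= Ca).
Hypothesis hM : forall M : R, \forall n \near \oo, M <= alpha n * n%:R * ln n%:R.

Lemma alpha_cvg0 : alpha n @[n --> \oo] --> (0 : R).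
Proof.
apply/cvgrPdist_le => e e0; near=> n.
rewrite sub0r normrN ger0_norm ?(alpha_ge0 halpha) //.
by near: n; apply: (near_alpha_small halpha Ca0 hA).
Unshelve. all: by end_near. Qed.

Lemma memory_slow (s : nat -> R) (x : R) : (\forall n \near \oo, 0 <= s n) -> s n * alpha n @[n --> \oo] --> x ->
  memory m lam alpha (fun n => Num.truncn (s n)) (fun n => rho m (alpha n) ^+ Num.truncn (s n)).
Proof.
move=> s0 hs e e0.
have B0 : 0 <= `|x| + 1 by rewrite addr_ge0.
have w1 := slow_whp hm hlam halpha (erefl _) (degree_const_gt0 hlam) Ca0 B0 e0 hA hM.
apply: (whp_near hm hlam halpha _ w1); near=> n => w h j y.
have hx : s n * alpha n <= `|x| + 1.
  by near: n; apply: near_cvg_le hs _; apply: le_lt_trans (ler_norm _) _; rewrite ltrDl.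
have sn0 : 0 <= s n by near: n.
apply: h; apply: le_trans hx; rewrite ler_wpM2r ?(alpha_ge0 halpha) //.
by have /andP[] := truncn_itv sn0.
Unshelve. all: by end_near. Qed.

Lemma rho_pow_ge0 n k : 0 <= rho m (alpha n) ^+ k.
Proof. by rewrite exprn_ge0 // rho_ge0 //; case: (halpha n). Qed.

(** The times s b n are b times a scale of order 1 / alpha. As b grows their
    memory tends to zero, which forces the stationary law to be uniform. *)
Lemma stat_slow (s : R -> nat -> R) (k : R) : 0 < k -> (forall b, 0 <= b -> \forall n \near \oo, 0 <= s b n) ->
  (forall b, 0 < b -> s b n * alpha n @[n --> \oo] --> b * k) ->
  (forall b, 1 < b -> late R (fun n => Num.truncn (s b n))) ->
  stat_uniform m lam alpha.
Proof.
move=> k0 s0 hs hl; apply: stat_uniform_of => // e e0.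
(* For this b, e^(- b k) <= 1 / (1 + b k) < e. *)
pose b := 2 + (e * k)^-1.
have i0 : 0 < (e * k)^-1 by rewrite invr_gt0 mulr_gt0.
have b1 : 1 < b by rewrite /b; lra.
have b0 : 0 < b by lra.
have sb : \forall n \near \oo, 0 <= s b n by apply: s0; apply: ltW.
exists (fun n => Num.truncn (s b n)), (fun n => rho m (alpha n) ^+ Num.truncn (s b n)); split.
- exact: memory_slow (hs b b0).
- exact: hl.
- by move=> n; apply: rho_pow_ge0.
apply: near_cvg_le (rho_pow_cvg sb alpha_cvg0 (hs b b0)) _.
rewrite expRN -[ltRHS]invrK ltf_pV2 ?posrE ?invr_gt0 ?expR_gt0 //.
apply: lt_le_trans (expR_ge1Dx _).
have h1 : e^-1 <= b * k.
  rewrite /b mulrDl invfM mulfVK ?gt_eqF // lerDr mulr_ge0 //; exact: ltW.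
have h2 : b * k <= b * k * c by rewrite ler_peMr ?c_ge1 // mulr_ge0 // ltW.
lra.
Unshelve. all: by end_near. Qed.

Lemma tv_slow (s : nat -> R) (x : R) : (\forall n \near \oo, 0 <= s n) -> s n * alpha n @[n --> \oo] --> x ->
  late R (fun n => Num.truncn (s n)) -> stat_uniform m lam alpha ->
  cvg_in_pr0 (edge_prob lam) alpha (fun n (G : digraph m n) =>
    max_tv_gap G (Num.truncn (s n)) ((m%:R - 1) / m%:R * expR (- (x * c)))).
Proof.
move=> s0 hs hl hst; apply: (cvg_in_pr0_of_whp hm hlam halpha) => e e0.
apply: (tv_limit_whp hm hlam halpha _ hl _ _ hst e0).
- exact: memory_slow hs.
- by move=> n; apply: rho_pow_ge0.
- exact: rho_pow_cvg alpha_cvg0 hs.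
Qed.
End Slow.

End Regimes.

Section Assembly.
Variables (R : realType) (m : nat) (hm : (1 < m)%N).
Variables (lam : R) (hlam : 1 < lam) (alpha : nat -> R).
Hypothesis halpha : forall n, 0 < alpha n /\ alpha n <= 1 / 2.
Let te := t_ent m lam alpha.

Lemma near_te_tau : \forall n \near \oo, tau R n <= 2 * te n /\ te n <= 2 * tau R n.
Proof.
have h2 : 0 < 1 / 2 :> R by lra.
near=> n.
have ht : 2 <= tau R n by near: n; exact: near_tau_ge.
have [h1 h3] : (1 - 1 / 2) * tau R n <= te n /\ te n <= (1 + 1 / 2) * tau R n.
  by near: n; apply: near_t_ent.
by move: h1 h3; split; lra.
Unshelve. all: by end_near. Qed.

(** This is the subcritical case: the walk uses many rewired edges before the
    entropic time. *)
Lemma many_rewirings : much_less (fun n => (alpha n)^-1) te ->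
  forall M : R, \forall n \near \oo, M <= alpha n * tau R n.
Proof.
move=> h M.
have e0 : 0 < (2 * (`|M| + 1))^-1 by rewrite invr_gt0 mulr_gt0 // ltr_wpDl.
near=> n.
have [_ h2] : tau R n <= 2 * te n /\ te n <= 2 * tau R n by near: n; exact: near_te_tau.
have t0 : 0 < te n by near: n; exact: near_te_gt0.
have ha : (alpha n)^-1 / te n <= (2 * (`|M| + 1))^-1 by near: n; apply: near_cvg_le h e0.
have [ap _] := halpha n.
have mp : 0 < `|M| + 1 by rewrite ltr_wpDl.
have p1 : 0 < alpha n * te n := mulr_gt0 ap t0.
have p2 : 0 < 2 * (`|M| + 1) by rewrite mulr_gt0.
rewrite -invfM lef_pV2 ?posrE // in ha.
have : alpha n * te n <= alpha n * (2 * tau R n) by rewrite ler_wpM2l // ltW.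
have : M <= `|M| by exact: ler_norm.
by move: ha; lra.
Unshelve. all: by end_near. Qed.

Lemma few_rewirings (x : R) : te n * alpha n @[n --> \oo] --> x ->
  \forall n \near \oo, alpha n * tau R n <= 2 * (`|x| + 1).
Proof.
move=> h; near=> n.
have [h2 _] : tau R n <= 2 * te n /\ te n <= 2 * tau R n by near: n; exact: near_te_tau.
have ha : te n * alpha n <= `|x| + 1.
  by near: n; apply: near_cvg_le h _; apply: le_lt_trans (ler_norm _) _; rewrite ltrDl.
have [ap _] := halpha n.
have : alpha n * tau R n <= alpha n * (2 * te n) by rewrite ler_wpM2l // ltW.
by move: ha; rewrite [te n * _]mulrC; lra.
Unshelve. all: by end_near. Qed.

Lemma late_inv (b : R) : 0 < b -> te n * alpha n @[n --> \oo] --> 0 ->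
  late R (fun n => Num.truncn (b * (alpha n)^-1)).
Proof.
move=> b0 h; apply: (@late_trunc _ _ 2); first by lra.
have b4 : 0 < b / 4 by rewrite divr_gt0.
near=> n.
have [h2 _] : tau R n <= 2 * te n /\ te n <= 2 * tau R n by near: n; exact: near_te_tau.
have ha : te n * alpha n <= b / 4 by near: n; apply: near_cvg_le h b4.
have [ap _] := halpha n.
rewrite ler_pdivlMr //.
have : 2 * tau R n * alpha n <= 4 * te n * alpha n.
  by rewrite ler_wpM2r ?(ltW ap) //; move: h2; lra.
by move: ha; lra.
Unshelve. all: by end_near. Qed.

(** In the critical case alpha is of order 1 / tau, so alpha n ln n is of order
    n ln (ln n). *)
Lemma dense_rewirings (k : R) : 0 < k -> te n * alpha n @[n --> \oo] --> k ->
  forall M : R, \forall n \near \oo, M <= alpha n * n%:R * ln n%:R.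
Proof.
move=> k0 h M.
have k2 : k / 2 < k by lra.
near=> n.
have [_ h2] : tau R n <= 2 * te n /\ te n <= 2 * tau R n by near: n; exact: near_te_tau.
have ha : k / 2 <= te n * alpha n by near: n; apply: near_cvg_ge h k2.
have lL1 : 1 <= ln (ln n%:R) :> R by near: n; exact: near_lnln_ge.
have L1 : 1 <= ln n%:R :> R by near: n; exact: near_ln_ge.
have nM : 4 * `|M| / k <= n%:R :> R by near: n; exact: near_nat_ge.
have [ap _] := halpha n.
have hk : k / 4 <= alpha n * tau R n.
  have : te n * alpha n <= 2 * tau R n * alpha n by rewrite ler_wpM2r // ltW.
  by move: ha; lra.
have tl : tau R n <= ln n%:R.
  by rewrite /tau ler_pdivrMr ?(lt_le_trans ltr01) // ler_peMr // (le_trans ler01).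
apply: le_trans (ler_norm M) _.
have -> : `|M| = k / 4 * (4 * `|M| / k) by field; rewrite gt_eqF.
rewrite [leRHS]mulrAC.
have hk2 : k / 4 <= alpha n * ln n%:R.
  by apply: le_trans hk _; rewrite ler_wpM2l // ltW.
apply: ler_pM hk2 nM; first by rewrite divr_ge0 // ltW.
by rewrite divr_ge0 ?mulr_ge0 // ltW.
Unshelve. all: by end_near. Qed.

Lemma dense_of_much_less : much_less (fun n => (alpha n)^-1) (fun n => lam * n%:R * ln n%:R) ->
  forall M : R, \forall n \near \oo, M <= alpha n * n%:R * ln n%:R.
Proof.
move=> h M.
have l0 : 0 < lam := lt_trans ltr01 hlam.
have e0 : 0 < (lam * (`|M| + 1))^-1 by rewrite invr_gt0 mulr_gt0 // ltr_wpDl.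
near=> n.
have L1 : 1 <= ln n%:R :> R by near: n; exact: near_ln_ge.
have n1 : 1 <= n%:R :> R by near: n; exact: near_nat_ge.
have ha : (alpha n)^-1 / (lam * n%:R * ln n%:R) <= (lam * (`|M| + 1))^-1.
  by near: n; apply: near_cvg_le h e0.
have [ap _] := halpha n.
have n0 := lt_le_trans ltr01 n1; have L0 := lt_le_trans ltr01 L1.
have mp : 0 < `|M| + 1 by rewrite ltr_wpDl.
have p1 : 0 < alpha n * (lam * n%:R * ln n%:R) by rewrite !mulr_gt0.
rewrite -invfM lef_pV2 ?posrE // in ha; last by rewrite mulr_gt0.
have e : alpha n * (lam * n%:R * ln n%:R) = lam * (alpha n * n%:R * ln n%:R) by ring.
rewrite e ler_pM2l // in ha.
have : M <= `|M| by exact: ler_norm.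
by move: ha; lra.
Unshelve. all: by end_near. Qed.

End Assembly.

Theorem theorem2 (R : realType) (m : nat) (hm : (2 <= m)%N)
    (lambda : R) (hlambda : 1 < lambda)
    (alpha : nat -> R) (halpha : forall n : nat, 0 < alpha n /\ alpha n <= 1 / 2) :
  (* subcritical case *)
  (much_less (fun n => (alpha n)^-1) (t_ent m lambda alpha) ->
   forall beta : R, 0 < beta -> beta != 1 ->
   cvg_in_pr0 (edge_prob lambda) alpha (fun n (G : digraph m n) =>
     max_tv_gap G (Num.truncn (beta * t_ent m lambda alpha n))
       (beta < 1)%R%:R))
  /\
  (* critical case *)
  (forall C : R, 0 < C ->
   asymp_equiv (fun n => (alpha n)^-1) (fun n => C * t_ent m lambda alpha n) ->
   forall beta : R, 0 < beta -> beta != 1 ->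
   cvg_in_pr0 (edge_prob lambda) alpha (fun n (G : digraph m n) =>
     max_tv_gap G (Num.truncn (beta * t_ent m lambda alpha n))
       ((beta < 1)%R%:R
        + (m%:R - 1) / m%:R * expR (- (beta / C * (m%:R / (m%:R - 1))))
          * (1 < beta)%R%:R)))
  /\
  (* supercritical case *)
  (much_less (t_ent m lambda alpha) (fun n => (alpha n)^-1) ->
   much_less (fun n => (alpha n)^-1) (fun n => lambda * n%:R * ln n%:R) ->
   (forall beta : R, 0 < beta -> beta != 1 ->
    cvg_in_pr0 (edge_prob lambda) alpha (fun n (G : digraph m n) =>
      max_tv_gap G (Num.truncn (beta * t_ent m lambda alpha n))
        ((beta < 1)%R%:R + (m%:R - 1) / m%:R * (1 < beta)%R%:R)))
   /\
   (forall beta : R, 0 < beta ->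
    cvg_in_pr0 (edge_prob lambda) alpha (fun n (G : digraph m n) =>
      max_tv_gap G (Num.truncn (beta * (alpha n)^-1))
        ((m%:R - 1) / m%:R * expR (- (beta * m%:R / (m%:R - 1))))))).
Proof.
set te := t_ent m lambda alpha.
have a0 n : alpha n != 0 by rewrite gt_eqF //; case: (halpha n).
have te_pos := near_te_gt0 hm hlambda halpha.
have te_ge0 b : 0 <= b -> \forall n \near \oo, 0 <= b * te n.
  by move=> b0; near=> n; rewrite mulr_ge0 // ltW //; near: n.
have inv_ge0 b : 0 <= b -> \forall n \near \oo, 0 <= b * (alpha n)^-1.
  by move=> b0; near=> n; rewrite mulr_ge0 // invr_ge0 (alpha_ge0 halpha).
have early b (l : R) : 0 < b -> b < 1 -> l = 1 -> stat_uniform m lambda alpha ->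
    cvg_in_pr0 (edge_prob lambda) alpha (fun n (G : digraph m n) =>
      max_tv_gap G (Num.truncn (b * te n)) l).
  move=> b0 b1 -> hst; apply: (cvg_in_pr0_of_whp hm hlambda halpha).
  exact: early_te.
split; [|split].
- move=> /(many_rewirings hm hlambda halpha) hA beta b0 bn1.
  have hst := stat_fast hm hlambda halpha hA.
  have [b1|b1] := ltP beta 1; first exact: early.
  have {bn1}b1 : 1 < beta by rewrite lt_neqAle eq_sym bn1.
  apply: (cvg_in_pr0_of_whp hm hlambda halpha) => e e0.
  have := tv_limit_whp hm hlambda halpha (memory_fast hm hlambda halpha b1 hA)
    (late_te hm hlambda halpha b1) (fun=> lexx 0) (cvg_cst 0) hst e0.
  by rewrite mulr0; apply.
- move=> C C0 hC beta b0 bn1.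
  have i0 : 0 < C^-1 by rewrite invr_gt0.
  have hk : te n * alpha n @[n --> \oo] --> C^-1.
    have : (C^-1 * ((alpha n)^-1 / (C * te n))^-1) @[n --> \oo] --> C^-1 * 1^-1.
      by apply: cvgMr; apply: cvgV => //; exact: oner_neq0.
    rewrite invr1 mulr1; apply: cvg_trans; apply: near_eq_cvg; near=> n.
    have t0 : 0 < te n by near: n.
    by field; rewrite a0 !gt_eqF.
  have hM := dense_rewirings hm hlambda halpha i0 hk.
  have hA := few_rewirings hm hlambda halpha hk.
  have Ca0 : 0 < 2 * (`|C^-1| + 1) by rewrite mulr_gt0 // ltr_wpDl.
  have hs b : b * te n * alpha n @[n --> \oo] --> b * C^-1.
    by under eq_fun do rewrite -mulrA; apply: cvgMr.
  have hst := stat_slow hm hlambda halpha Ca0 hA hM i0 te_ge0 (fun b _ => hs b)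
    (fun b => late_te hm hlambda halpha (b := b)).
  have [b1|b1] := ltP beta 1.
    by apply: early => //; rewrite ltNge (ltW b1) /= mulr0 addr0.
  have {bn1}b1 : 1 < beta by rewrite lt_neqAle eq_sym bn1.
  rewrite b1 /= mulr1 add0r.
  exact: (tv_slow hm hlambda halpha Ca0 hA hM (te_ge0 _ (ltW b0)) (hs beta)
    (late_te hm hlambda halpha b1) hst).
- move=> h1 h2.
  have hk : te n * alpha n @[n --> \oo] --> 0.
    by move: h1; rewrite /much_less; under eq_fun do rewrite invrK.
  have hM := dense_of_much_less hlambda halpha h2.
  have hA := few_rewirings hm hlambda halpha hk.
  have Ca0 : (0 : R) < 2 * (`|(0 : R)| + 1) by rewrite normr0 add0r mulr1.
  have hs b : b * (alpha n)^-1 * alpha n @[n --> \oo] --> b.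
    by under eq_fun do rewrite mulfVK //; exact: cvg_cst.
  have hst : stat_uniform m lambda alpha.
    apply: (stat_slow (s := fun b n => b * (alpha n)^-1) (k := 1) hm hlambda halpha Ca0 hA hM ltr01 inv_ge0) => b hb.
      by rewrite mulr1; exact: hs.
    by apply: (late_inv hm hlambda halpha) hk; apply: lt_trans hb.
  split=> beta b0.
    move=> bn1; have [b1|b1] := ltP beta 1.
      by apply: early => //; rewrite ltNge (ltW b1) /= mulr0 addr0.
    have {bn1}b1 : 1 < beta by rewrite lt_neqAle eq_sym bn1.
    rewrite b1 /= mulr1 add0r.
    have hs0 : beta * te n * alpha n @[n --> \oo] --> 0.
      by rewrite -[X in _ --> X](mulr0 beta); under eq_fun do rewrite -mulrA; apply: cvgMr.
    have := tv_slow hm hlambda halpha Ca0 hA hM (te_ge0 _ (ltW b0)) hs0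
      (late_te hm hlambda halpha b1) hst.
    by rewrite mul0r oppr0 expR0 mulr1.
  rewrite -[beta * m%:R / _]mulrA.
  exact: (tv_slow hm hlambda halpha Ca0 hA hM (inv_ge0 _ (ltW b0)) (hs beta)
    (late_inv hm hlambda halpha b0 hk) hst).
Unshelve. all: by end_near. Qed.
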